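(* Let $\mathfrak g=\mathfrak q(\infty)$ and let $M$ and $N$ be two non-isomorphic simple objects of the category $\mathcal B^{\mathrm{Int}}$ of integrable bounded weight $\mathfrak g$-modules. Then $\operatorname{Ext}^1_{\mathfrak g,\mathfrak h}(M,N)=0$ and $$\operatorname{Ext}^1_{\mathfrak g,\mathfrak h}(M,M)=\begin{cases}0&\text{if }M\not\cong\Pi M,\\ \mathbb C&\text{if }M\cong\Pi M.\end{cases}$$
   Context: Everything is over $\mathbb C$; modules are $\mathbb Z_2$-graded, homomorphisms preserve parity, and $\Pi$ is the parity change functor. $\mathfrak q(n)\subset\mathfrak{gl}(n|n)$ is the Lie superalgebra of matrices $\begin{pmatrix} A & B \\ B & A \end{pmatrix}$, and $\mathfrak q(\infty)=\varinjlim\mathfrak q(n)$ along the embeddings $\mathfrak q(n)\hookrightarrow\mathfrak q(n+1)$ adding zero rows and columns. $\mathfrak h$ is the subalgebra of diagonal matrices in the even part $\mathfrak g_{\bar 0}\cong\mathfrak{gl}(\infty)$. A $\mathfrak g$-module $M$ is integrable if $\dim\operatorname{span}\{v,gv,g^2v,\dots\}<\infty$ for all $v\in M$, $g\in\mathfrak g$; it is a weight module if it is the direct sum of its $\mathfrak h$-weight spaces $M^\lambda=\{v: hv=\lambda(h)v\ \forall h\in\mathfrak h\}$, $\lambda\in\mathfrak h^*$; a weight module is bounded if there is $k\in\mathbb Z_{>0}$ with $\dim M^\lambda\le k$ for all $\lambda$. $\mathcal B^{\mathrm{Int}}$ is the full subcategory of $\mathfrak g$-modules whose objects are the integrable bounded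 weight modules. $\operatorname{Ext}^1_{\mathfrak g,\mathfrak h}$ denotes the extension group in the category of $\mathfrak h$-weight $\mathfrak g$-modules.
   Formalization: ''Non-isomorphic'' is strengthened to: M is isomorphic neither to N nor to ΠN. Without this the first claim fails, e.g. M = C trivial, N = ΠC, where the odd trace gives a non-split extension; it fails for every M ≅ ΠN with M not isomorphic to N. *)

(* Defs.v *)
From mathcomp Require Import all_boot all_order all_algebra.
From mathcomp Require Import finmap monalg.
From mathcomp Require Import reals complex.

Set Implicit Arguments.
Unset Strict Implicit.
Unset Printing Implicit Defensive.

Import GRing.Theory.
Local Open Scope ring_scope.

(* The ground field K is arbitrary here; the theorem is about K = R[i], the
   complex numbers over R : realType. *)

(* ------------------------------------------------------------------------ *)
(* The Lie superalgebra q(oo)                                               *)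

(* gl(oo): matrices with rows and columns indexed by nat and finitely many
   nonzero entries, i.e. the union of the 'M[K]_n along the embeddings adding
   zero rows and columns.  The entry (i, j) of A is A@_(i, j). *)
Definition glinf (K : fieldType) : lmodType K := {malg K[(nat * nat)%type]}.

Definition fmulmx (K : fieldType) (A B : glinf K) : glinf K :=
  \sum_(u <- msupp A) \sum_(v <- msupp B | u.2 == v.1)
     << A@_u * B@_v *g (u.1, v.2) >>.

(* (A, B) : qinf K stands for the block matrix
     [ A B ]
     [ B A ]
   of gl(oo|oo), so that qinf K is the union of the q(n). *)
Definition qinf (K : fieldType) : lmodType K := (glinf K * glinf K)%type.

(* The product of two such block matrices is of the same form. *)
Definition qmul (K : fieldType) (x y : qinf K) : qinf K :=
  (fmulmx x.1 y.1 + fmulmx x.2 y.2, fmulmx x.1 y.2 + fmulmx x.2 y.1).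

(* Parities: false is even, true is odd. *)
Definition qpar (K : fieldType) (a : bool) (x : qinf K) : Prop :=
  if a then x.1 = 0 else x.2 = 0.

(* The Lie superbracket [x, y] of x, y homogeneous of parities a, b; it is only
   meaningful for such x, y. *)
Definition qbr (K : fieldType) (a b : bool) (x y : qinf K) : qinf K :=
  qmul x y - (-1) ^+ (a && b) *: qmul y x.

(* The Cartan subalgebra: finitely supported sequences d, embedded as the even
   diagonal matrices. *)
Definition cartan (K : fieldType) : lmodType K := {malg K[nat]}.

Definition cdiag (K : fieldType) (d : cartan K) : qinf K :=
  (\sum_(i <- msupp d) << d@_i *g (i, i) >>, 0).

(* ------------------------------------------------------------------------ *)
(* Z/2-graded q(oo)-modules                                                 *)

Record smod (K : fieldType) := SMod {
  smod_car :> lmodType K;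
  (* par b is the subspace of homogeneous elements of parity b *)
  par : bool -> smod_car -> Prop;
  act : qinf K -> smod_car -> smod_car;
  par_linear : forall b (c : K) v w,
    par b v -> par b w -> par b (c *: v + w);
  par_zero : forall b, par b 0;
  par_span : forall v, exists v0 v1,
    [/\ par false v0, par true v1 & v = v0 + v1];
  par_direct : forall v, par false v -> par true v -> v = 0;
  act_linear : forall x, linear (act x);
  act_linearl : forall v, linear (act^~ v);
  act_par : forall a b x v, qpar a x -> par b v -> par (a (+) b) (act x v);
  act_br : forall a b x y v, qpar a x -> qpar b y ->
    act (qbr a b x y) v
      = act x (act y v) - (-1) ^+ (a && b) *: act y (act x v)
}.

Arguments par {K} s b v.
Arguments act {K} s x v.

Definition is_hom (K : fieldType) (M N : smod K) (f : M -> N) : Prop :=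
  [/\ linear f,
      forall b v, par M b v -> par N b (f v)
    & forall x v, f (act M x v) = act N x (f v)].

Definition smod_iso (K : fieldType) (M N : smod K) : Prop :=
  exists (f : M -> N) (g : N -> M),
    [/\ is_hom f, is_hom g, cancel f g & cancel g f].

(* The parity change functor.  The other usual convention, where odd elements
   act on Pi M with an additional sign, gives an isomorphic module
   (via v |-> (-1)^(parity of v) v). *)
Section ParityChange.
Variables (K : fieldType) (M : smod K).

Let ppar b v := par M (~~ b) v.

Let ppar_span v : exists v0 v1, [/\ ppar false v0, ppar true v1 & v = v0 + v1].
Proof.
have [v0 [v1 [h0 h1 ->]]] := par_span v.
by exists v1, v0; rewrite addrC.
Qed.

Let ppar_direct v : ppar false v -> ppar true v -> v = 0.
Proof. by move=> h1 h0; apply: par_direct. Qed.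

Let ppar_act a b x v : qpar a x -> ppar b v -> ppar (a (+) b) (act M x v).
Proof. by move=> hx hv; rewrite /ppar -addbN; apply: act_par. Qed.

Definition Pi : smod K :=
  @SMod K M ppar (act M) (fun b => @par_linear K M (~~ b))
    (fun b => par_zero M (~~ b)) ppar_span ppar_direct
    (@act_linear K M) (@act_linearl K M) ppar_act (@act_br K M).

End ParityChange.

Section DirectSum.
Variables (K : fieldType) (M N : smod K).

Let dcar : lmodType K := (M * N)%type.
Let dpar b (v : dcar) := par M b v.1 /\ par N b v.2.
Let dact x (v : dcar) : dcar := (act M x v.1, act N x v.2).

Let dpar_linear b (c : K) v w : dpar b v -> dpar b w -> dpar b (c *: v + w).
Proof. by move=> [? ?] [? ?]; split; apply: par_linear. Qed.

Let dpar_zero b : dpar b 0.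
Proof. by split; apply: par_zero. Qed.

Let dpar_span v : exists v0 v1, [/\ dpar false v0, dpar true v1 & v = v0 + v1].
Proof.
case: v => m n; have [m0 [m1 [? ? ->]]] := par_span m.
have [n0 [n1 [? ? ->]]] := par_span n.
by exists (m0, n0), (m1, n1).
Qed.

Let dpar_direct v : dpar false v -> dpar true v -> v = 0.
Proof.
case: v => m n [/= m0 n0] [/= m1 n1].
by rewrite (par_direct m0 m1) (par_direct n0 n1).
Qed.

Let dact_linear x : linear (dact x).
Proof. by move=> c u v; rewrite /dact /= !act_linear. Qed.

Let dact_linearl v : linear (dact^~ v).
Proof.
move=> c x y; rewrite /dact.
by rewrite (act_linearl v.1 c x y) (act_linearl v.2 c x y).
Qed.

Let dact_par a b x v : qpar a x -> dpar b v -> dpar (a (+) b) (dact x v).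
Proof. by move=> hx [? ?]; split; apply: act_par. Qed.

Let dact_br a b x y v : qpar a x -> qpar b y ->
  dact (qbr a b x y) v
    = dact x (dact y v) - (-1) ^+ (a && b) *: dact y (dact x v).
Proof. by move=> hx hy; rewrite /dact !(act_br _ hx hy). Qed.

Definition dsum : smod K :=
  @SMod K dcar dpar dact dpar_linear dpar_zero dpar_span dpar_direct
    dact_linear dact_linearl dact_par dact_br.

End DirectSum.

(* ------------------------------------------------------------------------ *)
(* The category of integrable bounded weight modules                        *)

Definition lin_span (K : fieldType) (V : lmodType K) (f : nat -> V) (v : V) :
    Prop :=
  exists n (c : 'I_n -> K), v = \sum_(i < n) c i *: f i.

(* dim U <= k, for a subspace U *)
Definition dim_le (K : fieldType) (V : lmodType K) (U : V -> Prop) (k : nat) :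
    Prop :=
  exists e : 'I_k -> V, (forall i, U (e i)) /\
    forall v, U v -> exists c : 'I_k -> K, v = \sum_(i < k) c i *: e i.

Definition integrable (K : fieldType) (M : smod K) : Prop :=
  forall (x : qinf K) (v : M),
    exists k, dim_le (lin_span (fun n => iter n (act M x) v)) k.

Definition weight_space (K : fieldType) (M : smod K)
    (lam : {scalar cartan K}) (v : M) : Prop :=
  forall h : cartan K, act M (cdiag h) v = lam h *: v.

(* M is the direct sum of its weight spaces. *)
Definition weight_module (K : fieldType) (M : smod K) : Prop :=
  (forall v : M, exists n (lam : 'I_n -> {scalar cartan K}) (w : 'I_n -> M),
     (forall i, weight_space (lam i) (w i)) /\ v = \sum_(i < n) w i) /\
  (forall n (lam : 'I_n -> {scalar cartan K}) (w : 'I_n -> M),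
     (forall i j, lam i =1 lam j -> i = j) ->
     (forall i, weight_space (lam i) (w i)) ->
     \sum_(i < n) w i = 0 -> forall i, w i = 0).

Definition bounded (K : fieldType) (M : smod K) : Prop :=
  exists k : nat, (0 < k)%N /\
    forall lam : {scalar cartan K}, dim_le (@weight_space K M lam) k.

Definition in_BInt (K : fieldType) (M : smod K) : Prop :=
  [/\ weight_module M, integrable M & bounded M].

Definition graded_submodule (K : fieldType) (M : smod K) (U : M -> Prop) :
    Prop :=
  [/\ U 0,
      forall (c : K) u v, U u -> U v -> U (c *: u + v),
      forall x v, U v -> U (act M x v)
    & forall v, U v -> exists v0 v1,
        [/\ U v0 /\ par M false v0, U v1 /\ par M true v1 & v = v0 + v1]].

Definition simple (K : fieldType) (M : smod K) : Prop :=
  (exists v : M, v <> 0) /\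
  forall U : M -> Prop, graded_submodule U ->
    (forall v, U v -> v = 0) \/ (forall v, U v).

(* ------------------------------------------------------------------------ *)
(* Ext^1 in the category of weight modules (Yoneda extensions)              *)

(* Short exact sequences 0 -> N -> E -> M -> 0. *)
Record ses (K : fieldType) (M N : smod K) := Ses {
  mid : smod K;
  inc : N -> mid;
  prj : mid -> M;
  inc_hom : is_hom inc;
  prj_hom : is_hom prj;
  inc_inj : injective inc;
  prj_surj : forall m, exists e, prj e = m;
  ses_exact : forall e, prj e = 0 <-> exists n, e = inc n
}.

Arguments inc {K M N} s n.
Arguments prj {K M N} s e.

Record ext (K : fieldType) (M N : smod K) := Ext {
  ext_ses :> ses M N;
  ext_weight : weight_module (mid ext_ses)
}.

(* There is a morphism of short exact sequences E -> E' inducing al on the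
   submodules and ga on the quotients. *)
Definition ses_morph (K : fieldType) (M N M' N' : smod K)
    (al : N -> N') (ga : M -> M') (E : ses M N) (E' : ses M' N') : Prop :=
  exists f : mid E -> mid E',
    [/\ is_hom f, forall n, f (inc E n) = inc E' (al n)
      & forall e, prj E' (f e) = ga (prj E e)].

Definition ses_equiv (K : fieldType) (M N : smod K) (E E' : ses M N) : Prop :=
  ses_morph (fun n : N => n) (fun m : M => m) E E'.

Section SesSum.
Variables (K : fieldType) (M1 M2 N1 N2 : smod K).
Variables (E1 : ses M1 N1) (E2 : ses M2 N2).

Let sinc (n : dsum N1 N2) : dsum (mid E1) (mid E2) :=
  (inc E1 n.1, inc E2 n.2).
Let sprj (e : dsum (mid E1) (mid E2)) : dsum M1 M2 :=
  (prj E1 e.1, prj E2 e.2).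

Let sinc_hom : is_hom sinc.
Proof.
have [l1 p1 a1] := inc_hom E1; have [l2 p2 a2] := inc_hom E2.
split=> [c u v|b v [h1 h2]|x v].
- by rewrite /sinc /= l1 l2.
- by split; [apply: p1 | apply: p2].
- by rewrite /sinc /= a1 a2.
Qed.

Let sprj_hom : is_hom sprj.
Proof.
have [l1 p1 a1] := prj_hom E1; have [l2 p2 a2] := prj_hom E2.
split=> [c u v|b v [h1 h2]|x v].
- by rewrite /sprj /= l1 l2.
- by split; [apply: p1 | apply: p2].
- by rewrite /sprj /= a1 a2.
Qed.

Let sinc_inj : injective sinc.
Proof. by move=> [? ?] [? ?] [] /inc_inj -> /inc_inj ->. Qed.

Let sprj_surj m : exists e, sprj e = m.
Proof.
case: m => m1 m2; have [e1 <-] := prj_surj E1 m1.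
by have [e2 <-] := prj_surj E2 m2; exists (e1, e2).
Qed.

Let ssum_exact e : sprj e = 0 <-> exists n, e = sinc n.
Proof.
case: e => e1 e2; split=> [[h1 h2]|[[n1 n2] [-> ->]]].
  have [[n1 ->] [n2 ->]] := ((ses_exact e1).1 h1, (ses_exact e2).1 h2).
  by exists (n1, n2).
have h1 : prj E1 (inc E1 n1) = 0 by apply/ses_exact; exists n1.
have h2 : prj E2 (inc E2 n2) = 0 by apply/ses_exact; exists n2.
by rewrite /sprj /= h1 h2.
Qed.

Definition ses_sum : ses (dsum M1 M2) (dsum N1 N2) :=
  Ses sinc_hom sprj_hom sinc_inj sprj_surj ssum_exact.

End SesSum.

(* E is the Baer sum of E1 and E2: with D : M -> M + M the diagonal and
   S : N + N -> N the addition, F is the pullback of E1 + E2 along D and E is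
   the pushout of F along S.  Pullbacks and pushouts of short exact sequences
   are determined up to equivalence by the existence of these morphisms. *)
Definition baer_sum (K : fieldType) (M N : smod K) (E1 E2 E : ses M N) : Prop :=
  exists F : ses M (dsum N N),
    ses_morph (fun n : dsum N N => n) (fun m : M => (m, m) : dsum M M)
      F (ses_sum E1 E2) /\
    ses_morph (fun n : dsum N N => n.1 + n.2) (fun m : M => m) F E.

(* E' is c times E: the pushout of E along multiplication by c on N. *)
Definition ses_scale (K : fieldType) (M N : smod K) (c : K) (E E' : ses M N) :
    Prop :=
  ses_morph (fun n : N => c *: n) (fun m : M => m) E E'.

(* The vector space Ext^1(M, N), i.e. the extensions modulo equivalence with
   the Baer sum and the above scalar multiplication, is isomorphic to W.  The
   isomorphism is given as a map on extensions, not on a quotient type: the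
   extensions do not live in the universe over which lmodType ranges. *)
Definition Ext1_isomorphic (K : fieldType) (M N : smod K) (W : lmodType K) :
    Prop :=
  exists cl : ext M N -> W,
    [/\ forall E E' : ext M N, cl E = cl E' <-> ses_equiv E E',
        forall w, exists E, cl E = w,
        forall E1 E2 E : ext M N, baer_sum E1 E2 E -> cl E = cl E1 + cl E2
      & forall c (E E' : ext M N), ses_scale c E E' -> cl E' = c *: cl E].

(* Simple modules have to be distinguished up to a change of parity: the trivial
   module K is not isomorphic to Pi K, yet 0 -> Pi K -> E -> K -> 0 does not
   split when (A, B) acts on E = K + Pi K by the odd map \tr B : K -> Pi K. *)
Definition iso_up_to_parity (K : fieldType) (M N : smod K) : Prop :=
  smod_iso M N \/ smod_iso M (Pi N).

(* Main.v *)
(* Let M and N be simple.  The odd Cartan elements H_i square to E_ii, so on a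
   weight space of dimension <= k at most k^2 entries of the weight are nonzero.
   A weight of maximal support then has entries 1 and -1 (other entries could be
   split by sl_2-theory), in fact all of the same sign since otherwise a single
   weight space would contain infinitely many independent vectors.  Hence, up to
   the twist by the automorphism (A, B) |-> (- A^T, i B^T), the weights of M are
   sequences of natural numbers of a fixed sum d, and extensions of modules of
   different degrees split.

   On an extension E of polynomial modules of degree d, all H_i with i outside
   the support of a weight act in the same way; this defines an odd endomorphism
   theta with theta^2 = 0.  It vanishes on simple modules, so it amounts to an odd
   map t : M -> N, which is zero unless M is isomorphic to Pi N and is unique up
   to a scalar in that case.  It remains to see that t determines the extension.
   Subtracting otr(x) theta, where otr (A, B) = tr B, from the action of x, one may
   assume that H_i acts by zero at the weights with entry 0 at i.  Then E is
   determined by its weight (1,...,1,0,...): a linear projection p to N at this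
   weight, averaged over the Clifford group of H_1, ..., H_d and over the parity
   operator, extends to a retraction E -> N by
     v |-> 1/d! sum_f (prod_a E_(f a, a)) p (prod_a E_(a, f a)) v,
   f ranging over the maps from d auxiliary indices to the other indices. *)

From HB Require Import structures.
Require Import Defs.
From mathcomp Require Import all_boot all_order all_algebra.
From mathcomp Require Import finmap monalg.
From mathcomp Require Import boolp classical_sets reals complex.
From mathcomp Require Import ring zify.

Set Implicit Arguments.
Unset Strict Implicit.
Unset Printing Implicit Defensive.

Import GRing.Theory Num.Theory Order.TTheory.
Local Open Scope ring_scope.

(** * Representations by matrix units and their weights *)

(** The averaging formula needs auxiliary indices outside the support of $v$, and no choice of them
    serves all $v$. Moreover the projection at the weight $(1,\dots,1,0,\dots)$ commutes only with
    $H_1,\dots,H_d$ and the parity operator, so results for different auxiliary indices need not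
    agree a priori. The formula is therefore applied twice. Auxiliary indices $0,\dots,d-1$ give a
    map on the vectors supported from $d$ on, equivariant for every matrix unit on those indices.
    This map is the input for auxiliary indices $m,\dots,m+d-1$ and vectors supported in $[0,m)$,
    for every $m\ge d$. By its equivariance the results agree on common vectors, and the retraction
    is their eventual value. The $d$-fold sum is performed one index at a time. Each step is a
    Casimir-type sum whose eigenvalue is the number of units still to be moved; the product of these
    eigenvalues is $d!$. That every odd intertwiner $t$ occurs rests on [otr] vanishing on
    superbrackets: adding $\operatorname{otr}(x)\,t$ to the action on $N\oplus M$ again gives a
    module. *)

Definition mklin (K : pzRingType) (V W : lmodType K) (f : V -> W)
  (hf : linear f) : {linear V -> W} :=
  HB.pack f (GRing.isLinear.Build K V W *:%R f hf).

(** The eventual value of a sequence, which gives meaning to operators at infinity such as [theta].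
    The default 0 is for sequences that do not stabilize. *)
Definition evlim (K : pzRingType) (V : lmodType K) (u : nat -> V) : V :=
  xget 0 [set l | exists n0, forall n, (n0 <= n)%N -> u n = l]%classic.

Lemma evlim_eq (K : pzRingType) (V : lmodType K) (u : nat -> V) (l : V) n0 :
  (forall n, (n0 <= n)%N -> u n = l) -> evlim u = l.
Proof.
move=> hu; rewrite /evlim; case: xgetP => [l' _ [n1 hl']|/(_ l) []]; last first.
  by exists n0.
by rewrite -(hl' (maxn n0 n1)) ?hu ?leq_maxl ?leq_maxr.
Qed.

(* The action of q(oo) through the matrix units [e i j] = (E_ij, 0) and
   [o i j] = (0, E_ij), together with the parity operator. *)
Record qrep (K : numFieldType) (V : lmodType K) := QRep {
  qe : nat -> nat -> {linear V -> V};
  qo : nat -> nat -> {linear V -> V};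
  qs : {linear V -> V};
  qee : forall i j k l v, qe i j (qe k l v) =
    qe k l (qe i j v) + qe i l v *+ (j == k) - qe k j v *+ (l == i);
  qeo : forall i j k l v, qe i j (qo k l v) =
    qo k l (qe i j v) + qo i l v *+ (j == k) - qo k j v *+ (l == i);
  qoo : forall i j k l v, qo i j (qo k l v) =
    - qo k l (qo i j v) + qe i l v *+ (j == k) + qe k j v *+ (l == i);
  qss : forall v, qs (qs v) = v;
  qse : forall i j v, qs (qe i j v) = qe i j (qs v);
  qso : forall i j v, qs (qo i j v) = - qo i j (qs v)
}.

Definition wt (K : numFieldType) (V : lmodType K) (q : qrep V) (a : nat -> K)
  (v : V) := forall i, qe q i i v = a i *: v.

(** Terms may vanish and weights may repeat, so that this form survives operators acting by a scalar
    on each term, such as [qe q b b - c]. *)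
Fixpoint wsum (K : numFieldType) (V : lmodType K) (q : qrep V)
    (P : (nat -> K) -> Prop) (n : nat) (v : V) : Prop :=
  if n is n'.+1 then
    exists a w u, [/\ P a, wt q a w, wsum q P n' u & v = w + u]
  else v = 0.

(** The weights of the $d$-th tensor power of the natural representation; [n] is any bound for the
    support. *)
Definition posw (K : numFieldType) (d : nat) (a : nat -> K) : Prop :=
  exists (m : nat -> nat) n, [/\ forall i, a i = (m i)%:R,
    forall i, (n <= i)%N -> m i = 0%N & (\sum_(i < n) m i = d)%N].

Definition polyrep (K : numFieldType) (V : lmodType K) (q : qrep V)
  (d : nat) : Prop := forall v, exists n, wsum q (posw d) n v.

Section WeightSums.
Variables (K : numFieldType) (V : lmodType K) (q : qrep V).
Implicit Types (P : (nat -> K) -> Prop) (v w : V).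

Lemma wtZ a c v : wt q a v -> wt q a (c *: v).
Proof. by move=> h i; rewrite linearZ /= h !scalerA mulrC. Qed.

Lemma wsumZ P n c v : wsum q P n v -> wsum q P n (c *: v).
Proof.
elim: n v => [|n ih] v /=; first by move=> ->; rewrite scaler0.
move=> [a [w [u [pa hw hu ->]]]]; exists a, (c *: w), (c *: u).
by split=> //; [apply: wtZ | apply: ih | rewrite scalerDr].
Qed.

Lemma wsum_sub P n b c v :
  wsum q P n v -> wsum q P n (qe q b b v - c *: v).
Proof.
elim: n v => [|n ih] v /=; first by move=> ->; rewrite linear0 scaler0 subrr.
move=> [a [w [u [pa hw hu ->]]]].
exists a, ((a b - c) *: w), (qe q b b u - c *: u); split=> //.
- exact: wtZ.
- exact: ih.
- by rewrite linearD hw scalerDr scalerBl opprD addrACA.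
Qed.

(* If the weight [a] of the first term is wrong at [b], replacing [v] by a
   multiple of (E_bb - a b) v, which is [v] again, removes this term. *)
Lemma wsum_joint P n v (B : nat -> Prop) (c : nat -> K) :
  wsum q P n v -> (forall b, B b -> qe q b b v = c b *: v) ->
  exists n', wsum q (fun a => P a /\ forall b, B b -> a b = c b) n' v.
Proof.
elim: n v => [|n ih] v /=; first by move=> -> _; exists 0%N.
move=> [a [w [u [pa hw hu ev]]]] hv.
case: (EM (forall b, B b -> a b = c b)) => [hab|].
  have eu : u = v - w by rewrite ev addrC addKr.
  case: (ih u hu) => [b hb|n' hn'].
    by rewrite eu linearB scalerBr hv // hw hab.
  by exists n'.+1, a, w, u.
move=> /existsNP [b /not_implyP [hb hab]].
have hne : c b - a b != 0 by rewrite subr_eq0 eq_sym; apply/eqP.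
have ev2 : v = (c b - a b)^-1 *: (qe q b b u - a b *: u).
  have <- : (c b - a b) *: v = qe q b b u - a b *: u.
    rewrite scalerBl -hv // {1}ev linearD hw ev scalerDr opprD addrACA subrr.
    by rewrite add0r.
  by rewrite scalerA mulVf // scale1r.
apply: (ih v) => //; rewrite ev2; apply: wsumZ; exact: wsum_sub.
Qed.

Lemma wsum_absurd P n v : (forall a, ~ P a) -> wsum q P n v -> v = 0.
Proof.
by move=> hP; case: n => [//|n] [a [? [? [/hP]]]].
Qed.

(** Takes the place of projecting to a joint eigenspace: by [wsum_joint] only weights compatible
    with the known eigenvalues of [v] have to be considered. *)
Lemma wsum_ind_joint P n v (B : nat -> Prop) (c : nat -> K) (Q : V -> Prop) :
  Q 0 -> (forall u w, Q u -> Q w -> Q (u + w)) ->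
  (forall a w, P a -> wt q a w -> (forall b, B b -> a b = c b) -> Q w) ->
  wsum q P n v -> (forall b, B b -> qe q b b v = c b *: v) -> Q v.
Proof.
move=> Q0 QD hQ hv hb; have [n' {hv}] := wsum_joint hv hb.
elim: n' v {hb} => [|n' ih] v /=; first by move->.
by move=> [a [w [u [[pa ha] hw hu ->]]]]; apply: QD; [apply: hQ ha | apply: ih].
Qed.

End WeightSums.

Section Polynomial.
Variables (K : numFieldType) (V : lmodType K) (q : qrep V) (d : nat).
Hypothesis hq : polyrep q d.

Lemma poly_neg c v : qe q c c v = - v -> v = 0.
Proof.
move=> hv; have [n hn] := hq v.
apply: (wsum_ind_joint (B := fun b => b = c) (c := fun=> -1) (Q := fun v => v = 0) _ _ _ hn).
- by [].
- by move=> u w -> ->; rewrite addr0.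
- move=> a w [m [n0 [hm _ _]]] _ /(_ _ erefl); rewrite hm => /eqP.
  by rewrite -addr_eq0 natr1 pnatr_eq0.
- by move=> b ->; rewrite hv scaleN1r.
Qed.

(** Lowering an entry 0 would create the entry $-1$, which no polynomial weight has. *)
Lemma poly_free_e j c v : qe q c c v = 0 -> j != c -> qe q j c v = 0.
Proof.
move=> hv hj; apply: (@poly_neg c).
by rewrite qee hv linear0 eq_sym (negPf hj) eqxx mulr0n addr0 sub0r.
Qed.

Lemma poly_free_o j c v : qe q c c v = 0 -> j != c -> qo q j c v = 0.
Proof.
move=> hv hj; apply: (@poly_neg c).
by rewrite qeo hv linear0 eq_sym (negPf hj) eqxx mulr0n addr0 sub0r.
Qed.

Lemma poly_fresh v : exists n0, forall c, (n0 <= c)%N -> qe q c c v = 0.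
Proof.
have [n] := hq v; elim: n v => [|n ih] v /=.
  by move=> ->; exists 0%N => c _; rewrite linear0.
move=> [a [w [u [[m [n1 [hm hm0 _]]] hw /ih [n2 h2] ->]]]].
exists (maxn n1 n2) => c; rewrite geq_max => /andP [h1c h2c].
by rewrite linearD h2 // hw hm hm0 // scale0r addr0.
Qed.

Lemma poly_degree v : exists n0, forall n, (n0 <= n)%N ->
  \sum_(i < n) qe q i i v = d%:R *: v.
Proof.
have [n] := hq v; elim: n v => [|n ih] v /=.
  by move=> ->; exists 0%N => c _; rewrite big1 ?scaler0 // => i _; rewrite linear0.
move=> [a [w [u [[m [n1 [hm hm0 hs]]] hw /ih [n2 h2] ->]]]].
exists (maxn n1 n2) => c; rewrite geq_max => /andP [h1c h2c].
under eq_bigr do rewrite linearD.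
rewrite big_split /= h2 // scalerDr; congr (_ + _).
under eq_bigr do rewrite hw hm.
rewrite -scaler_suml -natr_sum; congr (_%:R *: _).
rewrite -hs -!(big_mkord xpredT) (big_cat_nat (leq0n n1) h1c) /=.
have -> : (\sum_(n1 <= i < c) m i = 0)%N.
  by rewrite big_nat_cond big1 // => i /andP [/andP [/hm0]].
by rewrite addn0.
Qed.

End Polynomial.

(** * Splitting: polarization and restitution *)

Lemma sum_nat_delta (V : zmodType) lo hi k (F : nat -> V) :
  (lo <= k < hi)%N -> \sum_(lo <= j < hi) F j *+ (j == k) = F k.
Proof.
move=> hk; rewrite (bigD1_seq k) ?mem_index_iota ?iota_uniq //= eqxx mulr1n.
by rewrite big1 ?addr0 // => j /negPf ->; rewrite mulr0n.
Qed.

Lemma sum_nat_sub (R : Type) (idx : R) (op : Monoid.law idx) lo hi n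
    (F : nat -> R) : (hi <= n)%N ->
  \big[op/idx]_(0 <= i < n | (lo <= i < hi)%N) F i =
  \big[op/idx]_(lo <= i < hi) F i.
Proof.
move=> hn; rewrite (@big_nat_widen _ _ _ lo hi n) // (@big_nat_widenl _ _ _ lo 0) //.
by apply: eq_bigl => i /=; rewrite andbC.
Qed.

Section Split.
Variables (K : numFieldType) (V : lmodType K) (q : qrep V) (d : nat).
Hypothesis hq : polyrep q d.
Hypothesis hfree : forall c v, qe q c c v = 0 -> qo q c c v = 0.
Variable NN : V -> Prop.
Hypothesis NN0 : NN 0.
Hypothesis NNl : forall (c : K) u v, NN u -> NN v -> NN (c *: u + v).
Hypothesis NNe : forall i j v, NN v -> NN (qe q i j v).
Local Notation e := (qe q).
Local Notation o := (qo q).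
Local Notation sg := (qs q).

(* Vectors obtained from those with weights supported in [lo, hi) by moving s
   units of weight to the indices b, ..., b + s - 1. *)
Definition stage lo hi b s (v : V) : Prop :=
  (forall c, (b <= c < b + s)%N -> e c c v = v) /\
  (forall c, ~~ (b <= c < b + s)%N -> ~~ (lo <= c < hi)%N -> e c c v = 0).

Lemma stage_lin lo hi b s (c : K) u v :
  stage lo hi b s u -> stage lo hi b s v -> stage lo hi b s (c *: u + v).
Proof.
move=> [h1 h2] [h3 h4]; split=> x hx; first by rewrite linearP h1 // h3.
by move=> hx'; rewrite linearP h2 // h4 // scaler0 addr0.
Qed.

Lemma stage0 lo hi b s : stage lo hi b s 0.
Proof. by split=> *; rewrite linear0. Qed.

Lemma qe_diag c i j v :
  e c c (e i j v) = e i j (e c c v) + e i j v *+ (c == i) - e i j v *+ (j == c).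
Proof.
rewrite qee; congr (_ + _ - _).
  by case: eqP => [->|].
by case: eqP => [->|].
Qed.

Lemma qeo_diag c i j v :
  e c c (o i j v) = o i j (e c c v) + o i j v *+ (c == i) - o i j v *+ (j == c).
Proof.
rewrite qeo; congr (_ + _ - _).
  by case: eqP => [->|].
by case: eqP => [->|].
Qed.

Lemma stage_raise lo hi b s j v :
  ~~ (lo <= b + s < hi)%N -> (lo <= j < hi)%N -> (hi <= b \/ b + s <= lo)%N ->
  stage lo hi b s v -> stage lo hi b s.+1 (e (b + s)%N j v).
Proof.
move=> ha hj hd [h1 h2]; split=> c.
  rewrite addnS ltnS => /andP [hc1 hc2]; rewrite qe_diag.
  have [->|hne] := eqVneq c (b + s)%N.
    rewrite h2 // ?linear0 ?add0r; last by rewrite ltnn andbF.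
    have -> : (j == b + s)%N = false by apply: contraNF ha => /eqP <-.
    by rewrite subr0.
  rewrite h1; last by lia.
  have -> : (j == c)%N = false by lia.
  by rewrite mulr0n addr0 subr0.
move=> hc hc'; rewrite qe_diag.
have -> : (c == b + s)%N = false by lia.
have -> : (j == c)%N = false by lia.
rewrite h2 //; last by lia.
by rewrite linear0 mulr0n addr0 subr0.
Qed.

Lemma stage_lower lo hi b s j v :
  (lo <= j < hi)%N -> (hi <= b \/ b + s.+1 <= lo)%N ->
  stage lo hi b s.+1 v -> stage lo hi b s (e j (b + s)%N v).
Proof.
move=> hj hd [h1 h2]; split=> c hc.
  rewrite qe_diag h1; last by lia.
  have -> : (c == j)%N = false by lia.
  have -> : (b + s == c)%N = false by lia.
  by rewrite mulr0n addr0 subr0.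
move=> hc'; rewrite qe_diag.
have -> : (c == j)%N = false by lia.
have [<-|hne] := eqVneq (b + s)%N c.
  by rewrite h1 ?mulr0n ?mulr1n ?addr0 ?subrr //; lia.
by rewrite h2 ?linear0 ?mulr0n ?addr0 ?subrr //; lia.
Qed.

Lemma stage_e lo hi b s k l v :
  (lo <= k < hi)%N -> (lo <= l < hi)%N -> (hi <= b \/ b + s <= lo)%N ->
  stage lo hi b s v -> stage lo hi b s (e k l v).
Proof.
move=> hk hl hd [h1 h2]; split=> c hc; first last.
  move=> hc'; rewrite qe_diag h2 // linear0.
  have -> : (c == k)%N = false by lia.
  have -> : (l == c)%N = false by lia.
  by rewrite addr0 subr0.
rewrite qe_diag h1 //.
have -> : (c == k)%N = false by lia.
have -> : (l == c)%N = false by lia.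
by rewrite addr0 subr0.
Qed.

Lemma stage_o lo hi b s k l v :
  (lo <= k < hi)%N -> (lo <= l < hi)%N -> (hi <= b \/ b + s <= lo)%N ->
  stage lo hi b s v -> stage lo hi b s (o k l v).
Proof.
move=> hk hl hd [h1 h2]; split=> c hc; first last.
  move=> hc'; rewrite qeo_diag h2 // linear0.
  have -> : (c == k)%N = false by lia.
  have -> : (l == c)%N = false by lia.
  by rewrite addr0 subr0.
rewrite qeo_diag h1 //.
have -> : (c == k)%N = false by lia.
have -> : (l == c)%N = false by lia.
by rewrite addr0 subr0.
Qed.

Lemma stage_oc lo hi b s k v : stage lo hi b s v -> stage lo hi b s (o k k v).
Proof.
move=> [h1 h2]; split=> c hc; first by rewrite qeo_diag eq_sym addrK h1.
by move=> hc'; rewrite qeo_diag eq_sym addrK h2 // linear0.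
Qed.

Lemma stage_s lo hi b s v : stage lo hi b s v -> stage lo hi b s (sg v).
Proof.
move=> [h1 h2]; split=> c hc; first by rewrite -qse h1.
by move=> hc'; rewrite -qse h2 // linear0.
Qed.

(** The [d] auxiliary units exhaust the total degree, so every other entry of the weight is 0. *)
Lemma stage_top lo hi b v c :
  (hi <= b \/ b + d <= lo)%N -> stage lo hi b d v -> ~~ (b <= c < b + d)%N ->
  e c c v = 0.
Proof.
move=> hd [h1 h2] hc; have [n hn] := hq v.
pose B x := (b <= x < b + d)%N \/ ~~ (lo <= x < hi)%N.
apply: (wsum_ind_joint (B := B) (c := fun x => (b <= x < b + d)%N%:R)
  (Q := fun v => e c c v = 0) _ _ _ hn).
- by rewrite linear0.
- by move=> u w hu hw; rewrite linearD hu hw addr0.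
- move=> a w [m [n0 [hm hm0 hs]]] hw ha; rewrite hw.
  have hm1 x : (b <= x < b + d)%N -> m x = 1%N.
    move=> hx; have := ha x (or_introl hx); rewrite hm hx => /eqP.
    by rewrite eqr_nat => /eqP.
  suff -> : a c = 0 by rewrite scale0r.
  rewrite hm; apply/eqP; rewrite pnatr_eq0 -leqn0.
  have hsN N : (n0 <= N)%N -> (\sum_(0 <= i < N) m i = d)%N.
    move=> hN; rewrite -hs -(big_mkord xpredT m) (big_cat_nat (leq0n n0) hN) /=.
    have -> : (\sum_(n0 <= i < N) m i = 0)%N.
      by rewrite big_nat_cond big1 // => i /andP [/andP [/hm0]].
    by rewrite addn0.
  have := hsN (maxn n0 (maxn (b + d) c.+1)) (leq_maxl _ _).
  set N := maxn _ _ => hN.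
  rewrite -(leq_add2l d) addn0 -{2}hN (bigID (fun i => b <= i < b + d)%N) /=.
  have -> : (\sum_(0 <= i < N | b <= i < b + d) m i = d)%N.
    rewrite (eq_bigr (fun=> 1%N)); last by move=> i /hm1.
    rewrite sum_nat_sub ?sum_nat_const_nat ?muln1 ?addKn //.
    by rewrite /N !leq_max leqnn orbT.
  rewrite leq_add2l big_mkcond (bigD1_seq c) ?iota_uniq ?mem_index_iota //=.
    by rewrite hc leq_addr.
  by rewrite /N !leq_max leqnn !orbT.
- move=> x; rewrite /B; case: (boolP (b <= x < b + d)%N) => hx.
    by move=> _; rewrite h1 // scale1r.
  by case=> // hx'; rewrite scale0r h2.
Qed.

(** Of the total degree [d], the auxiliary indices carry [s]; the rest sits in the window. *)
Lemma stage_sum lo hi b s v :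
  (hi <= b \/ b + s <= lo)%N -> (s <= d)%N -> stage lo hi b s v ->
  \sum_(lo <= j < hi) e j j v = (d - s)%:R *: v.
Proof.
move=> hd hs [h1 h2]; have [n0 hn0] := poly_degree hq v.
pose N := maxn n0 (maxn hi (b + s)).
have := hn0 N (leq_maxl _ _).
rewrite -(big_mkord xpredT (fun i => e i i v)) (bigID (fun i => lo <= i < hi)%N) /=.
rewrite sum_nat_sub; last by rewrite /N !leq_max leqnn orbT.
rewrite [X in _ + X](bigID (fun i => b <= i < b + s)%N) /=.
rewrite [X in _ + (X + _)](eq_bigl (fun i => b <= i < b + s)%N); last first.
  by move=> i /=; lia.
rewrite sum_nat_sub; last by rewrite /N !leq_max leqnn !orbT.
rewrite [X in _ + (_ + X)]big1; last by move=> i /andP [? ?]; rewrite h2.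
rewrite addr0; have -> : \sum_(b <= i < b + s) e i i v = \sum_(b <= i < b + s) v.
  by apply: eq_big_nat => i /h1.
rewrite sumr_const_nat addKn => h.
by rewrite natrB // scalerBl -h scaler_nat addrK.
Qed.

Definition Phi lo hi a (p : V -> V) (v : V) : V :=
  \sum_(lo <= j < hi) e j a (p (e a j v)).

(** The invariant of the iteration, required only on the stage, since [p] is arbitrary elsewhere. At
    the auxiliary indices only the odd Cartan elements are kept: they suffice to carry the
    equivariance for odd matrix units of the window through one step. *)
Record good lo hi b s (p : V -> V) : Prop := Good {
  g_lin : forall (c : K) u v, stage lo hi b s u -> stage lo hi b s v ->
    p (c *: u + v) = c *: p u + p v;
  g_st : forall v, stage lo hi b s v -> stage lo hi b s (p v);
  g_in : forall v, stage lo hi b s v -> NN (p v);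
  g_e : forall k l v, (lo <= k < hi)%N -> (lo <= l < hi)%N ->
    stage lo hi b s v -> p (e k l v) = e k l (p v);
  g_o : forall k l v, (lo <= k < hi)%N -> (lo <= l < hi)%N ->
    stage lo hi b s v -> p (o k l v) = o k l (p v);
  g_oc : forall c v, (b <= c < b + s)%N ->
    stage lo hi b s v -> p (o c c v) = o c c (p v);
  g_s : forall v, stage lo hi b s v -> p (sg v) = sg (p v)
}.

Lemma good0 lo hi b s p : good lo hi b s p -> p 0 = 0.
Proof.
move=> hp; have := g_lin hp 1 (stage0 _ _ _ _) (stage0 _ _ _ _).
by rewrite scaler0 add0r scale1r => /eqP; rewrite -subr_eq subrr eq_sym => /eqP.
Qed.

Lemma goodDb lo hi b s p u v (x : bool) : good lo hi b s p ->
  stage lo hi b s u -> stage lo hi b s v -> p (u + v *+ x) = p u + p v *+ x.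
Proof.
move=> hp hu hv; case: x; last by rewrite !mulr0n !addr0.
by rewrite !mulr1n -[u]scale1r (g_lin hp) // !scale1r.
Qed.

Lemma stage_sum_in lo hi b s lo' hi' (F : nat -> V) :
  (forall j, (lo' <= j < hi')%N -> stage lo hi b s (F j)) ->
  stage lo hi b s (\sum_(lo' <= j < hi') F j).
Proof.
move=> h; rewrite big_nat; elim/big_rec: _ => [|j x hj hx].
  exact: stage0.
by rewrite -[F j]scale1r; apply: stage_lin => //; apply: h.
Qed.

(** The commutator of [e a j] and [o a a] is [- o a j], and [o a a] kills [v] by [hfree]. So an odd
    matrix unit into a free index is replaced by an even one followed by an odd Cartan element. *)
Lemma qo_free_lower j a v : j != a -> e a a v = 0 ->
  o a j v = o a a (e a j v).
Proof.
move=> hj hv; have := qeo q a j a a v.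
rewrite (negPf hj) eqxx (hfree hv) linear0 mulr0n addr0 mulr1n => /eqP.
by rewrite eq_sym subr_eq0 => /eqP.
Qed.

Lemma qo_raise k a v : k != a -> e a a v = v -> o k a v = e k a (o a a v).
Proof.
move=> hk hv; rewrite qeo eqxx eq_sym (negPf hk) mulr0n subr0 mulr1n.
rewrite hfree ?add0r //.
by rewrite qe_diag hv eqxx eq_sym (negPf hk) mulr0n mulr1n addr0 subrr.
Qed.

(** Moving a matrix unit with indices [k], [l] through $\sum_j E_{ja}\,p\,E_{aj}$ leaves two
    boundary terms, at $j=k$ and $j=l$, which cancel. For odd units they become comparable only
    after both are expressed through [o a a], by [qo_free_lower] and [qo_raise]. *)
Lemma goodP lo hi b s p : (hi <= b \/ b + s.+1 <= lo)%N ->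
  good lo hi b s.+1 p -> good lo hi b s (Phi lo hi (b + s)%N p).
Proof.
move=> hd hp.
have hd' : (hi <= b \/ b + s <= lo)%N by lia.
have hna : ~~ (lo <= b + s < hi)%N by lia.
have hr j v : (lo <= j < hi)%N -> stage lo hi b s v ->
    stage lo hi b s.+1 (e (b + s)%N j v) by move=> *; apply: stage_raise.
have ha v : stage lo hi b s v -> e (b + s)%N (b + s)%N v = 0.
  by case=> _; apply=> //; rewrite ltnn andbF.
have ha1 v : stage lo hi b s.+1 v -> e (b + s)%N (b + s)%N v = v.
  by case=> h _; apply: h; rewrite addnS leqnn leq_addr.
have hne j : (lo <= j < hi)%N -> (j == b + s)%N = false.
  by move=> hj; apply: contraNF hna => /eqP <-.
split.
- move=> c u v hu hv; rewrite /Phi scaler_sumr -big_split /=.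
  apply: eq_big_nat => j hj.
  by rewrite linearP (g_lin hp) ?linearP; auto.
- move=> v hv; apply: stage_sum_in => j hj; apply: stage_lower => //.
  by apply: (g_st hp); apply: hr.
- move=> v hv; rewrite /Phi big_nat; elim/big_rec: _ => // j x hj hx.
  by rewrite -[e _ _ _]scale1r; apply: NNl => //; apply/NNe/(g_in hp)/hr.
- move=> k l v hk hl hv; rewrite /Phi linear_sum /=.
  pose F j := p (e (b + s)%N j v).
  rewrite (eq_big_nat _ _ (F2 := fun j => e k l (e j (b + s)%N (F j))
    + e j (b + s)%N (F l) *+ (j == k) - e k (b + s)%N (F j) *+ (j == l))).
    rewrite sumrB big_split /= !sum_nat_delta //; exact: addrK.
  move=> j hj; rewrite qee hne // mulr0n subr0.
  rewrite (goodDb _ hp); [|by apply: stage_e; auto; lia|by auto].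
  rewrite (g_e hp); auto.
  rewrite linearD linearMn /= [e j _ (e k l _)]qee (eq_sym _ k) hne // mulr0n.
  by rewrite addr0 (eq_sym l) addrAC.
- move=> k l v hk hl hv; rewrite /Phi linear_sum /=.
  pose F j := p (e (b + s)%N j v).
  rewrite (eq_big_nat _ _ (F2 := fun j => o k l (e j (b + s)%N (F j))
    + e j (b + s)%N (o (b + s)%N (b + s)%N (F l)) *+ (j == k)
    - o k (b + s)%N (F j) *+ (j == l))).
    rewrite sumrB big_split /= !sum_nat_delta // -qo_raise ?addrK ?hne //.
    by apply: ha1; apply: (g_st hp); auto.
  move=> j hj; rewrite qeo hne // mulr0n subr0.
  rewrite [o _ l v]qo_free_lower ?hne //; last exact: ha.
  rewrite (goodDb _ hp); [|by apply: stage_o; auto; lia|].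
    rewrite (g_o hp); auto.
    rewrite (g_oc hp); [|lia|by auto].
    rewrite linearD linearMn /= [e j _ (o k l _)]qeo (eq_sym _ k) hne // mulr0n.
    by rewrite addr0 (eq_sym l) addrAC.
  by apply: stage_oc; auto.
- move=> c v hc hv; rewrite /Phi linear_sum; apply: eq_big_nat => j hj /=.
  have h1 : (c == b + s)%N = false by lia.
  have h2 : (j == c)%N = false by lia.
  rewrite qeo h2 (eq_sym c) eq_sym h1 !mulr0n addr0 subr0.
  rewrite (g_oc hp); [|lia|by auto].
  by rewrite qeo (eq_sym _ c) h1 eq_sym h2 !mulr0n addr0 subr0.
- move=> v hv; rewrite /Phi linear_sum; apply: eq_big_nat => j hj /=.
  by rewrite -qse (g_s hp) ?qse; auto.
Qed.

Lemma goodZ lo hi b s p (c : K) : good lo hi b s p ->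
  good lo hi b s (fun v => c *: p v).
Proof.
move=> hp; split=> [x u v hu hv|v hv|v hv|k l v hk hl hv|k l v hk hl hv|k v hk hv|v hv].
- by rewrite (g_lin hp) // scalerDr !scalerA mulrC.
- by rewrite -[c *: _]addr0; apply: stage_lin; [apply: g_st hp _ _|apply: stage0].
- by rewrite -[c *: _]addr0; apply: NNl => //; apply: g_in hp _ _.
- by rewrite (g_e hp) // linearZ.
- by rewrite (g_o hp) // linearZ.
- by rewrite (g_oc hp) // linearZ.
- by rewrite (g_s hp) // linearZ.
Qed.

(* [Psi lo hi b p k] is meant on [stage lo hi b (d - k)], [p] being given at
   stage d. *)
Fixpoint Psi lo hi b (p : V -> V) k : V -> V :=
  if k is k'.+1 then Phi lo hi (b + (d - k))%N (Psi lo hi b p k') else p.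

Lemma good_Psi lo hi b p k : (hi <= b \/ b + d <= lo)%N -> (k <= d)%N ->
  good lo hi b d p -> good lo hi b (d - k)%N (Psi lo hi b p k).
Proof.
move=> hd + hp; elim: k => [|k ih] hk; first by rewrite subn0.
rewrite [Psi _ _ _ _ _]/=; apply: goodP; first by lia.
by rewrite subnSK //; apply: ih; apply: ltnW.
Qed.

Lemma Psi0 lo hi b p k : p 0 = 0 -> Psi lo hi b p k 0 = 0.
Proof.
move=> hp; elim: k => [//|k ih] /=.
by rewrite /Phi big1 // => j _; rewrite linear0 ih linear0.
Qed.

Lemma stage_sub lo hi b s lo' hi' b' v :
  (lo' <= lo)%N -> (hi <= hi')%N -> (lo' <= b)%N -> (b + s <= hi')%N ->
  stage lo hi b s v -> stage lo' hi' b' 0 v.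
Proof.
move=> h1 h2 h3 h4 [_ hv]; split=> c hc; first by lia.
by move=> hc'; apply: hv; lia.
Qed.

(** The auxiliary index [b + s] is free, so $E_{ja}E_{aj}v=E_{jj}v$ for $a=b+s$, and the sum counts
    the weight left in the window. *)
Lemma stage_casimir lo hi b s v :
  (hi <= b \/ b + s.+1 <= lo)%N -> (s <= d)%N -> stage lo hi b s v ->
  \sum_(lo <= j < hi) e j (b + s)%N (e (b + s)%N j v) = (d - s)%:R *: v.
Proof.
move=> hd hs hv; rewrite -(stage_sum _ hs hv); last by lia.
have ha : e (b + s)%N (b + s)%N v = 0 by apply: hv.2; lia.
apply: eq_big_nat => j hj; have hja : j != (b + s)%N by lia.
by rewrite qee (poly_free_e hq ha hja) linear0 add0r !eqxx ha subr0.
Qed.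

(** If [R] is equivariant on a window containing both the old window and the auxiliary indices, it
    can be pulled out of every sum; the remaining Casimir sums have eigenvalues $1,\dots,k$. With
    [R] the identity this shows that [NN] is fixed, with [R] another retraction that the two
    agree. *)
Lemma Psi_scale lo hi b p lo2 hi2 b2 (Q : V -> Prop) (R : V -> V) (c : K) k :
  (hi <= b \/ b + d <= lo)%N ->
  (lo2 <= lo)%N -> (hi <= hi2)%N -> (lo2 <= b)%N -> (b + d <= hi2)%N ->
  (forall i j v, Q v -> Q (e i j v)) ->
  (forall (c : K) u v, stage lo2 hi2 b2 0 u -> stage lo2 hi2 b2 0 v ->
    R (c *: u + v) = c *: R u + R v) ->
  (forall k l v, (lo2 <= k < hi2)%N -> (lo2 <= l < hi2)%N ->
    stage lo2 hi2 b2 0 v -> R (e k l v) = e k l (R v)) ->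
  (forall v, stage lo hi b d v -> Q v -> p v = c *: R v) ->
  (k <= d)%N -> forall v, stage lo hi b (d - k)%N v -> Q v ->
  Psi lo hi b p k v = (c * k`!%:R) *: R v.
Proof.
move=> hd h1 h2 h3 h4 hQ hRl hRe hp.
have R0 : R 0 = 0.
  have := hRl 1 0 0 (stage0 _ _ _ _) (stage0 _ _ _ _).
  by rewrite scaler0 add0r scale1r => /eqP; rewrite -subr_eq subrr eq_sym => /eqP.
elim: k => [|k ih] hk v; first by rewrite subn0 mulr1; apply: hp.
move=> hv Qv; rewrite [Psi _ _ _ _ _]/= /Phi.
have [a ea] : {a | a = (b + (d - k.+1))%N} by exists (b + (d - k.+1))%N.
rewrite -!ea.
have hst s u : (s <= d)%N -> stage lo hi b s u -> stage lo2 hi2 b2 0 u.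
  by move=> hs; apply: stage_sub => //; lia.
have hsv := hst _ _ (leq_subr _ _) hv.
have hin j : (lo <= j < hi)%N -> (lo2 <= j < hi2)%N by lia.
have ha : (lo2 <= a < hi2)%N by lia.
have hs1 j : (lo <= j < hi)%N -> stage lo hi b (d - k.+1).+1 (e a j v).
  by move=> hj; rewrite ea; apply: stage_raise => //; lia.
have hs2 j : (lo <= j < hi)%N -> stage lo hi b (d - k.+1) (e j a (e a j v)).
  by move=> hj; rewrite {1}ea; apply: stage_lower => //; [lia|exact: hs1].
rewrite (eq_big_nat _ _ (F2 := fun j => (c * k`!%:R) *: R (e j a (e a j v)))).
  have hRs r (F : nat -> V) : (forall j, j \in r -> stage lo2 hi2 b2 0 (F j)) ->
      \sum_(j <- r) R (F j) = R (\sum_(j <- r) F j).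
    elim: r => [|x r IH] hF; first by rewrite !big_nil R0.
    rewrite !big_cons IH => [|j hj]; last by apply: hF; rewrite inE hj orbT.
    rewrite -[in RHS](scale1r (F x)) hRl ?scale1r //.
      by apply: hF; rewrite inE eqxx.
    rewrite big_seq; elim/big_rec: _ => [|j y hj hy]; first exact: stage0.
    rewrite -[F j]scale1r; apply: stage_lin => //.
    by apply: hF; rewrite inE hj orbT.
  rewrite -scaler_sumr hRs.
    rewrite ea stage_casimir //; [|lia|lia].
    rewrite -[_ *: v]addr0 hRl ?R0 ?addr0 ?scalerA //; last exact: stage0.
    by rewrite subKn // -mulrA -natrM mulnC -factS.
  by move=> j; rewrite mem_index_iota => /hs2; apply: hst; lia.
move=> j hj; rewrite ih; [|lia| |exact: hQ].
  rewrite linearZ /= -hRe //; auto.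
  by apply: hst (hs1 _ hj); lia.
by rewrite -(subnSK hk); apply: hs1.
Qed.

(** A window index outside the support of [v] contributes nothing, as no unit can be taken from an
    entry 0. *)
Lemma Psi_mono lo hi lo' hi' b p k v : (hi' <= b \/ b + d <= lo')%N ->
  (lo' <= lo)%N -> (lo <= hi)%N -> (hi <= hi')%N -> p 0 = 0 -> (k <= d)%N ->
  stage lo hi b (d - k)%N v -> Psi lo' hi' b p k v = Psi lo hi b p k v.
Proof.
move=> hd h1 h2 h3 hp; elim: k v => [//|k ih] v hk hv.
rewrite [LHS]/= [RHS]/= /Phi; have [a ea] : {a | a = (b + (d - k.+1))%N} by exists (b + (d - k.+1))%N.
rewrite -!ea.
have hz j : (lo' <= j < hi')%N -> ~~ (lo <= j < hi)%N ->
    e j a (Psi lo' hi' b p k (e a j v)) = 0.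
  move=> hj hj'; have hj0 : e j j v = 0 by apply: hv.2 => //; lia.
  have hja : a != j by lia.
  by rewrite (poly_free_e hq hj0 hja) Psi0 ?linear0.
rewrite (big_cat_nat h1) /=; last by lia.
rewrite (big_cat_nat h2 h3) /=.
rewrite big_nat big1 ?add0r; last by move=> j hj; apply: hz; lia.
rewrite [X in _ + X]big_nat [X in _ + X]big1 ?addr0; last first.
  by move=> j hj; apply: hz; lia.
apply: eq_big_nat => j hj; rewrite ih //; first by lia.
by rewrite ea -(subnSK hk); apply: stage_raise => //; lia.
Qed.

(** At the top stage all entries in the window are 0, so its matrix units kill both [v] and [p v],
    and equivariance for them is automatic. *)
Lemma good_base lo hi b p : (hi <= b \/ b + d <= lo)%N ->
  (forall (c : K) u v, stage lo hi b d u -> stage lo hi b d v ->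
    p (c *: u + v) = c *: p u + p v) ->
  (forall v, stage lo hi b d v -> stage lo hi b d (p v)) ->
  (forall v, stage lo hi b d v -> NN (p v)) ->
  (forall c v, (b <= c < b + d)%N -> stage lo hi b d v ->
    p (o c c v) = o c c (p v)) ->
  (forall v, stage lo hi b d v -> p (sg v) = sg (p v)) ->
  good lo hi b d p.
Proof.
move=> hd h1 h2 h3 h4 h5.
have p0 : p 0 = 0.
  have := h1 1 0 0 (stage0 _ _ _ _) (stage0 _ _ _ _).
  by rewrite scaler0 add0r scale1r => /eqP; rewrite -subr_eq subrr eq_sym => /eqP.
have he l v : (lo <= l < hi)%N -> stage lo hi b d v -> e l l v = 0.
  by move=> hl hv; apply: (stage_top hd hv); lia.
split=> // k l v hk hl hv.
  have [->|hkl] := eqVneq k l; first by rewrite (he _ v) ?(he _ (p v)) ?p0; auto.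
  by rewrite (poly_free_e hq (he l v hl hv)) ?(poly_free_e hq (he l (p v) hl _)); auto.
have [->|hkl] := eqVneq k l.
  by rewrite (hfree (he l v hl hv)) (hfree (he l (p v) hl (h2 v hv))).
by rewrite (poly_free_o hq (he l v hl hv)) ?(poly_free_o hq (he l (p v) hl _)); auto.
Qed.

(** The averaged projection. The window of [stage d d 0 d] is empty, so this stage is the weight
    space with [d] entries 1 followed by zeros. *)
Variable p0 : V -> V.
Hypothesis p0_lin : forall (c : K) u v, stage d d 0 d u -> stage d d 0 d v ->
  p0 (c *: u + v) = c *: p0 u + p0 v.
Hypothesis p0_st : forall v, stage d d 0 d v -> stage d d 0 d (p0 v).
Hypothesis p0_in : forall v, stage d d 0 d v -> NN (p0 v).
Hypothesis p0_id : forall v, stage d d 0 d v -> NN v -> p0 v = v.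
Hypothesis p0_oc : forall c v, (c < d)%N -> stage d d 0 d v ->
  p0 (o c c v) = o c c (p0 v).
Hypothesis p0_s : forall v, stage d d 0 d v -> p0 (sg v) = sg (p0 v).

Lemma stage_top_eq hi v : stage d hi 0 d v <-> stage d d 0 d v.
Proof.
split=> hv; split=> c hc; try exact: hv.1.
  by move=> _; apply: stage_top hv _ => //; right.
by move=> _; apply: hv.2 => //; lia.
Qed.

Let p0_good m : good d m 0 d p0.
Proof.
apply: good_base => [|c u v /stage_top_eq hu /stage_top_eq hv|v /stage_top_eq hv
  |v /stage_top_eq hv|c v hc /stage_top_eq hv|v /stage_top_eq hv].
- by right.
- exact: p0_lin.
- by apply/stage_top_eq/p0_st.
- exact: p0_in.
- exact: p0_oc.
- exact: p0_s.
Qed.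

(* [r0 m] lives on the vectors supported in [d, m), with auxiliary indices
   0, ..., d - 1.  The maps [r m] below, which live on the vectors supported in
   [0, m), are built from it with auxiliary indices m, ..., m + d - 1; they agree
   with each other because [r0], unlike [p0], is equivariant for the indices
   in [d, m). *)
Let r0 m v := (d`!%:R)^-1 *: Psi d m 0 p0 d v.

Let fact_neq0 : d`!%:R != 0 :> K.
Proof. by rewrite pnatr_eq0 -lt0n fact_gt0. Qed.

Let r0_good m : good d m 0 0 (r0 m).
Proof.
rewrite -[X in good d m 0 X](subnn d); apply: goodZ; apply: good_Psi => //.
by right.
Qed.

Let r0_id m v : (d <= m)%N -> stage d m 0 0 v -> NN v -> r0 m v = v.
Proof.
move=> hm hv Nv; rewrite /r0.
rewrite (@Psi_scale _ _ _ _ 0 (m + d) 0 NN id 1) ?mul1r //; try by [right|lia].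
- by rewrite scalerA mulVf ?scale1r.
- by move=> u /stage_top_eq hu Nu; rewrite scale1r p0_id.
- by rewrite subnn.
Qed.

Let r0_mono m m' v : (d <= m)%N -> (m <= m')%N -> stage d m 0 0 v ->
  r0 m' v = r0 m v.
Proof.
move=> h1 h2 hv; rewrite /r0 (@Psi_mono d m) ?subnn //; first by right.
exact: good0 (p0_good m).
Qed.

Let r m v := (d`!%:R)^-1 *: Psi 0 m m (r0 (m + d)) d v.

(** With [d] units on $m,\dots,m+d-1$ all other entries vanish, in particular those below [d]. *)
Let r_base m v : (d <= m)%N -> stage 0 m m d v -> stage d (m + d) 0 0 v.
Proof.
move=> hm hv; split=> c hc; first by lia.
by move=> hc'; apply: (stage_top _ hv); [left|lia].
Qed.

Let r0_good2 m : (d <= m)%N -> good 0 m m d (r0 (m + d)).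
Proof.
move=> hm; have hg := r0_good (m + d).
have r00 := good0 hg.
apply: good_base => [|c u v /(r_base hm) hu /(r_base hm) hv|v hv|v /(r_base hm) hv
  |c v hc /(r_base hm) hv|v /(r_base hm) hv].
- by left.
- exact: (g_lin hg).
- split=> c hc; first by rewrite -(g_e hg) ?hv.1 //; try lia; apply: r_base.
  move=> hc'; case: (boolP (d <= c < m + d)%N) => hc2.
    rewrite -(g_e hg) ?hv.2 //; exact: r_base.
  by apply: (g_st hg _).2 => //; apply: r_base.
- exact: (g_in hg).
- by apply: (g_o hg) => //; lia.
- exact: (g_s hg).
Qed.

Let r_good m : (d <= m)%N -> good 0 m m 0 (r m).
Proof.
move=> hm; rewrite -[X in good 0 m m X](subnn d); apply: goodZ.
by apply: good_Psi => //; [left|apply: r0_good2].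
Qed.

Let r_id m v : (d <= m)%N -> stage 0 m m 0 v -> NN v -> r m v = v.
Proof.
move=> hm hv Nv; rewrite /r.
rewrite (@Psi_scale _ _ _ _ 0 (m + d) 0 NN id 1) ?mul1r //; try by [left|lia].
- by rewrite scalerA mulVf ?scale1r.
- move=> u /(r_base hm) hu Nu; rewrite scale1r r0_id //; lia.
- by rewrite subnn.
Qed.

(** For such [v] the window [[0, m)] may be shrunk to [[d, m)]. The map [r0 (m + d)] is already
    equivariant on [[d, m + d)], so [Psi] only multiplies it by $d!$. *)
Let r_r0 m n v : (d <= n)%N -> (n + d <= m)%N -> stage d (n + d) 0 0 v ->
  r m v = r0 (n + d) v.
Proof.
move=> h1 h2 hv; rewrite -(@r0_mono _ (m + d)) //; try lia.
have hv2 : stage d m m 0 v.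
  by split=> c hc; [lia|move=> hc'; apply: hv.2; lia].
have hg := r0_good (m + d).
rewrite /r (@Psi_mono d m) ?subnn //; try by [left|lia]; last exact: good0 hg.
rewrite (@Psi_scale _ _ _ _ d (m + d) 0 (fun=> True) (r0 (m + d)) 1) ?subnn //;
  try by [left|lia].
- by rewrite mul1r scalerA mulVf ?scale1r.
- exact: (g_lin hg).
- exact: (g_e hg).
- by move=> u _ _; rewrite scale1r.
Qed.

(** [r m] is equivariant on a window that contains the auxiliary indices of [r n], and by [r_r0] it
    agrees there with the base map of [r n]; so [Psi_scale] applies with [R] equal to [r m]. *)
Let r_compat m n v : (d <= n)%N -> (n + d <= m)%N -> stage 0 n n 0 v ->
  r m v = r n v.
Proof.
move=> h1 h2 hv; have hg : good 0 m m 0 (r m) by apply: r_good; lia.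
rewrite [RHS]/r (@Psi_scale _ _ _ _ 0 m m (fun=> True) (r m) 1) ?subnn //;
  try by [left|lia].
- by rewrite mul1r scalerA mulVf ?scale1r.
- exact: (g_lin hg).
- exact: (g_e hg).
- by move=> u /(r_base h1) hu _; rewrite scale1r (@r_r0 m n).
Qed.

Let r_stable v : exists n0, [/\ (d <= n0)%N, stage 0 n0 n0 0 v &
  forall n, (n0 <= n)%N -> stage 0 n n 0 v /\ r n v = r n0 v].
Proof.
have [n1 h1] := poly_fresh hq v.
have hs n : (n1 <= n)%N -> stage 0 n n 0 v.
  by move=> hn; split=> c hc; [lia|move=> hc'; apply: h1; lia].
exists (maxn n1 d); split; [exact: leq_maxr|exact/hs/leq_maxl|].
move=> n hn; have hs1 : stage 0 n n 0 v by apply: hs; lia.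
(* [r_compat] requires a gap of [d] between the windows, so both values are compared with the one at
   [n + d]. *)
split=> //; rewrite -(@r_compat (n + d) n) //; try lia.
by apply: r_compat; [lia|lia|apply: hs; lia].
Qed.

Lemma split_from_base : exists rho : V -> V,
  [/\ linear rho, forall v, NN (rho v), forall v, NN v -> rho v = v &
   [/\ forall i j v, rho (e i j v) = e i j (rho v),
       forall i j v, rho (o i j v) = o i j (rho v)
     & forall v, rho (sg v) = sg (rho v)]].
Proof.
pose rho v := evlim (fun n => r n v).
have hrho v : exists n0, (d <= n0)%N /\
    forall n, (n0 <= n)%N -> stage 0 n n 0 v /\ rho v = r n v.
  have [n0 [h0 _ h1]] := r_stable v; exists n0; split=> // n hn.
  have [hs hr] := h1 n hn; split=> //.
  by rewrite hr; apply: evlim_eq (n0) _ => k /h1 [].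
exists rho; split.
- move=> c u v; have [n1 [_ h1]] := hrho u; have [n2 [_ h2]] := hrho v.
  have [n3 [hd3 h3]] := hrho (c *: u + v).
  pose n := maxn n1 (maxn n2 n3).
  have [hu ->] := h1 n (leq_maxl _ _).
  have [hv ->] : stage 0 n n 0 v /\ rho v = r n v.
    by apply: h2; rewrite /n !leq_max leqnn orbT.
  have [_ ->] : stage 0 n n 0 (c *: u + v) /\ rho (c *: u + v) = r n (c *: u + v).
    by apply: h3; rewrite /n !leq_max leqnn !orbT.
  by rewrite (g_lin (@r_good n _)) // /n !leq_max hd3 !orbT.
- move=> v; have [n [hd h]] := hrho v; have [hs ->] := h n (leqnn _).
  exact: g_in (r_good hd) _ hs.
- move=> v Nv; have [n [hd h]] := hrho v; have [hs ->] := h n (leqnn _).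
  exact: r_id.
- split.
  + move=> i j v; have [n1 [hd h1]] := hrho v; have [n2 [_ h2]] := hrho (e i j v).
    pose n := maxn n1 (maxn n2 (maxn i.+1 j.+1)).
    have [hv ->] := h1 n (leq_maxl _ _).
    have [_ ->] : stage 0 n n 0 (e i j v) /\ rho (e i j v) = r n (e i j v).
      by apply: h2; rewrite /n !leq_max leqnn orbT.
    by rewrite (g_e (@r_good n _)) // /n !leq_max ?hd ?leqnn ?orbT.
  + move=> i j v; have [n1 [hd h1]] := hrho v; have [n2 [_ h2]] := hrho (o i j v).
    pose n := maxn n1 (maxn n2 (maxn i.+1 j.+1)).
    have [hv ->] := h1 n (leq_maxl _ _).
    have [_ ->] : stage 0 n n 0 (o i j v) /\ rho (o i j v) = r n (o i j v).
      by apply: h2; rewrite /n !leq_max leqnn orbT.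
    by rewrite (g_o (@r_good n _)) // /n !leq_max ?hd ?leqnn ?orbT.
  + move=> v; have [n1 [hd h1]] := hrho v; have [n2 [_ h2]] := hrho (sg v).
    pose n := maxn n1 n2.
    have [hv ->] := h1 n (leq_maxl _ _).
    have [_ ->] := h2 n (leq_maxr _ _).
    by rewrite (g_s (@r_good n _)) // /n leq_max hd.
Qed.

End Split.

(** * Complements, retractions and averaging *)

Definition subsp (K : fieldType) (V : lmodType K) (U : V -> Prop) : Prop :=
  U 0 /\ forall (c : K) u v, U u -> U v -> U (c *: u + v).

Section Subspaces.
Variables (K : fieldType) (V : lmodType K).
Implicit Types U W N T : V -> Prop.

Lemma subspD U u v : subsp U -> U u -> U v -> U (u + v).
Proof. by move=> [_ h] hu hv; rewrite -[u]scale1r; apply: h. Qed.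

Lemma subspZ U (c : K) u : subsp U -> U u -> U (c *: u).
Proof. by move=> [h0 h] hu; rewrite -[_ *: _]addr0; apply: h. Qed.

Lemma subspB U u v : subsp U -> U u -> U v -> U (u - v).
Proof. by move=> hU hu hv; rewrite -scaleN1r addrC; apply hU.2. Qed.

Lemma subsp_sum U I (r : seq I) (P : pred I) (F : I -> V) : subsp U ->
  (forall i, P i -> U (F i)) -> U (\sum_(i <- r | P i) F i).
Proof.
move=> hU h; elim/big_rec: _ => [|i x hi hx]; first exact: hU.1.
by apply: subspD => //; apply: h.
Qed.

(** The complement grows by one generator at a time: [x] is added exactly when it is not yet in
    [N + W], and then the intersection with [N] stays 0. *)
Lemma exists_complement N T (xs : seq V) : subsp N -> subsp T ->
  (forall x, x \in xs -> T x) ->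
  exists W, [/\ subsp W, forall w, W w -> T w, forall w, W w -> N w -> w = 0 &
    forall x, x \in xs -> exists n w, [/\ N n, W w & x = n + w]].
Proof.
move=> hN hT; elim: xs => [|x xs ih] hxs.
  exists (fun w => w = 0); split=> //; last by move=> w ->; case: hT.
  by split=> // c u v -> ->; rewrite scaler0 addr0.
have [y hy|W [hW WT WN hWx]] := ih; first by apply: hxs; rewrite inE hy orbT.
case: (EM (exists n w, [/\ N n, W w & x = n + w])) => [hx|hx].
  by exists W; split=> // y; rewrite inE => /orP [/eqP ->|/hWx].
exists (fun w => exists (c : K) u, W u /\ w = c *: x + u); split.
- split; first by exists 0, 0; split; [case: hW|rewrite scale0r addr0].
  move=> c _ _ [a [u [hu ->]]] [b [v [hv ->]]]; exists (c * a + b), (c *: u + v).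
  split; first exact: hW.2.
  by rewrite scalerDr scalerA addrACA -scalerDl.
- move=> _ [c [u [hu ->]]]; apply: hT.2; last exact: WT.
  by apply: hxs; rewrite inE eqxx.
- move=> _ [c [u [hu ->]]] hn; have [c0|c0] := eqVneq c 0.
    by rewrite c0 scale0r add0r in hn *; apply: WN.
  case: hx; exists (c^-1 *: (c *: x + u)), (- c^-1 *: u); split.
  + exact: subspZ.
  + exact: subspZ.
  + by rewrite scalerDr scalerA mulVf // scale1r scaleNr addrK.
- move=> y; rewrite inE => /orP [/eqP ->|/hWx [n [w [hn hw ->]]]].
    exists 0, x; split; [by case: hN| |by rewrite add0r].
    by exists 1, 0; split; [case: hW|rewrite scale1r addr0].
  exists n, w; split=> //; exists 0, w; split=> //.
  by rewrite scale0r add0r.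
Qed.

(* T is finitely generated modulo N, without mentioning linear combinations. *)
Definition fgmod N T : Prop := exists xs : seq V, (forall x, x \in xs -> T x) /\
  forall U, subsp U -> (forall v, N v -> U v) -> (forall x, x \in xs -> U x) ->
  forall v, T v -> U v.

Lemma exists_retraction N T : subsp N -> subsp T -> fgmod N T ->
  exists p : V -> V, [/\ forall (c : K) u v, T u -> T v ->
      p (c *: u + v) = c *: p u + p v,
    forall v, T v -> T (p v), forall v, T v -> N (p v)
    & forall v, T v -> N v -> p v = v].
Proof.
move=> hN hT [xs [hxs hgen]].
have [W [hW WT WN hWx]] := exists_complement hN hT hxs.
pose p v := xget 0 [set n | N n /\ W (v - n)]%classic.
have hp v : T v -> N (p v) /\ W (v - p v).
  move=> hv; apply: (@xgetPex _ 0 [set n | N n /\ W (v - n)]%classic).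
  have: exists n w, [/\ N n, W w & v = n + w].
    apply: (hgen (fun v => exists n w, [/\ N n, W w & v = n + w])) hv.
    - split; first by exists 0, 0; split; [case: hN|case: hW|rewrite addr0].
      move=> c _ _ [n1 [w1 [? ? ->]]] [n2 [w2 [? ? ->]]].
      exists (c *: n1 + n2), (c *: w1 + w2).
      by split; [apply: hN.2|apply: hW.2|rewrite scalerDr addrACA].
    - by move=> n hn; exists n, 0; split=> //; [case: hW|rewrite addr0].
    - exact: hWx.
  by move=> [n [w [hn hw ->]]]; exists n; split=> //=; rewrite [n + w]addrC addrK.
have huniq v n : T v -> N n -> W (v - n) -> p v = n.
  move=> hv hn hw; have [h1 h2] := hp v hv.
  apply/eqP; rewrite -subr_eq0; apply/eqP; apply: WN; last exact: subspB.
  have -> : p v - n = (v - n) - (v - p v) by rewrite opprB [RHS]addrC addrA subrK.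
  exact: subspB.
exists p; split.
- move=> c u v hu hv; have [h1 h2] := hp u hu; have [h3 h4] := hp v hv.
  apply: huniq; [exact: hT.2|exact: hN.2|].
  by rewrite opprD addrACA -scalerBr; apply: hW.2.
- move=> v hv; have [h1 h2] := hp v hv.
  by rewrite -[p v](subKr v); apply: subspB => //; apply: WT.
- by move=> v /hp [].
- by move=> v hv hn; apply: huniq; rewrite ?subrr //; case: hW.
Qed.
End Subspaces.

Section Average.
Variables (K : numFieldType) (V : lmodType K) (N T : V -> Prop).
Hypotheses (hN : subsp N) (hT : subsp T).
Variable X : nat -> {linear V -> V}.

(** Averages over the group generated by anticommuting involutions, one generator at a time, by
    $p\mapsto\frac12(p+X_npX_n)$. Equivariance under the earlier $X_i$ survives because each of the
    two factors $X_n$ contributes one sign. *)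
Lemma exists_equivariant_retraction n (p : V -> V) :
  (forall i j v, i != j -> X i (X j v) = - X j (X i v)) ->
  (forall i v, (i < n)%N -> T v -> X i (X i v) = v) ->
  (forall i v, T v -> T (X i v)) -> (forall i v, N v -> N (X i v)) ->
  (forall (c : K) u v, T u -> T v -> p (c *: u + v) = c *: p u + p v) ->
  (forall v, T v -> T (p v)) -> (forall v, T v -> N (p v)) ->
  (forall v, T v -> N v -> p v = v) ->
  exists p' : V -> V, [/\ forall (c : K) u v, T u -> T v ->
      p' (c *: u + v) = c *: p' u + p' v,
    forall v, T v -> T (p' v), forall v, T v -> N (p' v),
    forall v, T v -> N v -> p' v = v &
    forall i v, (i < n)%N -> T v -> p' (X i v) = X i (p' v)].
Proof.
move=> hX + XT XN h1 h2 h3 h4; elim: n => [|n ih] XX; first by exists p; split.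
have [i v hi|p1 [l1 t1 n1 i1 c1]] := ih; first by apply: XX; apply: ltnW.
have hN1 v : T v -> p1 (- v) = - p1 v.
  move=> hv; have := l1 (-1) v 0 hv hT.1.
  have := l1 1 0 0 hT.1 hT.1; rewrite scaler0 add0r scale1r => /eqP.
  rewrite -subr_eq subrr eq_sym => /eqP ->.
  by rewrite !scaleN1r !addr0.
exists (fun v => 2%:R^-1 *: (p1 v + X n (p1 (X n v)))); split.
- move=> c u v hu hv; rewrite linearP !l1 //; try exact: XT.
  rewrite linearP scalerA mulrC -scalerA -scalerDr; congr (_ *: _).
  by rewrite scalerDr addrACA.
- move=> v hv; apply: subspZ => //; apply: subspD => //; first exact: t1.
  by apply/XT/t1/XT.
- move=> v hv; apply: subspZ => //; apply: subspD => //; first exact: n1.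
  by apply/XN/n1/XT.
- move=> v hv hn; rewrite !i1 // ?XX //; try by [apply: XT|apply: XN].
  by rewrite -mulr2n -scaler_nat scalerA mulVf ?scale1r // pnatr_eq0.
- move=> i v; rewrite ltnS leq_eqVlt => /orP [/eqP ->|hi] hv.
    rewrite linearZ /= [X n (_ + _)]linearD (XX n v) //.
    by rewrite (XX n (p1 (X n v))) // 1?addrC //; apply/t1/XT.
  have hne : n != i by rewrite neq_ltn hi orbT.
  rewrite linearZ /= [X i (_ + _)]linearD c1 // (hX _ i) // hN1; last by apply/XT/XT.
  rewrite linearN [in LHS]c1 //; last exact: XT.
  by rewrite [in LHS](hX n) // opprK.
Qed.
End Average.

Lemma qo_sq (K : numFieldType) (V : lmodType K) (q : qrep V) c v :
  qo q c c (qo q c c v) = qe q c c v.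
Proof.
have := qoo q c c c c v; rewrite eqxx !mulr1n => h.
have h2 : (2%:R : K) *: qo q c c (qo q c c v) = 2%:R *: qe q c c v.
  by rewrite !scaler_nat !mulr2n {1}h addrC -addrA addNKr.
by apply: (scalerI _ h2); rewrite pnatr_eq0.
Qed.

Theorem splitting (K : numFieldType) (V : lmodType K) (q : qrep V) d
    (NN : V -> Prop) :
  polyrep q d ->
  (forall c v, qe q c c v = 0 -> qo q c c v = 0) ->
  subsp NN -> (forall i j v, NN v -> NN (qe q i j v)) ->
  (forall i j v, NN v -> NN (qo q i j v)) -> (forall v, NN v -> NN (qs q v)) ->
  fgmod NN (stage q d d 0 d) ->
  exists rho : V -> V,
  [/\ linear rho, forall v, NN (rho v), forall v, NN v -> rho v = v &
   [/\ forall i j v, rho (qe q i j v) = qe q i j (rho v),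
       forall i j v, rho (qo q i j v) = qo q i j (rho v)
     & forall v, rho (qs q v) = qs q (rho v)]].
Proof.
move=> hq hfree hN NNe NNo NNs hfg.
have hT : subsp (stage q d d 0 d).
  by split; [exact: stage0|move=> *; exact: stage_lin].
have [p [h1 h2 h3 h4]] := exists_retraction hN hT hfg.
(* The parity operator comes first, then the odd Cartan elements; on this stage $H_c^2=E_{cc}$ is
   the identity for $c<d$. *)
pose X i := if i is c.+1 then qo q c c else qs q.
have [||||p0 [l0 t0 n0 i0 c0]] :=
  @exists_equivariant_retraction K V NN _ hN hT X d.+1 p _ _ _ _ h1 h2 h3 h4.
- move=> [|i] [|j] v //= hij; first by rewrite qso.
    by rewrite qso opprK.
  move: hij; rewrite eqSS => hij.
  by rewrite qoo (eq_sym j) (negPf hij) !mulr0n !addr0.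
- move=> [|i] v; first by rewrite /= qss.
  by rewrite ltnS /= qo_sq => hi [hv _]; apply: hv.
- by move=> [|i] v hv; [apply: stage_s|apply: stage_oc].
- by move=> [|i] v hv; [apply: NNs|apply: NNo].
apply: (@split_from_base K V q d hq hfree NN hN.1 hN.2 NNe p0) => //.
- by move=> c v hc; apply: (c0 c.+1).
- by move=> v; apply: (c0 0%N).
Qed.

(** * The odd central endomorphism *)

Section Theta.
Variables (K : numFieldType) (V : lmodType K) (q : qrep V) (d : nat).
Hypothesis hq : polyrep q d.
Local Notation e := (qe q).
Local Notation o := (qo q).
Local Notation sg := (qs q).

Definition theta (v : V) : V := evlim (fun a => o a a v).

(** The commutator of [e a b] and [o b a] is [o a a - o b b], while both [e a b] and [o b a] kill
    [v], as they lower an entry 0. *)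
Lemma free_oE a b v : e a a v = 0 -> e b b v = 0 -> o a a v = o b b v.
Proof.
move=> ha hb; have [-> //|hab] := eqVneq a b.
have := qeo q a b b a v; rewrite (poly_free_e hq hb hab) !eqxx linear0 add0r.
have -> : o b a v = 0 by apply: (poly_free_o hq ha); rewrite eq_sym.
by rewrite linear0 !mulr1n => /esym/eqP; rewrite subr_eq0 => /eqP.
Qed.

Lemma theta_free a v : e a a v = 0 -> o a a v = theta v.
Proof.
move=> ha; have [n0 h] := poly_fresh hq v.
by apply/esym; apply: (evlim_eq (n0 := n0)) => n /h hn; apply: free_oE.
Qed.

Lemma thetaE v : exists n0, forall a, (n0 <= a)%N ->
  e a a v = 0 /\ o a a v = theta v.
Proof.
have [n0 h] := poly_fresh hq v; exists n0 => a /h ha.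
by split=> //; apply: theta_free.
Qed.

Lemma theta_linear : linear theta.
Proof.
move=> c u v; have [n1 h1] := thetaE u; have [n2 h2] := thetaE v.
have [e1 <-] := h1 _ (leq_maxl n1 n2); have [e2 <-] := h2 _ (leq_maxr n1 n2).
by rewrite -(@theta_free (maxn n1 n2)) linearP // e1 e2 scaler0 addr0.
Qed.

Lemma theta_e i j v : theta (e i j v) = e i j (theta v).
Proof.
have [n1 h1] := thetaE v; pose a := maxn n1 (maxn i.+1 j.+1).
have [e1 <-] := h1 a (leq_maxl _ _).
have ai : (a == i) = false by rewrite /a; lia.
have ja : (j == a) = false by rewrite /a; lia.
rewrite -(@theta_free a); first by rewrite qeo ja ai !mulr0n addr0 subr0.
by rewrite qe_diag e1 linear0 ai ja addr0 subr0.
Qed.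

Lemma theta_o i j v : theta (o i j v) = - o i j (theta v).
Proof.
have [n1 h1] := thetaE v; pose a := maxn n1 (maxn i.+1 j.+1).
have [e1 <-] := h1 a (leq_maxl _ _).
have ai : (a == i) = false by rewrite /a; lia.
have ja : (j == a) = false by rewrite /a; lia.
rewrite -(@theta_free a); first by rewrite qoo ja ai !mulr0n !addr0.
by rewrite qeo_diag e1 linear0 ai ja addr0 subr0.
Qed.

Lemma theta_s v : theta (sg v) = - sg (theta v).
Proof.
have [n1 h1] := thetaE v; have [e1 <-] := h1 _ (leqnn _).
rewrite -(@theta_free n1); first by rewrite qso opprK.
by rewrite -qse e1 linear0.
Qed.

Lemma theta_theta v : theta (theta v) = 0.
Proof.
have [n1 h1] := thetaE v; have [e1 h] := h1 _ (leqnn _).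
rewrite -(@theta_free n1) -h; first by rewrite qo_sq.
by rewrite qeo_diag e1 linear0 addrK.
Qed.

Definition thetaL : {linear V -> V} := mklin theta_linear.

Lemma thetaB u v : theta (u - v) = theta u - theta v.
Proof. exact: (linearB thetaL). Qed.

Lemma thetaMn n v : theta (v *+ n) = theta v *+ n.
Proof. exact: (linearMn thetaL n). Qed.

Definition qo_mod (i j : nat) : {linear V -> V}.
Proof.
refine (@mklin K V V (fun v => o i j v - theta v *+ (i == j)) _).
move=> c u v; rewrite linearP theta_linear mulrnDl opprD addrACA.
by rewrite scalerBr scalerMnr.
Defined.

Lemma qo_modE i j v : qo_mod i j v = o i j v - theta v *+ (i == j).
Proof. by []. Qed.

(** The corrections cancel because the commutator of two matrix units has trace 0. *)
Lemma qmod_eo i j k l v : e i j (qo_mod k l v) =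
    qo_mod k l (e i j v) + qo_mod i l v *+ (j == k) - qo_mod k j v *+ (l == i).
Proof.
rewrite !qo_modE linearB linearMn /= qeo theta_e.
have -> : (o i l v - theta v *+ (i == l)) *+ (j == k) =
    o i l v *+ (j == k) - theta v *+ ((i == l) && (j == k)).
  by case: (j == k); rewrite ?andbT ?andbF ?mulr0n ?subr0 ?mulr1n.
have -> : (o k j v - theta v *+ (k == j)) *+ (l == i) =
    o k j v *+ (l == i) - theta v *+ ((i == l) && (j == k)).
  rewrite (eq_sym k) (eq_sym l).
  by case: (i == l); rewrite ?mulr0n ?subr0 ?mulr1n.
set x := o k l _; set t1 := e i j (theta v) *+ _; set t2 := theta v *+ _.
set y := o i l v *+ _; set z := o k j v *+ _.
rewrite -[RHS]addrA opprB [X in _ = _ + X]addrA subrK.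
by rewrite -(addrA x) (addrAC x).
Qed.

(** [theta] anticommutes with the odd matrix units and has square 0, so the corrections drop out of
    the anticommutator. *)
Lemma qmod_oo i j k l v : qo_mod i j (qo_mod k l v) =
    - qo_mod k l (qo_mod i j v) + e i l v *+ (j == k) + e k j v *+ (l == i).
Proof.
have ho i' j' u w (b : bool) : o i' j' (u - w *+ b) = o i' j' u - o i' j' w *+ b.
  by rewrite linearB linearMn.
rewrite !qo_modE !ho qoo !thetaB !thetaMn !theta_o !theta_theta.
rewrite !mul0rn !subr0 !mulNrn !opprK.
set y := e i l v *+ _; set z := e k j v *+ _; set c := o i j (theta v) *+ _.
by rewrite opprD opprB [LHS]addrC !addrA (addrAC _ z (- c)) (addrAC _ y (- c)).
Qed.

Lemma qmod_so i j v : sg (qo_mod i j v) = - qo_mod i j (sg v).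
Proof.
by rewrite !qo_modE linearB linearMn qso theta_s /= mulNrn !opprD !opprK.
Qed.

(* The action of x minus (odd trace of x) theta. *)
Definition qmod : qrep V :=
QRep (qee q) qmod_eo qmod_oo (qss q) (qse q) qmod_so.

Lemma qmod_polyrep : polyrep qmod d.
Proof.
move=> v; have [n hn] := hq v; exists n.
elim: n v hn => [//|n ih] v [a [w [u [pa hw hu ->]]]].
by exists a, w, u; split=> //; apply: ih.
Qed.

(** The retraction is equivariant for the corrected action [qmod]. Undoing the correction leaves the
    term [theta v]: [rho] fixes it, as it lies in [NN], while [theta] kills the values of [rho]. *)
Theorem splitting_theta (NN : V -> Prop) :
  subsp NN -> (forall i j v, NN v -> NN (e i j v)) ->
  (forall i j v, NN v -> NN (o i j v)) -> (forall v, NN v -> NN (sg v)) ->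
  (forall v, NN v -> theta v = 0) -> (forall v, NN (theta v)) ->
  fgmod NN (stage q d d 0 d) ->
  exists rho : V -> V,
  [/\ linear rho, forall v, NN (rho v), forall v, NN v -> rho v = v &
   [/\ forall i j v, rho (e i j v) = e i j (rho v),
       forall i j v, rho (o i j v) = o i j (rho v) + theta v *+ (i == j)
     & forall v, rho (sg v) = sg (rho v)]].
Proof.
move=> hN NNe NNo NNs th0 thN hfg.
have [| | | | | | |rho [h1 h2 h3 [h4 h5 h6]]] := @splitting K V qmod d NN => //.
- exact: qmod_polyrep.
- by move=> c v hc; rewrite /= (theta_free hc) eqxx subrr.
- by move=> i j v hv; rewrite /= th0 // mul0rn subr0; apply: NNo.
exists rho; split=> //; split=> // i j v.
have hlin : linear rho by [].
have hB u w : rho (u - w) = rho u - rho w by exact: (linearB (mklin hlin)).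
have hMn u n : rho (u *+ n) = rho u *+ n by exact: (linearMn (mklin hlin)).
have := h5 i j v; rewrite /= hB hMn (h3 (theta v)) // (th0 (rho v)) //.
by rewrite mul0rn subr0 => /eqP; rewrite subr_eq => /eqP.
Qed.

End Theta.

(** * The automorphism that exchanges polynomial and dual modules *)

Section Twist.
Variables (K : numClosedFieldType) (V : lmodType K) (q : qrep V).

Lemma twist_e_linear i j : linear (fun v => - qe q j i v).
Proof. by move=> c u v; rewrite linearP opprD scalerN. Qed.

Lemma twist_o_linear i j : linear (fun v : V => ('i : K) *: (qo q j i v : V)).
Proof. by move=> c u v; rewrite linearP scalerDr !scalerA mulrC. Qed.

Let e i j := mklin (twist_e_linear i j).
Let o i j := mklin (twist_o_linear i j).

Lemma twist_ee i j k l v : e i j (e k l v) =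
  e k l (e i j v) + e i l v *+ (j == k) - e k j v *+ (l == i).
Proof.
rewrite /= !linearN !opprK /= qee !mulNrn opprK (eq_sym l) (eq_sym j).
by rewrite addrAC.
Qed.

Lemma twist_eo i j k l v : e i j (o k l v) =
  o k l (e i j v) + o i l v *+ (j == k) - o k j v *+ (l == i).
Proof.
rewrite /= linearZ linearN /= qeo (eq_sym l) (eq_sym j).
by rewrite scalerBr scalerDr !scalerMnr scalerN opprB opprD addrCA addrA.
Qed.

Lemma twist_oo i j k l v : o i j (o k l v) =
  - o k l (o i j v) + e i l v *+ (j == k) + e k j v *+ (l == i).
Proof.
rewrite /= !linearZ /= qoo !scalerA -expr2 sqrCi.
rewrite !scaleN1r !opprD !opprK !mulNrn (eq_sym l) (eq_sym j).
by rewrite addrAC.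
Qed.

Lemma twist_se i j v : qs q (e i j v) = e i j (qs q v).
Proof. by rewrite /= linearN qse. Qed.

Lemma twist_so i j v : qs q (o i j v) = - o i j (qs q v).
Proof. by rewrite /= linearZ qso /= scalerN. Qed.

(* The automorphism (A, B) |-> (- A^T, i B^T). *)
Definition twist : qrep V :=
  QRep twist_ee twist_eo twist_oo (qss q) twist_se twist_so.

End Twist.

(** * Weights of simple bounded modules *)

Lemma row_dependence (K : fieldType) n k (B : 'M[K]_(n, k)) : (k < n)%N ->
  exists c : 'I_n -> K, (exists i, c i != 0) /\
    forall j, \sum_(i < n) c i * B i j = 0.
Proof.
move=> hkn; have hker : kermx B != 0.
  by rewrite -mxrank_eq0 mxrank_ker subn_eq0 -ltnNge (leq_ltn_trans (rank_leq_col B)).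
have /rowV0Pn [u hu /rV0Pn [i hi]] := hker.
exists (u 0); split; first by exists i.
move=> j; have /sub_kermxP := hu.
by move=> /(congr1 (fun M : 'rV_k => M 0 j)); rewrite !mxE.
Qed.

Lemma dim_dependence (K : fieldType) (V : lmodType K) (U : V -> Prop) k n
    (x : 'I_n -> V) : dim_le U k -> (k < n)%N -> (forall i, U (x i)) ->
  exists c : 'I_n -> K, (exists i, c i != 0) /\ \sum_(i < n) c i *: x i = 0.
Proof.
move=> [f [_ hf]] hkn hx.
have [B hB] := choice (fun i => hf _ (hx i)).
have [c [hc h0]] := row_dependence (\matrix_(i, j) B i j) hkn.
exists c; split=> //; under eq_bigr do rewrite hB scaler_sumr.
rewrite exchange_big big1 // => j _ /=.
under eq_bigr do rewrite scalerA.
rewrite -scaler_suml; have := h0 j.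
by under eq_bigr do rewrite mxE; move=> ->; rewrite scale0r.
Qed.

Lemma exists_support (P : nat -> Prop) r :
  (forall s, uniq s -> (forall i, i \in s -> P i) -> (size s <= r)%N) ->
  exists s, uniq s /\ forall i, i \in s <-> P i.
Proof.
move=> hr.
suff H k s : uniq s -> (forall i, i \in s -> P i) -> (r <= size s + k)%N ->
    exists s, uniq s /\ forall i, i \in s <-> P i by exact: (H r [::]).
elim: k s => [|k ih] s us hs hk.
  exists s; split=> // i; split=> [/hs //|hi].
  apply: contraT => his; have := hr (i :: s).
  rewrite /= his us => /(_ isT) H; have : (size s < r)%N.
    by apply: H => j; rewrite inE => /orP [/eqP ->|/hs].
  by rewrite ltnNge -[size s]addn0 hk.
case: (EM (exists2 i, P i & i \notin s)) => [[i hi his]|hno].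
  apply: (ih (i :: s)); rewrite /= ?his ?addSnnS //.
  by move=> j; rewrite inE => /orP [/eqP ->|/hs].
exists s; split=> // i; split=> [/hs //|hi].
by apply: contraT => his; case: hno; exists i.
Qed.

Lemma exists_fresh (s : seq nat) : exists b, forall i, (b <= i)%N -> i \notin s.
Proof.
exists (\max_(i <- s) i).+1 => i hi; apply: contraL hi => his.
by rewrite -leqNgt big_tnth; have [j ->] := seq_tnthP his; apply: leq_bigmax.
Qed.

Definition shiftw (K : numFieldType) (a : nat -> K) i j : nat -> K :=
  fun c => a c + (c == i)%:R - (c == j)%:R.

Section Weights.
Variables (K : numFieldType) (V : lmodType K) (q : qrep V).
Local Notation e := (qe q).
Local Notation o := (qo q).
Local Notation sg := (qs q).

Lemma wt_shift a i j v : wt q a v -> wt q (shiftw a i j) (e i j v).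
Proof.
move=> hv c; rewrite qe_diag hv linearZ /= /shiftw scalerBl scalerDl.
by rewrite !scaler_nat (eq_sym j).
Qed.

Lemma wt_oc a i v : wt q a v -> wt q a (o i i v).
Proof. by move=> hv c; rewrite qeo_diag hv linearZ eq_sym addrK. Qed.

(** With $u_m=E_{ij}^mv$, $sl_2$-theory gives $E_{ji}u_{m+1}=(m+1)(a_j-a_i-m)u_m$. At the last
    nonzero $u_m$ the coefficient has to vanish. *)
Lemma lowest_weight a i j v n : i != j -> wt q a v -> v != 0 ->
  iter n (e i j) v = 0 -> e j i v = 0 -> exists p : nat, a j - a i = p%:R.
Proof.
move=> hij hv nz; pose u n := iter n (e i j) v; rewrite -/(u n) => hn hl.
have hi m : e i i (u m) = (a i + m%:R) *: u m.
  elim: m => [|m ih]; first by rewrite addr0 hv.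
  rewrite /u iterS -/(u m) qe_diag ih linearZ eqxx /= eq_sym (negPf hij).
  by rewrite subr0 -[X in _ + X]scale1r -scalerDl -addrA -natr1.
have hj m : e j j (u m) = (a j - m%:R) *: u m.
  elim: m => [|m ih]; first by rewrite subr0 hv.
  rewrite /u iterS -/(u m) qe_diag ih linearZ eqxx /= eq_sym (negPf hij).
  by rewrite addr0 -[X in _ - X]scale1r -scalerBl -addrA -opprD natr1.
have hf m : e j i (u m.+1) = (m.+1%:R * (a j - a i - m%:R)) *: u m.
  elim: m => [|m ih].
    rewrite subr0 mul1r /u /= qee hl linear0 !eqxx add0r !mulr1n !hv.
    by rewrite scalerBl.
  rewrite {1}/u iterS -/(u m.+1) qee ih linearZ !eqxx !mulr1n hi hj /=.
  rewrite -/(u m.+1) -scalerDl -scalerBl; congr (_ *: _).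
  by rewrite -!natr1; ring.
have : exists m, u m != 0 /\ u m.+1 = 0.
  elim: n hn => [|n ih] hn; first by rewrite /u /= in hn; rewrite hn eqxx in nz.
  by have [/ih //|h] := eqVneq (u n) 0; exists n.
move=> [m [h1 h2]]; exists m; have := hf m; rewrite h2 linear0 => /esym/eqP.
rewrite scaler_eq0 (negPf h1) orbF mulf_eq0 pnatr_eq0 /= subr_eq0.
by move=> /eqP.
Qed.

(* A relation sum_i c_i o_ii = 0 on the weight space gives 2 c_j a_j = 0 when
   anticommuted with o_jj, so these operators are linearly independent. *)
Lemma clifford_bound a k v (s : seq nat) : dim_le (wt q a) k -> wt q a v ->
  v != 0 -> uniq s -> (forall i, i \in s -> a i != 0) -> (size s <= k * k)%N.
Proof.
move=> [f [hf1 hf2]] hv nz us hs; rewrite leqNgt; apply/negP => hlt.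
pose x (t : 'I_(size s)) := nth 0%N s t.
have /choice [A hA] : forall t, exists b : 'I_k -> 'I_k -> K,
    forall i, o (x t) (x t) (f i) = \sum_(j < k) b i j *: f j.
  move=> t; have /choice [b hb] : forall i, exists b : 'I_k -> K,
      o (x t) (x t) (f i) = \sum_(j < k) b j *: f j by move=> i; apply/hf2/wt_oc.
  by exists b.
have [c [[t0 ct0] h0]] :=
  row_dependence (\matrix_(t < size s) mxvec (\matrix_(i, j) A t i j)) hlt.
have hc w : wt q a w -> \sum_t c t *: o (x t) (x t) w = 0.
  move=> /hf2 [y ->].
  have -> : \sum_t c t *: o (x t) (x t) (\sum_(i < k) y i *: f i) =
      \sum_(i < k) y i *: \sum_t c t *: o (x t) (x t) (f i).
    under [RHS]eq_bigr do rewrite scaler_sumr.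
    rewrite [RHS]exchange_big; apply: eq_bigr => t _ /=.
    rewrite linear_sum scaler_sumr; apply: eq_bigr => i _.
    by rewrite linearZ /= !scalerA mulrC.
  rewrite big1 // => i _.
  under eq_bigr do rewrite hA scaler_sumr.
  rewrite exchange_big big1 ?scaler0 // => j _ /=.
  under eq_bigr do rewrite scalerA.
  rewrite -scaler_suml; have := h0 (mxvec_index i j).
  under eq_bigr do rewrite mxE mxvecE mxE.
  by move=> ->; rewrite scale0r.
have h1 : o (x t0) (x t0) (\sum_t c t *: o (x t) (x t) v) +
    \sum_t c t *: o (x t) (x t) (o (x t0) (x t0) v) = 0.
  by rewrite !hc ?linear0 ?addr0 //; apply: wt_oc.
move: h1; rewrite linear_sum -big_split (bigD1 t0) //= big1 ?addr0; last first.
  move=> t ht; have hne : x t != x t0 by rewrite nth_uniq.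
  rewrite linearZ /= [X in _ + _ *: X]qoo (negPf hne) eq_sym (negPf hne).
  by rewrite !mulr0n !addr0 scalerN addrN.
rewrite linearZ /= !qo_sq hv -mulr2n -scaler_nat !scalerA => /eqP.
rewrite !scaler_eq0 (negPf nz) !mulf_eq0 pnatr_eq0 /= (negPf ct0) !orbF.
by apply/negP/hs/mem_nth.
Qed.

End Weights.

(** * Weights of maximal support *)

Section MaxSupport.
Variables (K : numFieldType) (V : lmodType K) (q : qrep V).
Local Notation e := (qe q).
Local Notation o := (qo q).
Local Notation sg := (qs q).
Hypothesis hnil : forall i j a v, i != j -> wt q a v ->
  exists n, iter n (e i j) v = 0.
Variable r : nat.
Hypothesis hmax : forall a v s, wt q a v -> v != 0 -> uniq s ->
  (forall i, i \in s -> a i != 0) -> (size s <= r)%N.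

Lemma max_off a v s i : wt q a v -> v != 0 -> uniq s ->
  (forall i, i \in s -> a i != 0) -> (r <= size s)%N -> i \notin s -> a i = 0.
Proof.
move=> hv nz us hs hr his; apply: contraTeq hr => hi; rewrite -ltnNge.
apply: (hmax (s := i :: s) hv nz) => [|j]; first by rewrite /= his.
by rewrite inE => /orP [/eqP ->|/hs].
Qed.

Definition isnat (x : K) : Prop := exists p : nat, x = p%:R.

Lemma lower_neq0 a i j v : i != j -> wt q a v -> v != 0 ->
  ~ isnat (a j - a i) -> e j i v != 0.
Proof.
move=> hij hv nz hp; apply/eqP => h0; have [n hn] := hnil hij hv.
by have [p h] := lowest_weight hij hv nz hn h0; apply: hp; exists p.
Qed.

(* One unit is moved from [i] to a fresh index [j], with a sign that keeps both
   entries nonzero. *)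
Lemma split_entry a v s i : wt q a v -> v != 0 -> 
  (forall j, (j \in s) = (a j != 0)) -> i \in s -> a i != 1 -> a i != -1 ->
  exists b w j, [/\ j \notin s, wt q b w /\ w != 0,
    forall c, c \in j :: s -> b c != 0,
    forall c, c != i -> c != j -> b c = a c
  & isnat (b i) -> isnat (a i)].
Proof.
move=> hv nz hs hi h1 h2; have [j /(_ j (leqnn _)) hj] := exists_fresh s.
have aj : a j = 0 by apply/eqP; rewrite -[_ == _]negbK -hs.
have ai : a i != 0 by rewrite -hs.
have hij : i != j by apply: contraNneq hj => <-.
have hjs c : c \in s -> (c == j) = false.
  by move=> hc; apply: contraNF hj => /eqP <-.
(* [e j i v] can vanish only if $-a_i$ is a natural number. In that case $a_i$ is negative, so
   [e i j v] is nonzero and is used instead. Excluding $a_i=\pm1$ keeps the entry at [i] nonzero. *)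
case: (EM (isnat (- a i))) => [[p /eqP]|hp].
  rewrite eqr_oppLR => /eqP hp.
  exists (shiftw a i j), (e i j v), j; split=> //.
  - split; first exact: wt_shift.
    apply: lower_neq0 hv nz _; rewrite 1?eq_sym // aj subr0 => -[p' hp'].
    move: ai; rewrite hp oppr_eq0 pnatr_eq0 => /negP; apply.
    move: hp'; rewrite hp => /eqP; rewrite eq_sym -addr_eq0 -natrD.
    by rewrite pnatr_eq0 addn_eq0 => /andP [].
  - move=> c; rewrite inE => /orP [/eqP ->|hc]; rewrite /shiftw.
      by rewrite aj eqxx (eq_sym j) (negPf hij) add0r sub0r oppr_eq0 oner_eq0.
    rewrite hjs // subr0; have [->|hci] := eqVneq c i; last by rewrite addr0 -hs.
    by rewrite addr_eq0.
  - by move=> c /negPf h3 /negPf h4; rewrite /shiftw h3 h4 addr0 subr0.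
  - move=> [p' hp']; move: hp'; rewrite /shiftw eqxx (negPf hij) subr0 hp.
    move=> /eqP; rewrite addrC subr_eq -natrD eqr_nat => /eqP.
    move: ai h2; rewrite hp oppr_eq0 eqr_opp pnatr_eq0 pnatr_eq1.
    by case: p {hp} => [|[|p]] //= _ _; rewrite !addnS.
exists (shiftw a j i), (e j i v), j; split=> //.
- split; first exact: wt_shift.
  by apply: lower_neq0 hv nz _ => //; rewrite aj sub0r.
- move=> c; rewrite inE => /orP [/eqP ->|hc]; rewrite /shiftw.
    by rewrite aj eqxx (eq_sym j) (negPf hij) add0r subr0 oner_eq0.
  rewrite hjs // addr0; have [->|hci] := eqVneq c i; last by rewrite subr0 -hs.
  by rewrite subr_eq0.
- by move=> c /negPf h3 /negPf h4; rewrite /shiftw h3 h4 addr0 subr0.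
- rewrite /shiftw eqxx (negPf hij) addr0 => -[p /eqP].
  by rewrite subr_eq natr1 => /eqP ->; exists p.+1.
Qed.

(** Any other entry could be split by [split_entry], which enlarges the support. *)
Lemma max_entry a v s i : wt q a v -> v != 0 -> uniq s ->
  (forall i, i \in s -> a i != 0) -> (r <= size s)%N -> i \in s ->
  a i = 1 \/ a i = -1.
Proof.
move=> hv nz us hs hr hi.
have hs' j : (j \in s) = (a j != 0).
  apply/idP/idP; first exact: hs.
  by apply: contraNT => hj; rewrite (max_off hv nz us hs hr hj).
have [/eqP|h1] := boolP (a i == 1); first by left.
have [/eqP|h2] := boolP (a i == -1); first by right.
have [b [w [j [hj [hw nw] hb _ _]]]] := split_entry hv nz hs' hi h1 h2.
have : (size (j :: s) <= r)%N by apply: hmax hw nw _ hb; rewrite /= hj.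
by rewrite /= ltnNge hr.
Qed.

Variable k : nat.
Hypothesis hbdd : forall a, dim_le (wt q a) k.

(* Moving the entries 1 at i and -1 at j to fresh indices x n and y n and then
   cancelling them yields vectors u n of one and the same weight, which are
   separated by the operators e (x n) (y n). *)
Lemma max_not_mixed a v s i j : wt q a v -> v != 0 -> uniq s ->
  (forall i, i \in s -> a i != 0) -> (r <= size s)%N ->
  i \in s -> j \in s -> a i = 1 -> a j = -1 -> False.
Proof.
move=> hv nz us hs hr hi hj ai aj.
have [x [y [hx hy xinj yinj xy]]] : exists x y : nat -> nat,
    [/\ forall n, x n \notin s, forall n, y n \notin s,
      forall n m, (x n == x m) = (n == m), forall n m, (y n == y m) = (n == m)
    & forall n m, (x n == y m) = false].
  have [b0 hb0] := exists_fresh s.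
  exists (fun n => b0 + n.*2)%N, (fun n => (b0 + n.*2).+1).
  split=> [n|n|n m|n m|n m]; last by lia.
  - by apply: hb0; rewrite leq_addr.
  - by apply: hb0; rewrite leqW // leq_addr.
  - by lia.
  - by lia.
have yx n m : (y n == x m) = false by rewrite eq_sym xy.
have off c : c \notin s -> a c = 0 by apply: max_off hv nz us hs hr.
have hij : i != j.
  by apply/eqP => eij; move/eqP: aj; rewrite -eij ai -subr_eq0 opprK -mulr2n pnatr_eq0.
have ins c c' : c \in s -> c' \notin s -> (c == c') = false.
  by move=> h1 h2; apply: contraNF h2 => /eqP <-.
pose a1 n := shiftw a j (y n).
pose v1 n := e j (y n) v.
pose a2 n := shiftw (a1 n) (x n) i.
pose v2 n := e (x n) i (v1 n).
have w1 n : wt q (a1 n) (v1 n) by apply: wt_shift.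
have w2 n : wt q (a2 n) (v2 n) by apply: wt_shift.
have neg1 : ~ isnat (-1).
  by move=> [p /eqP]; rewrite eq_sym -subr_eq0 opprK natr1 pnatr_eq0.
have nz1 n : v1 n != 0.
  apply: lower_neq0 hv nz _; first by rewrite eq_sym ins.
  by rewrite aj off // subr0.
have nz2 n : v2 n != 0.
  apply: lower_neq0 (w1 n) (nz1 n) _; first by rewrite ins.
  rewrite /a1 /shiftw off // xy (eq_sym (x n)) (ins j) // add0r subr0.
  by rewrite (negPf hij) ins // ai addr0 subr0 sub0r.
pose s' := rem i (rem j s).
have us' : uniq s' by rewrite !rem_uniq.
have szs' : ((size s').+2 = size s)%N.
  rewrite /s' !size_rem //; last by rewrite mem_rem_uniq // !inE hij.
  have : (size [:: i; j] <= size s)%N.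
    apply: uniq_leq_size; first by rewrite /= inE hij.
    by move=> c; rewrite !inE => /orP [/eqP ->|/eqP ->].
  by rewrite /=; lia.
have ins' c : (c \in s') = [&& c != i, c != j & c \in s].
  by rewrite /s' mem_rem_uniq ?rem_uniq // !inE mem_rem_uniq // !inE.
have a2E n c : a2 n c = if c \in s' then a c else (c == x n)%:R - (c == y n)%:R.
  rewrite /a2 /a1 /shiftw ins'.
  have [->|hci] := eqVneq c i.
    by rewrite (negPf hij) !ins // ai !addr0 !subr0 subrr.
  have [->|hcj] := eqVneq c j.
    by rewrite !ins // aj !addr0 !subr0 addrC subrr.
  rewrite subr0 addr0 /=; case: (boolP (c \in s)) => hc.
    by rewrite !ins // addr0 subr0.
  by rewrite off // add0r addrC.
have hs'nz n c : c \in s' -> a2 n c != 0.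
  by move=> hc; rewrite a2E hc; apply: hs; move: hc; rewrite ins' => /and3P [].
have xs' n : x n \notin s' by rewrite ins' (negPf (hx n)) !andbF.
have ys' n : y n \notin s' by rewrite ins' (negPf (hy n)) !andbF.
(* For [n = m] the entries at [x n] and [y n] become 2 and -2 on a support of maximal size, against
   [max_entry]. For other [n] the support has two indices more than [s]. *)
have kill n m : e (x n) (y n) (v2 m) = 0.
  apply/eqP/negPn/negP => nzk; have wk := wt_shift (x n) (y n) (w2 m).
  have [enm|nm] := eqVneq n m.
    have : shiftw (a2 m) (x n) (y n) (x n) = 1 \/
           shiftw (a2 m) (x n) (y n) (x n) = -1.
      apply: (max_entry (s := [:: x n, y n & s']) wk nzk).
      - by rewrite /= !inE xy /= xs' ys' us'.
      - move=> c; rewrite enm !inE => /or3P [/eqP ->|/eqP ->|hc]; rewrite /shiftw.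
        + rewrite a2E (negPf (xs' m)) eqxx xy !subr0.
          by rewrite -mulr2n pnatr_eq0.
        + rewrite a2E (negPf (ys' m)) eqxx yx addr0 sub0r -opprD oppr_eq0.
          by rewrite -mulr2n pnatr_eq0.
        + have -> : (c == x m) = false by apply: contraNF (xs' m) => /eqP <-.
          have -> : (c == y m) = false by apply: contraNF (ys' m) => /eqP <-.
          by rewrite addr0 subr0 hs'nz.
      - by rewrite /= szs'.
      - by rewrite inE eqxx.
    rewrite /shiftw a2E enm (negPf (xs' m)) eqxx xy !subr0 -mulr2n.
    move=> [/eqP|/eqP]; first by rewrite (eqr_nat _ 2 1).
    by rewrite -subr_eq0 opprK natr1 pnatr_eq0.
  have xx : (x n == x m) = false by rewrite xinj (negPf nm).
  have yy : (y n == y m) = false by rewrite yinj (negPf nm).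
  have xx2 : (x m == x n) = false by rewrite eq_sym.
  have yy2 : (y m == y n) = false by rewrite eq_sym.
  have : (size [:: x n, y n, x m, y m & s'] <= r)%N.
    apply: hmax wk nzk _ _.
      by rewrite /= !inE !xy !yx xx yy /= !xs' !ys' us'.
    move=> c; rewrite !inE => /or4P [/eqP ->|/eqP ->|/eqP ->|/orP [/eqP ->|hc]];
      rewrite /shiftw.
    - by rewrite a2E (negPf (xs' n)) eqxx xx !xy !subr0 add0r oner_eq0.
    - rewrite a2E (negPf (ys' n)) eqxx yy !yx.
      by rewrite !subr0 !add0r oppr_eq0 oner_eq0.
    - by rewrite a2E (negPf (xs' m)) eqxx xx2 !xy !subr0 addr0 oner_eq0.
    - rewrite a2E (negPf (ys' m)) eqxx yy2 !yx.
      by rewrite sub0r addr0 subr0 oppr_eq0 oner_eq0.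
    - have -> : (c == x n) = false by apply: contraNF (xs' n) => /eqP <-.
      have -> : (c == y n) = false by apply: contraNF (ys' n) => /eqP <-.
      by rewrite addr0 subr0 hs'nz.
  by move: hr szs'; rewrite /=; lia.
pose u n := e (y n) (x n) (v2 n).
have wu n : wt q (fun c => if c \in s' then a c else 0) (u n).
  move=> c; rewrite (wt_shift (y n) (x n) (w2 n)) /shiftw a2E.
  congr (_ *: _); case: ifP => hc.
    have -> : (c == x n) = false by apply: contraTF hc => /eqP ->.
    have -> : (c == y n) = false by apply: contraTF hc => /eqP ->.
    by rewrite addr0 subr0.
  by rewrite subrK subrr.
have [c [[m cm] h0]] := dim_dependence (hbdd _) (leqnn k.+1) (fun n : 'I_k.+1 => wu n).
(* By [kill] only the Cartan term of the commutator survives; the factor 2 is the difference of the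
   entries 1 and -1 of [a2 n]. *)
have eu n : e (x m) (y m) (u n) = if (n == m :> nat) then 2%:R *: v2 n else 0.
  rewrite /u qee kill linear0 add0r; case: ifP => [/eqP -> | nm].
    rewrite !eqxx !mulr1n !w2 !a2E (negPf (xs' _)) (negPf (ys' _)) !eqxx !xy !yx.
    by rewrite subr0 sub0r scaleN1r opprK scale1r -mulr2n scaler_nat.
  by rewrite yinj xinj nm eq_sym nm !mulr0n subr0.
have := congr1 (e (x m) (y m)) h0; rewrite linear0 linear_sum (bigD1 m) //=.
rewrite big1 ?addr0 => [|n nm]; last first.
  by rewrite linearZ /= eu -(inj_eq val_inj) in nm *; rewrite (negPf nm) scaler0.
rewrite linearZ /= eu eqxx scalerA => /eqP.
by rewrite scaler_eq0 (negPf (nz2 m)) mulf_eq0 pnatr_eq0 (negPf cm).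
Qed.

End MaxSupport.

(** The sum of all $E_{ii}$ is not in $\mathfrak q(\infty)$, so its action is read off from the
    truncations, which stabilize on each vector of a given degree. *)
Definition has_degree (K : numFieldType) (V : lmodType K) (q : qrep V)
    (c : K) (v : V) : Prop :=
  exists n0, forall n, (n0 <= n)%N -> \sum_(0 <= i < n) qe q i i v = c *: v.

Definition qsimple (K : numFieldType) (V : lmodType K) (q : qrep V) : Prop :=
  (exists v : V, v != 0) /\
  forall U : V -> Prop, subsp U -> (forall i j v, U v -> U (qe q i j v)) ->
    (forall i j v, U v -> U (qo q i j v)) -> (forall v, U v -> U (qs q v)) ->
    (exists2 v, v != 0 & U v) -> forall v, U v.

Lemma sum_delta_if (V : zmodType) n k (F : nat -> V) : (k < n)%N ->
  \sum_(0 <= j < n) F j *+ (j == k) = F k.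
Proof. by move=> h; apply: sum_nat_delta. Qed.

Section Degree.
Variables (K : numFieldType) (V : lmodType K) (q : qrep V) (c : K).

Lemma has_degree_subsp : subsp (has_degree q c).
Proof.
split; first by exists 0%N => n _; rewrite big1 ?scaler0 // => i _; rewrite linear0.
move=> x u v [n1 h1] [n2 h2]; exists (maxn n1 n2) => n.
rewrite geq_max => /andP [hn1 hn2].
under eq_bigr do rewrite linearP.
by rewrite big_split -scaler_sumr /= h1 // h2 // scalerDr !scalerA mulrC.
Qed.

Lemma has_degree_e i j v : has_degree q c v -> has_degree q c (qe q i j v).
Proof.
move=> [n0 h0]; exists (maxn n0 (maxn i.+1 j.+1)) => n.
rewrite !geq_max => /andP [hn /andP [hi hj]].
under eq_bigr do rewrite qe_diag (eq_sym j).
rewrite sumrB big_split /= !sum_delta_if // addrK -linear_sum.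
by rewrite h0 // linearZ.
Qed.

Lemma has_degree_o i j v : has_degree q c v -> has_degree q c (qo q i j v).
Proof.
move=> [n0 h0]; exists (maxn n0 (maxn i.+1 j.+1)) => n.
rewrite !geq_max => /andP [hn /andP [hi hj]].
under eq_bigr do rewrite qeo_diag (eq_sym j).
rewrite sumrB big_split /= !sum_delta_if // addrK -linear_sum.
by rewrite h0 // linearZ.
Qed.

Lemma has_degree_s v : has_degree q c v -> has_degree q c (qs q v).
Proof.
move=> [n0 h0]; exists n0 => n /h0 h.
by under eq_bigr do rewrite -qse; rewrite -linear_sum h linearZ.
Qed.

(** The truncated sums eventually commute with any given matrix unit, so the vectors of one degree
    form a submodule. *)
Lemma simple_degree v : qsimple q -> v != 0 -> has_degree q c v ->
  forall u, has_degree q c u.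
Proof.
move=> [_ hs] nz hv; apply: hs.
- exact: has_degree_subsp.
- exact: has_degree_e.
- exact: has_degree_o.
- exact: has_degree_s.
- by exists v.
Qed.
End Degree.

Lemma scaler_injr (K : fieldType) (V : lmodType K) (v : V) (a b : K) :
  v != 0 -> a *: v = b *: v -> a = b.
Proof.
move=> nz /eqP; rewrite -subr_eq0 -scalerBl scaler_eq0 (negPf nz) orbF subr_eq0.
by move/eqP.
Qed.

Lemma wsum_nz (K : numFieldType) (V : lmodType K) (q : qrep V)
    (P Q : (nat -> K) -> Prop) n v :
  (forall a w, P a -> wt q a w -> w != 0 -> Q a) ->
  wsum q P n v -> exists n', wsum q Q n' v.
Proof.
move=> hPQ; elim: n v => [|n ih] v /=; first by move=> ->; exists 0%N.
move=> [a [w [u [pa hw /ih [n' hn'] ->]]]].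
have [->|nz] := eqVneq w 0; first by exists n'; rewrite add0r.
by exists n'.+1, a, w, u; split=> //; apply: hPQ hw nz.
Qed.

(** * From one weight of maximal support to all weights *)

Section Positive.
Variables (K : numFieldType) (V : lmodType K) (q : qrep V).
Local Notation e := (qe q).
Hypothesis hall : forall v, exists n, wsum q (fun=> True) n v.
Hypothesis hsim : qsimple q.
Hypothesis hnil : forall i j a v, i != j -> wt q a v ->
  exists n, iter n (e i j) v = 0.
Variables (a0 : nat -> K) (v0 : V) (s0 : seq nat).
Hypothesis hmax : forall a v s, wt q a v -> v != 0 -> uniq s ->
  (forall i, i \in s -> a i != 0) -> (size s <= size s0)%N.
Hypotheses (wt0 : wt q a0 v0) (nz0 : v0 != 0) (us0 : uniq s0).
Hypothesis ones0 : forall i, i \in s0 -> a0 i = 1.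

Lemma sum_support (a : nat -> K) (s : seq nat) n :
  uniq s -> (forall i, i \in s -> (i < n)%N) -> (forall i, i \notin s -> a i = 0) ->
  \sum_(0 <= i < n) a i = \sum_(i <- s) a i.
Proof.
move=> us hn hs; rewrite (bigID (mem s)) /= [X in _ + X]big1 ?addr0 => [|i /hs //].
rewrite -big_filter; apply: perm_big; apply: uniq_perm => //.
  by rewrite filter_uniq // iota_uniq.
move=> i; rewrite mem_filter mem_index_iota /=.
by apply/andP/idP => [[]//|hi]; rewrite hi hn.
Qed.

Lemma seq_bound (s : seq nat) : exists n, forall i, i \in s -> (i < n)%N.
Proof.
have [b hb] := exists_fresh s; exists b => i; rewrite ltnNge.
by apply: contraL => /hb.
Qed.

Lemma ones_degree v : has_degree q (size s0)%:R v.
Proof.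
apply: (simple_degree hsim nz0).
have off i : i \notin s0 -> a0 i = 0.
  apply: (max_off hmax wt0 nz0 us0) => // j hj; by rewrite ones0 // oner_neq0.
have [n0 hn0] := seq_bound s0; exists n0 => n hn.
under eq_bigr do rewrite wt0.
rewrite -scaler_suml (sum_support us0) //; last first.
  by move=> i /hn0 hi; apply: leq_trans hn.
congr (_ *: _); rewrite big_seq (eq_bigr (fun=> 1)); last by move=> i /ones0.
by rewrite -big_seq big_const_seq count_predT iter_addr_0.
Qed.

(* Otherwise a weight of largest support among those with a bad entry has
   entries 1 and -1, with at least one -1; as their sum is [size s0], its support
   is too large. *)
Lemma ones_nat k a v s i : wt q a v -> v != 0 -> uniq s ->
  (forall i, i \in s -> a i != 0) -> (size s0 < size s + k)%N -> isnat (a i).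
Proof.
(* Induction on the room [k] left for enlarging [s]; larger supports are covered by the induction
   hypothesis. *)
elim: k a v s i => [|k ih] a v s i hv nz us hs hk.
  by move: hk; rewrite addn0 ltnNge (hmax hv nz us hs).
apply: contrapT => hni.
case: (EM (exists2 l, l \notin s & a l != 0)) => [[l hl al]|hfull].
  apply: hni; apply: (ih a v (l :: s)) => //; rewrite ?addSnnS //= ?hl //.
  by move=> j; rewrite inE => /orP [/eqP ->|/hs].
have hs' j : (j \in s) = (a j != 0).
  apply/idP/idP; first exact: hs.
  by apply: contraTT => hj; apply/negP => aj; apply: hfull; exists j.
have hpm j : j \in s -> a j = 1 \/ a j = -1.
  move=> hj; have [/eqP|h1] := boolP (a j == 1); first by left.
  have [/eqP|h2] := boolP (a j == -1); first by right.
  have [b [w [l [hl [hw nw] hb hb' hnat]]]] := split_entry hnil hv nz hs' hj h1 h2.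
  have hbn c : isnat (b c).
    by apply: (ih b w (l :: s)) => //; rewrite ?addSnnS //= hl.
  case: hni; have [->|hij] := eqVneq i j; first exact: hnat.
  have [->|hil] := eqVneq i l; last by rewrite -hb'.
  by exists 0%N; apply/eqP; rewrite -[_ == _]negbK -hs'.
have ai : a i = -1.
  case: (boolP (i \in s)) => [/hpm [h|//]|].
    by case: hni; exists 1%N.
  by rewrite hs' negbK => /eqP h; case: hni; exists 0%N.
have his : i \in s by rewrite hs' ai oppr_eq0 oner_eq0.
have hsum : \sum_(j <- s) a j = (size s0)%:R.
  have [n1 hn1] := ones_degree v; have [n2 hn2] := seq_bound s.
  have := hn1 _ (leq_maxl n1 n2); under eq_bigr do rewrite hv.
  rewrite -scaler_suml (sum_support us) => [|j /hn2 hj|j].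
  - by move=> /(scaler_injr nz).
  - exact: leq_trans (leq_maxr _ _).
  - by rewrite hs' negbK => /eqP.
(* The sum is [size s - size s0]. Yet every term is 0 or 2, and the one at [i] is 2. *)
have : \sum_(j <- s) (1 - a j) <= 0.
  rewrite sumrB hsum big_const_seq count_predT iter_addr_0 subr_le0 ler_nat.
  exact: hmax hv nz us hs.
rewrite (bigD1_seq i) //= ai opprK lt_geF //.
apply: ltr_pwDl; first by rewrite addr_gt0.
rewrite big_seq_cond; apply: sumr_ge0 => j /andP [/hpm [->|->] _].
  by rewrite subrr.
by rewrite opprK addr_ge0.
Qed.

Lemma ones_posw a v : wt q a v -> v != 0 -> posw (size s0) a.
Proof.
move=> hv nz.
have /choice [m hm] : forall i, isnat (a i).
  by move=> i; apply: (@ones_nat (size s0).+1 a v [::]).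
have [|s [us hs]] := @exists_support (fun i => a i != 0) (size s0).
  by move=> s us hs; apply: hmax hv nz us hs.
have off i : i \notin s -> a i = 0.
  by move=> hi; apply/eqP; apply: contraNT hi => /hs.
have [n1 hn1] := seq_bound s; have [n2 hn2] := ones_degree v.
exists m, (maxn n1 n2); split=> //.
  move=> i; rewrite geq_max => /andP [hi _]; apply/eqP; rewrite -(eqr_nat K) -hm.
  by rewrite off //; apply: contraL hi => /hn1; rewrite ltnNge.
have := hn2 _ (leq_maxr n1 n2); under eq_bigr do rewrite hv hm.
rewrite -scaler_suml => /(scaler_injr nz) /eqP.
by rewrite -natr_sum eqr_nat big_mkord => /eqP.
Qed.

Lemma ones_polyrep : polyrep q (size s0).
Proof.
move=> v; have [n hn] := hall v.
by apply: wsum_nz hn => a w _; apply: ones_posw.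
Qed.

End Positive.

Section Classify.
Variables (K : numClosedFieldType) (V : lmodType K).
Implicit Type q : qrep V.

Lemma wt_twist q a v : wt (twist q) a v <-> wt q (fun i => - a i) v.
Proof.
split=> h i; first by rewrite scaleNr -h /= opprK.
by rewrite /= h scaleNr opprK.
Qed.

Lemma wsum_twist q (P : (nat -> K) -> Prop) n v :
  wsum q (fun a => P (fun i => - a i)) n v -> wsum (twist q) P n v.
Proof.
elim: n v => [//|n ih] v [a [w [u [pa hw hu ->]]]].
exists (fun i => - a i), w, u; split=> //; last exact: ih.
by apply/wt_twist => i; rewrite opprK.
Qed.

Lemma qsimple_twist q : qsimple q -> qsimple (twist q).
Proof.
move=> [nz h]; split=> // U hU Ue Uo Us; apply: h => //.
  move=> i j v /(Ue j i) /= hv; rewrite -[qe q i j v]opprK -scaleN1r.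
  exact: subspZ.
move=> i j v /(Uo j i) /= hv.
have -> : qo q i j v = (- 'i : K) *: ('i *: (qo q i j v : V)).
  by rewrite scalerA mulNr -expr2 sqrCi opprK scale1r.
exact: subspZ.
Qed.

Theorem polynomial_or_dual q k :
  (forall v, exists n, wsum q (fun=> True) n v) ->
  (forall a, dim_le (wt q a) k) ->
  (forall i j a v, i != j -> wt q a v -> exists n, iter n (qe q i j) v = 0) ->
  qsimple q -> exists d, polyrep q d \/ polyrep (twist q) d.
Proof.
move=> hall hbdd hnil hsim.
(* The support sizes that occur; they are bounded by [k * k], so a maximal one exists. *)
pose P n := `[< exists a v s, [/\ wt q a v, v != 0, uniq s,
  forall i, i \in s -> a i != 0 & size s = n] >].
have hP0 : exists n, P n.
  exists 0%N; apply/asboolP; apply: contrapT => hno.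
  have [[v nz] _] := hsim; have [n hn] := hall v.
  move/eqP: nz; apply.
  have [|n' hn'] := @wsum_nz _ _ q _ (fun=> False) n v _ hn.
    by move=> a w _ hw nz; apply: hno; exists a, w, [::].
  by apply: (wsum_absurd (P := fun=> False) _ hn') => a [].
have hPk n : P n -> (n <= k * k)%N.
  move=> /asboolP [a [v [s [hv nz us hs <-]]]].
  exact: clifford_bound (hbdd a) hv nz us hs.
case: (ex_maxnP hP0 hPk) => r /asboolP [a [v [s [hv nz us hs sz]]]] hr.
have hmax b w t : wt q b w -> w != 0 -> uniq t ->
    (forall i, i \in t -> b i != 0) -> (size t <= r)%N.
  by move=> h1 h2 h3 h4; apply: hr; apply/asboolP; exists b, w, t.
have hrs : (r <= size s)%N by rewrite sz.
exists r; rewrite -sz in hmax hrs *.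
have ent i : i \in s -> a i = 1 \/ a i = -1 by move=> hi; apply: (max_entry hnil hmax hv nz us hs hrs hi).
case: (EM (exists2 i, i \in s & a i = -1)) => [[j hj aj]|hno]; last first.
  left; apply: (@ones_polyrep _ _ q hall hsim hnil a v) => // i hi.
  by case: (ent i hi) => // ai; case: hno; exists i.
right; apply: (@ones_polyrep _ _ (twist q) _ _ _ (fun i => - a i) v) => //.
- move=> w; have [n hn] := hall w; exists n; exact: wsum_twist.
- exact: qsimple_twist.
- move=> i l b w hil /wt_twist hw; have [|n hn] := hnil l i _ w _ hw.
    by rewrite eq_sym.
  exists n; have -> : iter n (qe (twist q) i l) w = (-1) ^+ n *: iter n (qe q l i) w.
    elim: n {hn} => [|n ih]; first by rewrite scale1r.
    by rewrite !iterS ih linearZ /= scalerN -scaleN1r scalerA exprSr mulrC.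
  by rewrite hn scaler0.
- move=> b w t /wt_twist hw nw ut ht; apply: hmax hw nw ut _ => i /ht.
  by rewrite oppr_eq0.
- by apply/wt_twist => i; rewrite opprK.
- move=> i hi; case: (ent i hi) => [ai|->]; last by rewrite opprK.
  by case: (max_not_mixed hnil hmax hbdd hv nz us hs hrs hi hj ai aj).
Qed.

End Classify.

(** * From modules to matrix units *)

Section LinearExtension.
Variables (K : fieldType) (T : choiceType) (a : T -> K).

Definition lext (x : {malg K[T]}) : K := \sum_(k <- msupp x) x@_k * a k.

Lemma lextEw (D : {fset T}) (x : {malg K[T]}) : (msupp x `<=` D)%fset ->
  lext x = \sum_(k <- D) x@_k * a k.
Proof.
move=> hD; apply: big_fset_incl => // k _ hk.
by rewrite mcoeff_outdom // mul0r.
Qed.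

Lemma lext_linear : linear_for *%R lext.
Proof.
move=> c x y; pose D := (msupp (c *: x + y) `|` msupp x `|` msupp y)%fset.
rewrite !(@lextEw D); try by rewrite /D ?fsubsetUr // -fsetUA ?fsubsetUl // fsetUCA fsubsetUl.
rewrite mulr_sumr -big_split /=; apply: eq_bigr => k _.
by rewrite mcoeffD mcoeffZ mulrDl mulrA.
Qed.

Lemma lextU c k : lext << c *g k >> = c * a k.
Proof.
rewrite (@lextEw [fset k]%fset); first by rewrite big_seq_fset1 mcoeffUU.
exact: msuppU_le.
Qed.

Definition lextL : {scalar {malg K[T]}} :=
  HB.pack lext (GRing.isLinear.Build K {malg K[T]} K *%R lext lext_linear).

End LinearExtension.

Section MatrixUnits.
Variable K : fieldType.

Definition eE i j : qinf K := (<< 1 *g (i, j) >>, 0).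
Definition oE i j : qinf K := (0, << 1 *g (i, j) >>).

Lemma fmulmx0l (B : glinf K) : fmulmx 0 B = 0.
Proof. by rewrite /fmulmx msupp0 big_seq_fset0. Qed.

Lemma fmulmx0r (A : glinf K) : fmulmx A 0 = 0.
Proof.
rewrite /fmulmx big1 // => u _; by rewrite msupp0 big_mkcond big_seq_fset0.
Qed.

Lemma fmulmxU i j k l : fmulmx (<< 1 *g (i, j) >> : glinf K) << 1 *g (k, l) >> =
  << 1 *g (i, l) >> *+ (j == k).
Proof.
rewrite /fmulmx !msuppU oner_eq0 big_seq_fset1 big_mkcond big_seq_fset1 /=.
by rewrite !mcoeffUU mulr1; case: (j == k).
Qed.

Lemma qinf_ind (P : qinf K -> Prop) : P 0 ->
  (forall (c : K) x y, P x -> P y -> P (c *: x + y)) ->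
  (forall i j, P (eE i j)) -> (forall i j, P (oE i j)) -> forall x, P x.
Proof.
move=> P0 Pl Pe Po [A B].
have PD x y : P x -> P y -> P (x + y) by move=> hx; rewrite -[x]scale1r; apply: Pl.
have PZ c x : P x -> P (c *: x) by move=> hx; rewrite -[_ *: _]addr0; apply: Pl.
have -> : (A, B) = (A, 0) + (0, B) :> qinf K by congr pair; rewrite ?addr0 ?add0r.
have hU c k : << c *g k >> = c *: << 1 *g k >> :> glinf K.
  by apply/malgP => k'; rewrite mcoeffZ !mcoeffU mulrnAr mulr1.
apply: PD.
  rewrite [A]monalgE; elim/big_rec: _ => [//|[i j] x _ hx].
  have -> : (<< A@_(i, j) *g (i, j) >> + x, 0) = A@_(i, j) *: eE i j + (x, 0) :> qinf K.
    by congr pair; rewrite /= ?scaler0 ?addr0 // hU.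
  exact: Pl.
rewrite [B]monalgE; elim/big_rec: _ => [//|[i j] x _ hx].
have -> : (0, << B@_(i, j) *g (i, j) >> + x) = B@_(i, j) *: oE i j + (0, x) :> qinf K.
  by congr pair; rewrite /= ?scaler0 ?addr0 // hU.
exact: Pl.
Qed.

Definition otr (x : qinf K) : K := lext (fun k => (k.1 == k.2)%:R) x.2.

Lemma otr_linear : linear_for *%R otr.
Proof. by move=> c x y; rewrite /otr /= lext_linear. Qed.

Lemma otr_e i j : otr (eE i j) = 0.
Proof. by rewrite /otr /lext /= msupp0 big_seq_fset0. Qed.

Lemma otr_o i j : otr (oE i j) = (i == j)%:R.
Proof. by rewrite /otr /= lextU mul1r. Qed.

Lemma otr_even x : qpar false x -> otr x = 0.
Proof. by rewrite /otr /= => ->; rewrite /lext msupp0 big_seq_fset0. Qed.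

End MatrixUnits.

Section Bridge.
Variables (K : numFieldType) (M : smod K).
Implicit Types (v w : M) (x y : qinf K).

Lemma actDl x y v : act M (x + y) v = act M x v + act M y v.
Proof. by rewrite -[x in LHS]scale1r (act_linearl v) scale1r. Qed.

Lemma act0l v : act M 0 v = 0.
Proof. exact: (linear0 (mklin (@act_linearl K M v))). Qed.

Lemma actBl x y v : act M (x - y) v = act M x v - act M y v.
Proof. exact: (linearB (mklin (@act_linearl K M v))). Qed.

Lemma actMnl x n v : act M (x *+ n) v = act M x v *+ n.
Proof. exact: (linearMn (mklin (@act_linearl K M v)) n). Qed.

Lemma par0 b : par M b 0. Proof. exact: par_zero. Qed.

Lemma parB b v w : par M b v -> par M b w -> par M b (v - w).
Proof. by move=> hv hw; rewrite addrC -scaleN1r; apply: par_linear. Qed.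

Lemma parD b v w : par M b v -> par M b w -> par M b (v + w).
Proof. by move=> hv hw; rewrite -[v]scale1r; apply: par_linear. Qed.

Lemma parN b v : par M b v -> par M b (- v).
Proof. by move=> hv; rewrite -sub0r; apply: parB => //; apply: par0. Qed.

(** The parity operator $v_0+v_1\mapsto v_0-v_1$. It encodes the grading by a linear involution:
    homogeneous means eigenvector, graded means stable, and one can average over it. *)
Definition sgf v : M :=
  let v0 := projT1 (cid (par_span v)) in v0 - (v - v0).

Lemma sgfE v0 v1 : par M false v0 -> par M true v1 -> sgf (v0 + v1) = v0 - v1.
Proof.
move=> h0 h1; rewrite /sgf; case: cid => w0 /= [w1 [hw0 hw1 e]].
have e0 : w0 = v0.
  apply/eqP; rewrite -subr_eq0; apply/eqP; apply: par_direct; first exact: parB.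
  have -> : w0 - v0 = v1 - w1.
    by apply/eqP; rewrite subr_eq addrAC [v1 + v0]addrC e addrK.
  exact: parB.
by rewrite e0 [v0 + v1]addrC addrK.
Qed.

Lemma sgf_linear : linear sgf.
Proof.
move=> c v w; have [v0 [v1 [h0 h1 ->]]] := par_span v.
have [w0 [w1 [k0 k1 ->]]] := par_span w.
rewrite scalerDr addrACA !sgfE //; try exact: par_linear.
by rewrite scalerBr opprD addrACA.
Qed.

Definition actL x : {linear M -> M} := mklin (act_linear (s := M) x).

Lemma actD x v w : act M x (v + w) = act M x v + act M x w.
Proof. exact: (linearD (actL x)). Qed.

Lemma actB x v w : act M x (v - w) = act M x v - act M x w.
Proof. exact: (linearB (actL x)). Qed.

Lemma sgf_act a x v : qpar a x -> sgf (act M x v) = (-1) ^+ a *: act M x (sgf v).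
Proof.
move=> hx; have [v0 [v1 [h0 h1 ->]]] := par_span v.
rewrite sgfE // actD actB; have := act_par hx h0; have := act_par hx h1.
case: a hx => hx k1 k0; last by rewrite sgfE // scale1r.
by rewrite addrC sgfE // scaleN1r opprB.
Qed.

Definition sgL : {linear M -> M} := mklin sgf_linear.

Lemma sgf_sgf v : sgf (sgf v) = v.
Proof.
have [v0 [v1 [h0 h1 ->]]] := par_span v.
by rewrite !sgfE ?opprK //; apply: parN.
Qed.

Lemma par_sgf b v : par M b v <-> sgf v = (-1) ^+ b *: v.
Proof.
split=> [|]; last first.
  have [v0 [v1 [h0 h1 ->]]] := par_span v; rewrite sgfE //.
  have two_inj (u : M) : u + u = 0 -> u = 0.
    by rewrite -mulr2n -scaler_nat => /eqP; rewrite scaler_eq0 pnatr_eq0 => /eqP.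
  case: b; rewrite ?scale1r ?scaleN1r.
    rewrite opprD => /eqP; rewrite subr_eq subrK => /eqP e.
    by rewrite (two_inj v0) ?add0r // {1}e addNr.
  move=> /addrI /eqP; rewrite eq_sym -subr_eq0 opprK => /eqP /two_inj ->.
  by rewrite addr0.
case: b => h; last by rewrite -[v]addr0 sgfE ?subr0 ?addr0 ?scale1r //; apply: par0.
by rewrite -[v]add0r sgfE ?sub0r ?add0r ?scaleN1r //; apply: par0.
Qed.

Lemma qpar_eE i j : qpar false (eE K i j). Proof. by []. Qed.
Lemma qpar_oE i j : qpar true (oE K i j). Proof. by []. Qed.

Lemma act_ee i j k l v : act M (eE K i j) (act M (eE K k l) v) =
  act M (eE K k l) (act M (eE K i j) v) + act M (eE K i l) v *+ (j == k)
  - act M (eE K k j) v *+ (l == i).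
Proof.
have := act_br v (qpar_eE i j) (qpar_eE k l).
rewrite /qbr /qmul /= !fmulmx0l !fmulmx0r !fmulmxU !addr0 !scale1r.
have -> : (<< 1 *g (i, l) >> *+ (j == k), 0) - (<< 1 *g (k, j) >> *+ (l == i), 0)
  = eE K i l *+ (j == k) - eE K k j *+ (l == i) :> qinf K.
  by case: (j == k); case: (l == i); rewrite ?mulr0n ?mulr1n; congr pair; rewrite /= ?subr0.
rewrite actBl !actMnl => /eqP; rewrite eq_sym subr_eq => /eqP ->.
by rewrite addrC addrA.
Qed.

Lemma act_eo i j k l v : act M (eE K i j) (act M (oE K k l) v) =
  act M (oE K k l) (act M (eE K i j) v) + act M (oE K i l) v *+ (j == k)
  - act M (oE K k j) v *+ (l == i).
Proof.
have := act_br v (qpar_eE i j) (qpar_oE k l).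
rewrite /qbr /qmul /= !fmulmx0l !fmulmx0r !fmulmxU !addr0 !add0r !scale1r.
have -> : (0, << 1 *g (i, l) >> *+ (j == k)) - (0, << 1 *g (k, j) >> *+ (l == i))
  = oE K i l *+ (j == k) - oE K k j *+ (l == i) :> qinf K.
  by case: (j == k); case: (l == i); rewrite ?mulr0n ?mulr1n; congr pair; rewrite /= ?subr0.
rewrite actBl !actMnl => /eqP; rewrite eq_sym subr_eq => /eqP ->.
by rewrite addrC addrA.
Qed.

Lemma act_oo i j k l v : act M (oE K i j) (act M (oE K k l) v) =
  - act M (oE K k l) (act M (oE K i j) v) + act M (eE K i l) v *+ (j == k)
  + act M (eE K k j) v *+ (l == i).
Proof.
have := act_br v (qpar_oE i j) (qpar_oE k l).
rewrite /qbr /qmul /= !fmulmx0l !fmulmx0r !fmulmxU !addr0 !add0r !scaleN1r.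
have -> : (<< 1 *g (i, l) >> *+ (j == k), 0) - - (<< 1 *g (k, j) >> *+ (l == i), 0)
  = eE K i l *+ (j == k) + eE K k j *+ (l == i) :> qinf K.
  case: (j == k); case: (l == i); rewrite ?mulr0n ?mulr1n; congr pair;
    by rewrite /= ?oppr0 ?opprK ?addr0.
rewrite actDl !actMnl => /eqP; rewrite eq_sym subr_eq => /eqP ->.
by rewrite addrC addrA.
Qed.

Lemma act_se i j v : sgf (act M (eE K i j) v) = act M (eE K i j) (sgf v).
Proof. by rewrite (sgf_act _ (qpar_eE i j)) scale1r. Qed.

Lemma act_so i j v : sgf (act M (oE K i j) v) = - act M (oE K i j) (sgf v).
Proof. by rewrite (sgf_act _ (qpar_oE i j)) scaleN1r. Qed.

Definition qof : qrep M :=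
  @QRep K M (fun i j => actL (eE K i j)) (fun i j => actL (oE K i j)) sgL
    act_ee act_eo act_oo sgf_sgf act_se act_so.

End Bridge.

Arguments qof {K} M.

Section Weights.
Variables (K : numFieldType) (M : smod K).

Lemma cdiag_act (h : cartan K) (v : M) :
  act M (cdiag h) v = \sum_(i <- msupp h) h@_i *: act M (eE K i i) v.
Proof.
pose L := mklin (act_linearl (s := M) v).
have -> : cdiag h = \sum_(i <- msupp h) h@_i *: eE K i i.
  rewrite /cdiag; elim/big_rec2: _ => // i x y _ <-.
  congr pair; rewrite /= ?scaler0 ?addr0 //; congr (_ + _).
  by apply/malgP => k'; rewrite mcoeffZ !mcoeffU mulrnAr mulr1.
rewrite -[act M _ v]/(L _) linear_sum; apply: eq_bigr => i _.
by rewrite linearZ.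
Qed.

Lemma scalar_coeff (lam : {scalar cartan K}) h :
  lam h = \sum_(i <- msupp h) h@_i * lam << 1 *g i >>.
Proof.
rewrite {1}[h]monalgE linear_sum; apply: eq_bigr => i _.
rewrite -[RHS]linearZ /=; congr (lam _).
by apply/malgP => k'; rewrite mcoeffZ !mcoeffU mulrnAr mulr1.
Qed.

Lemma weight_wt (lam : {scalar cartan K}) (v : M) :
  weight_space lam v <-> wt (qof M) (fun i => lam << 1 *g i >>) v.
Proof.
split=> h; last first.
  move=> c; rewrite cdiag_act scalar_coeff scaler_suml; apply: eq_bigr => i _.
  by have := h i; rewrite /= => ->; rewrite scalerA.
move=> i; have := h << 1 *g i >>; rewrite cdiag_act.
by rewrite msuppU oner_eq0 big_seq_fset1 mcoeffUU scale1r.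
Qed.

Lemma wt_weight (a : nat -> K) (v : M) :
  wt (qof M) a v <-> weight_space (lextL a) v.
Proof.
split=> h; first by apply/weight_wt => i; rewrite h /= lextU mul1r.
by move/weight_wt: h => h i; rewrite h /= lextU mul1r.
Qed.

Lemma weight_wsum : weight_module M ->
  forall v : M, exists n, wsum (qof M) (fun=> True) n v.
Proof.
move=> [hM _] v; have [n [lam [w [hw ->]]]] := hM v.
exists n; elim: n lam w hw => [|n ih] lam w hw; first by rewrite big_ord0.
rewrite big_ord_recl; exists (fun i => lam ord0 << 1 *g i >>), (w ord0).
exists (\sum_(i < n) w (lift ord0 i)); split=> //.
  exact/weight_wt.
by apply: (ih (fun i => lam (lift ord0 i))) => i.
Qed.

Lemma bounded_wt : bounded M -> exists k, forall a, dim_le (wt (qof M) a) k.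
Proof.
move=> [k [_ hk]]; exists k => a; have [f [h1 h2]] := hk (lextL a).
by exists f; split=> [i|v /wt_weight/h2 //]; apply/wt_weight.
Qed.

(** The iterates have pairwise different weights, so the nonzero ones are independent; by
    integrability they span a space of finite dimension. *)
Lemma wt_nilpotent : weight_module M -> integrable M ->
  forall i j a v, i != j -> wt (qof M) a v ->
  exists n, iter n (qe (qof M) i j) v = 0.
Proof.
move=> [_ hdir] hint i j a v hij hv; have [k hk] := hint (eE K i j) v.
pose u n := iter n (act M (eE K i j)) v.
have hu (n : 'I_k.+1) : lin_span u (u n).
  exists n.+1, (fun t => (t == ord_max)%:R).
  rewrite (bigD1 ord_max) //= eqxx scale1r big1 ?addr0 // => t /negPf ->.
  by rewrite scale0r.
have [c [[m cm] h0]] := dim_dependence hk (leqnn k.+1) hu.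
pose b n := fun c : nat => a c + (c == i)%:R *+ n - (c == j)%:R *+ n.
have wu n : wt (qof M) (b n) (u n).
  elim: n => [|n ih]; first by move=> x; rewrite /b !mulr0n addr0 subr0 hv.
  have := wt_shift i j ih.
  suff -> : shiftw (b n) i j = b n.+1 by [].
  apply/funext => x; rewrite /b /shiftw !mulrSr opprD !addrA.
  by congr (_ - _); rewrite addrAC.
have hd : forall i0 j0 : 'I_k.+1, lextL (b i0) =1 lextL (b j0) -> i0 = j0.
  move=> x y /(_ << 1 *g i >>); rewrite /= !lextU !mul1r /b eqxx (negPf hij).
  by rewrite !mul0rn !subr0 => /addrI /eqP; rewrite eqr_nat => /eqP/val_inj.
have hw (n : 'I_k.+1) : weight_space (lextL (b n)) (c n *: u n).
  by apply/wt_weight/wtZ.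
have /eqP := hdir _ _ _ hd hw h0 m.
by rewrite scaler_eq0 (negPf cm) => /eqP h; exists m.
Qed.

(** A subspace stable under the parity operator contains the components
    $\frac12(w\pm\mathrm{sg}\,w)$ of its vectors, hence is graded. *)
Lemma simple_qsimple : simple M -> qsimple (qof M).
Proof.
move=> [[v nz] h]; split; first by exists v; apply/eqP.
move=> U hU Ue Uo Us [u nu Uu].
have gU : graded_submodule U.
  split.
  - by case: hU.
  - by move=> c x y; apply: hU.2.
  - move=> x w hw; elim/qinf_ind: x => [|c x y hx hy|i j|i j].
    + by rewrite act0l; case: hU.
    + by rewrite (act_linearl w); apply: hU.2.
    + exact: (Ue i j).
    + exact: (Uo i j).
  - move=> w hw; have [w0 [w1 [h0 h1 ew]]] := par_span w.
    have := Us _ hw; rewrite /= ew sgfE // => hs; rewrite ew in hw.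
    exists w0, w1; split=> //; split=> //.
      have -> : w0 = 2%:R^-1 *: ((w0 + w1) + (w0 - w1)).
        rewrite addrACA subrr addr0 -mulr2n -scaler_nat scalerA mulVf ?scale1r //.
        by rewrite pnatr_eq0.
      by apply: subspZ => //; apply: subspD.
    have -> : w1 = 2%:R^-1 *: ((w0 + w1) - (w0 - w1)).
      rewrite opprB addrCA (addrC w0 w1) addrK.
      rewrite -mulr2n -scaler_nat scalerA mulVf ?scale1r //.
      by rewrite pnatr_eq0.
    by apply: subspZ => //; apply: subspB.
case: (h U gU) => // h0; by case/eqP: nu; apply: h0.
Qed.

End Weights.

Theorem simple_polyrep (K : numClosedFieldType) (M : smod K) :
  in_BInt M -> simple M ->
  exists d, polyrep (qof M) d \/ polyrep (twist (qof M)) d.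
Proof.
move=> [hw hi /bounded_wt [k hk]] hs.
apply: (polynomial_or_dual (k := k)) => //.
- exact: weight_wsum.
- exact: wt_nilpotent.
- exact: simple_qsimple.
Qed.

(** * Extensions of simple modules *)

(** The kernel of [theta] is a submodule, and it is nonzero because [theta] has square 0. *)
Lemma theta_simple (K : numFieldType) (V : lmodType K) (q : qrep V) d v :
  polyrep q d -> qsimple q -> theta q v = 0.
Proof.
move=> hq [[w nw] hs]; pose U v := theta q v = 0.
apply: (hs U).
- split; first exact: (linear0 (thetaL hq)).
  move=> c u u' hu hu'; rewrite /U (theta_linear hq) hu hu'.
  by rewrite scaler0 addr0.
- by move=> i j u hu; rewrite /U (theta_e hq) hu linear0.
- by move=> i j u hu; rewrite /U (theta_o hq) hu linear0 oppr0.
- by move=> u hu; rewrite /U (theta_s hq) hu linear0 oppr0.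
- have [h|h] := eqVneq (theta q w) 0; first by exists w.
  by exists (theta q w) => //; apply: theta_theta.
Qed.

Lemma simple_o_vanish (K : numClosedFieldType) (V : lmodType K) (q : qrep V) d v :
  polyrep q d \/ polyrep (twist q) d -> qsimple q ->
  exists n0, forall a, (n0 <= a)%N -> qo q a a v = 0.
Proof.
move=> [hq|hq] hs.
  have [n0 h0] := thetaE hq v; exists n0 => a /h0 [_ ->].
  exact: theta_simple hq hs.
have [n0 h0] := thetaE hq v; exists n0 => a /h0 [_].
rewrite (theta_simple _ hq (qsimple_twist hs)) /= => /eqP.
by rewrite scaler_eq0 (negPf (neq0Ci _)) => /eqP.
Qed.

(** Exact sequences of matrix-unit actions rather than of [smod], so that all three terms can be
    twisted together. *)
Record qses (K : numFieldType) (VM VN VE : lmodType K) (qM : qrep VM)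
    (qN : qrep VN) (qE : qrep VE) (inc : {linear VN -> VE})
    (prj : {linear VE -> VM}) : Prop := QSes {
  inc_e : forall i j n, inc (qe qN i j n) = qe qE i j (inc n);
  inc_o : forall i j n, inc (qo qN i j n) = qo qE i j (inc n);
  inc_s : forall n, inc (qs qN n) = qs qE (inc n);
  prj_e : forall i j v, prj (qe qE i j v) = qe qM i j (prj v);
  prj_o : forall i j v, prj (qo qE i j v) = qo qM i j (prj v);
  prj_s : forall v, prj (qs qE v) = qs qM (prj v);
  qinc_inj : injective inc;
  qprj_surj : forall m, exists v, prj v = m;
  qexact : forall v, prj v = 0 <-> exists n, v = inc n
}.

Section Extension.
Variables (K : numFieldType) (VM VN VE : lmodType K) (qM : qrep VM).
Variables (qN : qrep VN) (qE : qrep VE) (inc : {linear VN -> VE}).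
Variable prj : {linear VE -> VM}.
Hypothesis H : qses qM qN qE inc prj.
Hypothesis hall : forall v, exists n, wsum qE (fun=> True) n v.

Lemma prj_inc n : prj (inc n) = 0.
Proof. by apply/(qexact H); exists n. Qed.

Lemma inc_neq0 n : inc n != 0 -> n != 0.
Proof. by apply: contraNneq => ->; rewrite linear0. Qed.

Lemma wt_prj a v : wt qE a v -> wt qM a (prj v).
Proof. by move=> h i; rewrite -(prj_e H) h linearZ. Qed.

Lemma wt_inc a n : wt qE a (inc n) -> wt qN a n.
Proof. by move=> h i; apply: (qinc_inj H); rewrite (inc_e H) h linearZ. Qed.

Lemma wt_ext a v : wt qE a v -> v != 0 ->
  (exists2 m, wt qM a m & m != 0) \/ (exists2 n, wt qN a n & n != 0).
Proof.
move=> hv nz; have [h0|h] := eqVneq (prj v) 0.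
  have [n en] := (qexact H v).1 h0; right; exists n; last by rewrite inc_neq0 -?en.
  by apply: wt_inc; rewrite -en.
by left; exists (prj v) => //; apply: wt_prj.
Qed.

Lemma polyrep_wt (V : lmodType K) (q : qrep V) d a (v : V) :
  polyrep q d -> wt q a v -> v != 0 -> posw d a.
Proof.
move=> hq hv; have [n hn] := hq v; move/eqP; apply: contra_notP => hno.
apply: (wsum_ind_joint (B := fun=> True) (c := a) (Q := fun v => v = 0) _ _ _ hn) => //.
- by move=> u w -> ->; rewrite addr0.
- by move=> b w hb hw hba; case: hno; have -> : a = b by apply/funext => i; rewrite hba.
Qed.

Lemma polyrep_ext d : polyrep qM d -> polyrep qN d -> polyrep qE d.
Proof.
move=> hM hN v; have [n hn] := hall v; apply: wsum_nz hn => a w _ hw nz.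
by case: (wt_ext hw nz) => -[u hu nu]; [apply: (polyrep_wt hM hu nu)|apply: (polyrep_wt hN hu nu)].
Qed.

(** Induction on the weight decomposition of a preimage. A term of weight [a] is set aside; a term
    of another weight [b] is removed by $(E_{ii}-b_i)/(a_i-b_i)$, which fixes the image [m]. *)
Lemma lift_weight a m : wt qM a m -> exists2 v, wt qE a v & prj v = m.
Proof.
have [v ev] := qprj_surj H m; have [n hn] := hall v.
elim: n v m ev hn => [|n ih] v m /=.
  by move=> <- -> _; exists 0; rewrite ?linear0 // => i; rewrite linear0 scaler0.
move=> ev [b [w [u [_ hw hu evw]]]] hm.
case: (EM (b = a)) => [eb|hne].
  have [||x hx ex] := ih u (m - prj w) _ hu.
  - by rewrite -ev evw linearD addrC addKr.
  - move=> i; rewrite linearB hm -(prj_e H) hw eb linearZ scalerBr.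
    by [].
  exists (w + x); last by rewrite linearD ex addrC subrK.
  by move=> i; rewrite linearD hw hx eb scalerDr.
have [i hi] : exists i, b i != a i.
  apply: contrapT => hno; apply: hne; apply/funext => i; apply/eqP.
  by apply: contrapT => hi; apply: hno; exists i; apply/negP.
have nz : a i - b i != 0 by rewrite subr_eq0 eq_sym.
apply: (ih ((a i - b i)^-1 *: (qe qE i i u - b i *: u)) m) => //.
  have -> : qe qE i i u - b i *: u = qe qE i i v - b i *: v.
    by rewrite evw linearD hw scalerDr opprD addrACA subrr add0r.
  rewrite linearZ linearB linearZ (prj_e H) ev hm /= -scalerBl scalerA mulVf //.
  by rewrite scale1r.
by apply/wsumZ/wsum_sub.
Qed.

(** Lifts of a finite spanning family of the weight space of the quotient generate this stage modulo
    the kernel. *)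
Lemma ext_fgmod d k : (forall a, dim_le (wt qM a) k) ->
  fgmod (fun v => prj v = 0) (stage qE d d 0 d).
Proof.
move=> hk; pose a c : K := (c < d)%N%:R.
have sta v : stage qE d d 0 d v <-> wt qE a v.
  split=> [[h1 h2] c|h]; rewrite /a.
    case: (boolP (c < d)%N) => hc; first by rewrite scale1r h1.
    by rewrite scale0r h2 //; lia.
  split=> c hc.
    have hcd : (c < d)%N by lia.
    by rewrite h /a hcd scale1r.
  have hcd : (c < d)%N = false by lia.
  by move=> _; rewrite h /a hcd scale0r.
have [f [hf1 hf2]] := hk a.
have /choice [x hx] : forall i, exists v, wt qE a v /\ prj v = f i.
  by move=> i; have [v h1 h2] := lift_weight (hf1 i); exists v.
exists [seq x i | i <- enum 'I_k]; split.
  by move=> _ /mapP [i _ ->]; apply/sta; case: (hx i).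
move=> U hU hN hxs v /sta/wt_prj/hf2 [c hc].
have -> : v = (v - \sum_(i < k) c i *: x i) + \sum_(i < k) c i *: x i by rewrite subrK.
apply: subspD => //.
  apply: hN; rewrite linearB linear_sum hc; apply/eqP; rewrite subr_eq0.
  by apply/eqP/eq_bigr => i _; rewrite linearZ (hx i).2.
apply: subsp_sum => // i _; apply: subspZ => //.
by apply: hxs; apply: map_f; rewrite mem_enum.
Qed.

(* The class [t] of an extension, and a retraction [r] of [inc] which is
   equivariant up to [t]. *)
Definition ext_datum (r : VE -> VN) (t : VM -> VN) : Prop :=
  [/\ linear r, forall n, r (inc n) = n,
   [/\ forall i j v, r (qe qE i j v) = qe qN i j (r v),
       forall i j v, r (qo qE i j v) = qo qN i j (r v) + t (prj v) *+ (i == j)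
     & forall v, r (qs qE v) = qs qN (r v)]
   & forall v, exists n0, forall a, (n0 <= a)%N -> qo qE a a v = inc (t (prj v))].

Lemma ext_datum_poly d k : polyrep qM d -> polyrep qN d ->
  qsimple qM -> qsimple qN -> (forall a, dim_le (wt qM a) k) ->
  exists r t, ext_datum r t.
Proof.
move=> hM hN sM sN hk; have hE := polyrep_ext hM hN.
pose NN (v : VE) := prj v = 0.
have thN n : theta qE (inc n) = 0.
  have [n1 h1] := thetaE hE (inc n); have [n2 h2] := thetaE hN n.
  have [_ <-] := h1 _ (leq_maxl n1 n2); have [_ h] := h2 _ (leq_maxr n1 n2).
  by rewrite -(inc_o H) h (theta_simple n hN sN) linear0.
have thP v : NN (theta qE v).
  have [n1 h1] := thetaE hE v; have [n2 h2] := thetaE hM (prj v).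
  have [_ <-] := h1 _ (leq_maxl n1 n2); have [_ h] := h2 _ (leq_maxr n1 n2).
  by rewrite /NN (prj_o H) h; apply: theta_simple hM sM.
have [|||||||rho [h1 h2 h3 [h4 h5 h6]]] := @splitting_theta K VE qE d hE NN.
- split; first exact: linear0.
  by move=> c u v hu hv; rewrite /NN linearP hu hv scaler0 addr0.
- by move=> i j v hv; rewrite /NN (prj_e H) hv linear0.
- by move=> i j v hv; rewrite /NN (prj_o H) hv linear0.
- by move=> v hv; rewrite /NN (prj_s H) hv linear0.
- by move=> v /(qexact H) [n ->].
- exact: thP.
- exact: ext_fgmod hk.
have /choice [r hr] : forall v, exists n, rho v = inc n.
  by move=> v; apply/(qexact H); apply: h2.
have /choice [g hg] := qprj_surj H.
(* [g] is a mere set-theoretic section; the choice is harmless because [theta] vanishes on the image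
   of [inc]. *)
pose t m := r (theta qE (g m)).
have ht v : inc (t (prj v)) = theta qE v.
  rewrite /t -hr (h3 _ (thP _)).
  have /(qexact H) [n en] : prj (v - g (prj v)) = 0 by rewrite linearB hg subrr.
  have := thN n; rewrite -en (thetaB hE) => /eqP; rewrite subr_eq0.
  by move/eqP.
have inj := qinc_inj H.
exists r, t; split.
- by move=> c u v; apply: inj; rewrite -hr h1 linearP !hr.
- by move=> n; apply: inj; rewrite -hr h3 //; apply: prj_inc.
- split=> [i j v|i j v|v]; apply: inj.
  + by rewrite (inc_e H) -!hr h4.
  + by rewrite linearD linearMn /= ht (inc_o H) -!hr h5.
  + by rewrite (inc_s H) -!hr h6.
- by move=> v; have [n0 h] := thetaE hE v; exists n0 => a /h [_ ->].
Qed.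

(** The vectors of degree [cM] form a complement of the image of [inc] that is stable under the
    action; projecting along it gives an extension of class 0. *)
Lemma ext_datum_degree (cM cN : K) : cM != cN ->
  (forall m, has_degree qM cM m) -> (forall n, has_degree qN cN n) ->
  (forall m, exists n0, forall a, (n0 <= a)%N -> qo qM a a m = 0) ->
  (forall n, exists n0, forall a, (n0 <= a)%N -> qo qN a a n = 0) ->
  exists r t, ext_datum r t.
Proof.
move=> hne hM hN oM oN.
have deg_prj c v : has_degree qE c v -> has_degree qM c (prj v).
  move=> [n0 h0]; exists n0 => n /h0 h.
  by under eq_bigr do rewrite -(prj_e H); rewrite -linear_sum h linearZ.
have deg_inc n : has_degree qE cN (inc n).
  have [n0 h0] := hN n; exists n0 => k /h0 h.
  by under eq_bigr do rewrite -(inc_e H); rewrite -linear_sum h linearZ.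
have deg_uniq (V : lmodType K) (q : qrep V) (v : V) :
    has_degree q cM v -> has_degree q cN v -> v = 0.
  move=> [n1 h1] [n2 h2]; have := h1 _ (leq_maxl n1 n2).
  rewrite (h2 _ (leq_maxr n1 n2)) => /eqP; rewrite eq_sym -subr_eq0 -scalerBl.
  by rewrite scaler_eq0 subr_eq0 (negPf hne) => /eqP.
have hsub := has_degree_subsp qE cM.
have hex v : exists n, has_degree qE cM (v - inc n).
  have [n hn] := hall v; elim: n v hn => [|n ih] v /=.
    by move=> ->; exists 0; rewrite linear0 subr0; case: hsub.
  move=> [a [w [u [_ hw /ih [x hx] ->]]]].
  (* A weight vector either lies in the image of [inc], or its weight occurs in the quotient, so
     that it has degree [cM] itself. *)
  have [y hy] : exists y, has_degree qE cM (w - inc y).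
    have [/(qexact H) [y ->]|nz] := eqVneq (prj w) 0.
      by exists y; rewrite subrr; case: hsub.
    exists 0; rewrite linear0 subr0; have [n0 h0] := hM (prj w).
    exists n0 => k /h0; under eq_bigr do rewrite (wt_prj hw).
    rewrite -scaler_suml => /(scaler_injr nz) e.
    by under eq_bigr do rewrite hw; rewrite -scaler_suml e.
  by exists (y + x); rewrite linearD opprD addrACA; apply: subspD.
have [r hr] := choice hex.
have inj := qinc_inj H.
have runiq v n : has_degree qE cM (v - inc n) -> r v = n.
  move=> h; apply: inj; apply/eqP; rewrite -subr_eq0; apply/eqP.
  apply: deg_uniq; last by rewrite -linearB.
  have -> : inc (r v) - inc n = (v - inc n) - (v - inc (r v)).
    by rewrite opprB [RHS]addrC addrA subrK.
  exact: subspB.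
exists r, (fun=> 0); split.
- move=> c u v; apply: runiq; rewrite linearP opprD addrACA -scalerBr.
  exact: hsub.2.
- by move=> n; apply: runiq; rewrite subrr; case: hsub.
- split=> [i j v|i j v|v]; apply: runiq.
  + by rewrite (inc_e H) -linearB; apply: has_degree_e.
  + by rewrite mul0rn addr0 (inc_o H) -linearB; apply: has_degree_o.
  + by rewrite (inc_s H) -linearB; apply: has_degree_s.
- move=> v; rewrite linear0.
  have [n1 h1] := oM (prj v); have [n2 h2] := oN (r v).
  exists (maxn n1 n2) => a; rewrite geq_max => /andP [/h1 e1 /h2 e2].
  have ev : v = (v - inc (r v)) + inc (r v) by rewrite subrK.
  rewrite ev linearD -(inc_o H) e2 linear0 addr0.
  have /(qexact H) [n en] : prj (qo qE a a (v - inc (r v))) = 0.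
    by rewrite (prj_o H) linearB prj_inc subr0.
  apply: deg_uniq; last by rewrite en.
  by apply: has_degree_o.
Qed.

End Extension.

Section Signed.
Variables (K : numClosedFieldType).

Lemma polyrep_degree (V : lmodType K) (q : qrep V) d : polyrep q d ->
  forall v, has_degree q d%:R v.
Proof.
move=> hq v; have [n0 h0] := poly_degree hq v; exists n0 => n /h0.
by rewrite big_mkord.
Qed.

Lemma twist_degree (V : lmodType K) (q : qrep V) d : polyrep (twist q) d ->
  forall v, has_degree q (- d%:R) v.
Proof.
move=> hq v; have [n0 h0] := polyrep_degree hq v; exists n0 => n /h0 /=.
by rewrite sumrN scaleNr => <-; rewrite opprK.
Qed.

(** In degree 0 the only weight is 0, its own negative. This is the one case in which a polynomial
    and a dual module have the same signed degree. *)
Lemma twist_polyrep0 (V : lmodType K) (q : qrep V) :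
  polyrep (twist q) 0 -> polyrep q 0.
Proof.
move=> hq v; have [n hn] := hq v; exists n; elim: n v hn => [//|n ih] v.
move=> [a [w [u [pa /wt_twist hw /ih hu ->]]]]; exists a, w, u; split=> //.
have [m [k [hm hm0 /eqP hs]]] := pa.
have -> : a = (fun i => - a i); last by [].
apply/funext => i; rewrite hm; suff -> : m i = 0%N by rewrite oppr0.
case: (ltnP i k) => [hi|/hm0 //].
by move: hs; rewrite sum_nat_eq0 => /forallP /(_ (Ordinal hi)) /= /eqP.
Qed.

Variables (VM VN VE : lmodType K) (qM : qrep VM).
Variables (qN : qrep VN) (qE : qrep VE) (inc : {linear VN -> VE}).
Variable prj : {linear VE -> VM}.
Hypothesis H : qses qM qN qE inc prj.
Hypothesis hall : forall v, exists n, wsum qE (fun=> True) n v.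

Lemma qses_twist : qses (twist qM) (twist qN) (twist qE) inc prj.
Proof.
split=> [i j n|i j n|n|i j v|i j v|v|||] /=.
- by rewrite linearN (inc_e H).
- by rewrite linearZ (inc_o H).
- exact: inc_s H _.
- by rewrite linearN (prj_e H).
- by rewrite linearZ (prj_o H).
- exact: prj_s H _.
- exact: qinc_inj H.
- exact: qprj_surj H.
- exact: qexact H.
Qed.

(** The twisted odd action carries the factor ['i], so the class is multiplied by its inverse
    [- 'i]. *)
Lemma ext_datum_twist r t :
  ext_datum (twist qN) (twist qE) inc prj r t ->
  ext_datum qN qE inc prj r (fun m => - 'i *: t m).
Proof.
move=> [h1 h2 [h3 h4 h5] h6].
have inv_i (V : lmodType K) (x : V) : x = (- 'i : K) *: (('i : K) *: x).
  by rewrite scalerA mulNr -expr2 sqrCi opprK scale1r.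
have rN v : r (- v) = - r v by exact: (linearN (mklin h1)).
have rZ c v : r (c *: v) = c *: r v by exact: (linearZ_LR (mklin h1)).
split=> //; last first.
  move=> v; have [n0 h0] := h6 v; exists n0 => a /h0 /= e.
  by rewrite linearZ /= -e -inv_i.
split=> [i j v|i j v|//].
  by have := h3 j i v; rewrite /= rN => /oppr_inj.
have := h4 j i v; rewrite /= rZ => e.
by rewrite (inv_i _ (r _)) e scalerDr -inv_i scalerMnr eq_sym.
Qed.

Theorem ext_datum_exists dM dN k :
  polyrep qM dM \/ polyrep (twist qM) dM ->
  polyrep qN dN \/ polyrep (twist qN) dN ->
  qsimple qM -> qsimple qN -> (forall a, dim_le (wt qM a) k) ->
  exists r t, ext_datum qN qE inc prj r t.
Proof.
move=> pM pN sM sN hk.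
have oM m := simple_o_vanish m pM sM; have oN n := simple_o_vanish n pN sN.
have mismatch cM cN : cM != cN -> (forall m, has_degree qM cM m) ->
    (forall n, has_degree qN cN n) -> exists r t, ext_datum qN qE inc prj r t.
  by move=> hne hM hN; apply: (ext_datum_degree H hall hne hM hN oM oN).
have both_poly d : polyrep qM d -> polyrep qN d ->
    exists r t, ext_datum qN qE inc prj r t.
  by move=> hM hN; apply: (ext_datum_poly H hall hM hN sM sN hk).
have cases0 a b : ((a%:R : K) == - b%:R) = (a == 0%N) && (b == 0%N).
  by rewrite -subr_eq0 opprK -natrD pnatr_eq0 addn_eq0.
case: pM pN => [hM|hM] [hN|hN].
- have [e|hne] := eqVneq dM dN; first by apply: (both_poly dM) => //; rewrite e.
  apply: (mismatch dM%:R dN%:R); rewrite ?eqr_nat //; exact: polyrep_degree.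
- have [|hne] := boolP ((dM%:R : K) == - dN%:R).
    rewrite cases0 => /andP [/eqP e1 /eqP e2].
    by apply: (both_poly 0%N); [rewrite -e1|apply: twist_polyrep0; rewrite -e2].
  apply: (mismatch _ _ hne); [exact: polyrep_degree|exact: twist_degree].
- have [|hne] := boolP (- (dM%:R : K) == dN%:R).
    rewrite eq_sym cases0 => /andP [/eqP e1 /eqP e2].
    by apply: (both_poly 0%N); [apply: twist_polyrep0; rewrite -e2|rewrite -e1].
  apply: (mismatch _ _ hne); [exact: twist_degree|exact: polyrep_degree].
- have [e|hne] := eqVneq dM dN.
    have hallT v : exists n, wsum (twist qE) (fun=> True) n v.
      by have [n hn] := hall v; exists n; apply: wsum_twist.
    have hkT a : dim_le (wt (twist qM) a) k.
      have [f [h1 h2]] := hk (fun i => - a i); exists f; split=> [i|v].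
        exact/wt_twist.
      by move=> /wt_twist /h2.
    have [|r [t hd]] := ext_datum_poly qses_twist hallT hM _ (qsimple_twist sM)
      (qsimple_twist sN) hkT; first by rewrite e.
    by exists r, (fun m => - 'i *: t m); apply: ext_datum_twist.
  apply: (mismatch (- dM%:R) (- dN%:R)); rewrite ?eqr_opp ?eqr_nat //;
  exact: twist_degree.
Qed.

End Signed.

(** * Schur's lemma *)

Section LinearFacts.
Variables (K : pzRingType) (V W : lmodType K) (f : V -> W) (fl : linear f).

Lemma linZ c v : f (c *: v) = c *: f v.
Proof. exact: (linearZ_LR (mklin fl)). Qed.

Lemma linD v w : f (v + w) = f v + f w.
Proof. exact: (linearD (mklin fl)). Qed.

Lemma linB v w : f (v - w) = f v - f w.
Proof. exact: (linearB (mklin fl)). Qed.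

Lemma lin0 : f 0 = 0.
Proof. exact: (linear0 (mklin fl)). Qed.

End LinearFacts.

Section Homs.
Variables (K : numFieldType) (M N : smod K).

Lemma hom_sgf (f : M -> N) v : is_hom f -> f (sgf v) = sgf (f v).
Proof.
move=> [fl fp _]; have [v0 [v1 [h0 h1 ->]]] := par_span v.
by rewrite sgfE // (linB fl) (linD fl) sgfE //; apply: fp.
Qed.

Lemma is_hom_sgf (f : M -> N) : linear f ->
  (forall x v, f (act M x v) = act N x (f v)) ->
  (forall v, f (sgf v) = sgf (f v)) -> is_hom f.
Proof.
move=> fl fa fs; split=> // b v /par_sgf h; apply/par_sgf.
by rewrite -fs h (linZ fl).
Qed.

Lemma hom0 (f : M -> N) : is_hom f -> f 0 = 0.
Proof. by move=> [fl _ _]; exact: (linear0 (mklin fl)). Qed.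

End Homs.

Section SchurIso.
Variables (K : numFieldType) (M N : smod K).

Lemma hom_component (f : M -> N) v0 v1 : is_hom f ->
  par M false v0 -> par M true v1 -> f (v0 + v1) = 0 -> f v0 = 0 /\ f v1 = 0.
Proof.
move=> [fl fp _] h0 h1; have -> : f (v0 + v1) = f v0 + f v1 by exact: (linearD (mklin fl)).
move=> e; have e0 : f v0 = 0.
  apply: par_direct; first exact: fp.
  have -> : f v0 = - f v1 by apply/eqP; rewrite -addr_eq0 e.
  by apply: parN; apply: fp.
by split=> //; rewrite e0 add0r in e.
Qed.

Lemma schur_iso (f : M -> N) : is_hom f -> simple M -> simple N ->
  (exists m, f m <> 0) -> smod_iso M N.
Proof.
move=> hf [_ sM] [_ sN] [m0 nz]; have [fl fp fa] := hf.
have f0 := hom0 hf.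
have fD : {morph f : u v / u + v} by exact: (linD fl).
have fB : {morph f : u v / u - v} by exact: (linearB (mklin fl)).
have hker m : f m = 0 -> m = 0.
  have [] := sM (fun m => f m = 0); first split.
  - exact: f0.
  - by move=> c u v hu hv; rewrite fl hu hv scaler0 addr0.
  - by move=> x v hv; rewrite fa hv (lin0 (act_linear (s := N) x)).
  - move=> v hv; have [v0 [v1 [h0 h1 ev]]] := par_span v.
    rewrite ev in hv; have [e0 e1] := hom_component hf h0 h1 hv.
    by exists v0, v1.
  - by move=> h; apply: h.
  - by move=> h; case: nz; apply: h.
have himg n : exists m, f m = n.
  have [] := sN (fun n => exists m, f m = n); first split.
  - by exists 0.
  - by move=> c _ _ [u <-] [v <-]; exists (c *: u + v); rewrite fl.
  - by move=> x _ [v <-]; exists (act M x v); rewrite fa.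
  - move=> _ [v <-]; have [v0 [v1 [h0 h1 ->]]] := par_span v.
    exists (f v0), (f v1); split; [by split; [exists v0|apply: fp]|
      by split; [exists v1|apply: fp]|exact: fD].
  - by move=> h; case: nz; apply: h; exists m0.
  - by move=> h; apply: h.
have finj : injective f.
  by move=> u v e; apply/eqP; rewrite -subr_eq0; apply/eqP/hker; rewrite fB e subrr.
have [g hg] := choice himg.
exists f, g; split=> //; last by move=> m; apply: finj; rewrite hg.
apply: is_hom_sgf.
- by move=> c u v; apply: finj; rewrite fl !hg.
- by move=> x v; apply: finj; rewrite fa !hg.
- by move=> v; apply: finj; rewrite (hom_sgf (g v) hf) !hg.
Qed.

End SchurIso.

Lemma simple_Pi (K : fieldType) (N : smod K) : simple N -> simple (Pi N).
Proof.
move=> [nz h]; split=> // U [U0 Ul Ua Ug]; apply: h; split=> // v hv.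
have [v0 [v1 [[h0 p0] [h1 p1] e]]] := Ug v hv.
by exists v1, v0; split=> //; rewrite addrC.
Qed.

Section Eigen.
Variables (K : numClosedFieldType) (V : lmodType K) (h : {linear V -> V}).

Definition pev (p : {poly K}) (v : V) : V :=
  \sum_(i < size p) p`_i *: iter i h v.

Lemma pevE (p : {poly K}) (v : V) n : (size p <= n)%N -> pev p v = \sum_(i < n) p`_i *: iter i h v.
Proof.
move=> hn; rewrite /pev (big_ord_widen n (fun i => p`_i *: iter i h v) hn).
rewrite [RHS](bigID (fun i : 'I_n => (i < size p)%N)) /= [X in _ + X]big1 ?addr0 //.
by move=> i; rewrite -leqNgt => /(nth_default 0) ->; rewrite scale0r.
Qed.

Lemma pev_mul (p : {poly K}) z (v : V) : pev (p * ('X - z%:P)) v = pev p (h v - z *: v).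
Proof.
have hs : (size (p * ('X - z%:P))%R <= (size p).+1)%N.
  have [->|nz] := eqVneq p 0; first by rewrite mul0r size_poly0.
  by rewrite size_Mmonic ?monicXsubC // size_XsubC addn2.
have hit i : iter i h (h v - z *: v) = iter i.+1 h v - z *: iter i h v.
  elim: i => [//|i ih]; by rewrite !iterS ih linearB linearZ.
rewrite (pevE _ hs) (eq_bigr (fun i : 'I__ =>
  (p * 'X)`_i *: iter i h v - z *: (p`_i *: iter i h v))); last first.
  by move=> i _; rewrite mulrBr coefB coefMC scalerBl scalerA [z * _]mulrC.
rewrite sumrB big_ord_recl coefMX scale0r add0r.
rewrite [X in _ - X]big_ord_recr /= nth_default // scale0r scaler0 addr0 -sumrB.
apply: eq_bigr => i _; rewrite coefMX /= hit scalerBr !scalerA [z * _]mulrC.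
by [].
Qed.

(** A dependence among the iterates of [v] gives a nonzero polynomial in [h] that kills [v]. Peeling
    off its linear factors, the first one that yields 0 exhibits an eigenvector. *)
Lemma exists_eigenvector k (U : V -> Prop) v : dim_le U k -> U v -> v != 0 ->
  (forall u, U u -> U (h u)) -> exists c w, w != 0 /\ h w = c *: w.
Proof.
move=> hU Uv nz hh.
have hu (n : 'I_k.+1) : U (iter n h v).
  by elim: (n : nat) => [//|m ih]; rewrite iterS; apply: hh.
have [c [[m cm] h0]] := dim_dependence hU (leqnn k.+1) hu.
pose p := \poly_(i < k.+1) c (inord i).
have p0 : p != 0.
  apply: contraNneq cm => e; have := congr1 (fun q : {poly K} => q`_m) e.
  by rewrite coef_poly ltn_ord inord_val coef0 => ->.
have hp : pev p v = 0.
  rewrite (@pevE _ _ k.+1) ?size_poly // -[RHS]h0; apply: eq_bigr => i _.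
  by rewrite coef_poly ltn_ord inord_val.
have [rs ep] := closed_field_poly_normal p.
have : pev (\prod_(z <- rs) ('X - z%:P)) v = 0.
  have e : pev p v = lead_coef p *: pev (\prod_(z <- rs) ('X - z%:P)) v.
    rewrite {1}ep (@pevE _ _ (size (\prod_(z <- rs) ('X - z%:P)))) ?size_scale_leq //.
    by rewrite scaler_sumr; apply: eq_bigr => i _; rewrite coefZ scalerA.
  move/eqP: hp; rewrite e scaler_eq0 lead_coef_eq0 (negPf p0) => /eqP.
  exact.
elim: rs v {hp ep hu h0 Uv} nz => [|z rs ih] v nz.
  rewrite big_nil /pev size_poly1 big_ord1 coef1 scale1r /= => e.
  by rewrite e eqxx in nz.
rewrite big_cons mulrC pev_mul.
have [e _|nz'] := eqVneq (h v - z *: v) 0; last exact: ih.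
by exists z, v; split=> //; apply/eqP; rewrite -subr_eq0 e.
Qed.

End Eigen.

(** The module may have infinite dimension, but [h] preserves each weight space, where it has an
    eigenvector; the eigenspace of [h] is a submodule. *)
Lemma schur_scalar (K : numClosedFieldType) (M : smod K) (h : M -> M) :
  weight_module M -> bounded M -> simple M -> is_hom h ->
  exists c, forall m, h m = c *: m.
Proof.
move=> hw /bounded_wt [k hk] /simple_qsimple sM hh; have [hl _ ha] := hh.
have [[v nz] sM2] := sM.
have [a [w [wa nw]]] : exists a w, wt (qof M) a w /\ w != 0.
  apply: contrapT => hno; have [n hn] := weight_wsum hw v.
  have [|n' hn'] := @wsum_nz _ _ (qof M) _ (fun=> False) n v _ hn.
    by move=> a w _ hw' nw; apply: hno; exists a, w.
  by move/eqP: nz; apply; apply: (wsum_absurd (P := fun=> False) _ hn') => a [].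
have [|c [u [nu eu]]] := @exists_eigenvector K M (mklin hl) k _ w (hk a) wa nw.
  by move=> u hu i; rewrite /= -ha -[act M _ u]/(qe (qof M) i i u) hu (linZ hl).
exists c; apply: (sM2 (fun m => h m = c *: m)).
- split; first by rewrite hom0 // scaler0.
  by move=> x y z hy hz; rewrite hl hy hz scalerDr !scalerA mulrC.
- by move=> i j m hm; rewrite ha hm (linZ (act_linear (s := M) _)).
- by move=> i j m hm; rewrite ha hm (linZ (act_linear (s := M) _)).
- by move=> m hm; rewrite /= hom_sgf // hm (linZ (@sgf_linear K M)).
- by exists u.
Qed.

(** * Classes of extensions *)

(* The class of an extension: the odd map [t : M -> N] by which the odd Cartan
   elements of large index act. *)
Definition ext_class (K : numClosedFieldType) (M N : smod K) (E : ses M N)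
    (t : M -> N) : Prop :=
  forall v : mid E, exists n0, forall a, (n0 <= a)%N ->
    act (mid E) (oE K a a) v = inc E (t (prj E v)).

Section Classes.
Variables (K : numClosedFieldType) (M N : smod K).

Lemma incI (E : ses M N) n n' : inc E n = inc E n' -> n = n'.
Proof. exact: Defs.inc_inj. Qed.

Lemma ext_class_uniq (E : ses M N) t t' :
  ext_class E t -> ext_class E t' -> t =1 t'.
Proof.
move=> h h' m; have [v <-] := prj_surj E m.
have [n1 h1] := h v; have [n2 h2] := h' v; apply: (incI (E := E)).
by rewrite -(h1 _ (leq_maxl n1 n2)) -(h2 _ (leq_maxr n1 n2)).
Qed.

Lemma prj_inc0 (E : ses M N) n : prj E (inc E n) = 0.
Proof. by apply/ses_exact; exists n. Qed.

Lemma ext_class_linear (E : ses M N) t : ext_class E t -> linear t.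
Proof.
move=> h c m m'; have [v <-] := prj_surj E m; have [v' <-] := prj_surj E m'.
have [il _ _] := inc_hom E; have [pl _ _] := prj_hom E.
have [n1 h1] := h v; have [n2 h2] := h v'; have [n3 h3] := h (c *: v + v').
pose a := maxn n1 (maxn n2 n3); apply: (incI (E := E)).
rewrite -pl -(h3 a) ?il -?(h1 a) -?(h2 a) ?act_linear // /a !leq_max leqnn ?orbT //.
Qed.

Lemma ext_class_e (E : ses M N) t i j m : ext_class E t ->
  t (act M (eE K i j) m) = act N (eE K i j) (t m).
Proof.
move=> h; have [v <-] := prj_surj E m.
have [_ _ ia] := inc_hom E; have [_ _ pa] := prj_hom E.
have [n1 h1] := h v; have [n2 h2] := h (act _ (eE K i j) v).
pose a := maxn (maxn n1 n2) (maxn i.+1 j.+1); apply: (incI (E := E)).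
have ja : (j == a) = false by rewrite /a; lia.
have ai : (a == i) = false by rewrite /a; lia.
have e1 := h1 a (leq_trans (leq_maxl _ _) (leq_maxl _ _)).
have e2 := h2 a (leq_trans (leq_maxr _ _) (leq_maxl _ _)).
have := act_eo i j a a v; rewrite ja ai e1 e2 !mulr0n addr0 subr0 ia pa.
by move=> <-.
Qed.

Lemma ext_class_o (E : ses M N) t i j m : ext_class E t ->
  t (act M (oE K i j) m) = - act N (oE K i j) (t m).
Proof.
move=> h; have [v <-] := prj_surj E m.
have [il _ ia] := inc_hom E; have [_ _ pa] := prj_hom E.
have [n1 h1] := h v; have [n2 h2] := h (act _ (oE K i j) v).
pose a := maxn (maxn n1 n2) (maxn i.+1 j.+1); apply: (incI (E := E)).
have ja : (j == a) = false by rewrite /a; lia.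
have ai : (a == i) = false by rewrite /a; lia.
have e1 := h1 a (leq_trans (leq_maxl _ _) (leq_maxl _ _)).
have e2 := h2 a (leq_trans (leq_maxr _ _) (leq_maxl _ _)).
have := act_oo i j a a v; rewrite ja ai e1 e2 !mulr0n !addr0 pa => e3.
by rewrite -scaleN1r (linZ il) scaleN1r ia e3 opprK.
Qed.

Lemma ext_class_s (E : ses M N) t m : ext_class E t ->
  t (sgf m) = - sgf (t m).
Proof.
move=> h; have [v <-] := prj_surj E m.
have hi := inc_hom E; have [il _ _] := hi.
have [n1 h1] := h v; have [n2 h2] := h (sgf v).
apply: (incI (E := E)).
rewrite -scaleN1r (linZ il) scaleN1r (hom_sgf _ hi) -(hom_sgf _ (prj_hom E)).
rewrite -(h2 (maxn n1 n2)) ?leq_maxr // -(h1 (maxn n1 n2)) ?leq_maxl //.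
by rewrite act_so opprK.
Qed.

(** A class anticommutes with the odd matrix units. The parity operator supplies the other sign, so
    that the composite commutes with the action, which [Pi] leaves unchanged. *)
Lemma ext_class_hom (E : ses M N) t : ext_class E t ->
  @is_hom K M (Pi N) (fun m => t (sgf m)).
Proof.
move=> h; have tl := ext_class_linear h.
have sl := @sgf_linear K M.
split.
- by move=> c u v; rewrite sl tl.
- move=> b v /par_sgf hv; change (par N (~~ b) (t (sgf v))); apply/par_sgf.
  rewrite -[LHS]opprK -(ext_class_s _ h) sgf_sgf hv (linZ tl) scalerA.
  by rewrite -signr_addb -scaleN1r addNb addbb.
- move=> x v; elim/qinf_ind: x => [|c x y hx hy|i j|i j].
  + by rewrite !act0l (lin0 sl) (lin0 tl).
  + by rewrite (act_linearl v) sl tl hx hy -(act_linearl (s := N)).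
  + by rewrite act_se (ext_class_e _ _ _ h).
  + by rewrite act_so -scaleN1r (linZ tl) scaleN1r (ext_class_o _ _ _ h) opprK.
Qed.

Lemma class_trivial (E : ses M N) t : ext_class E t -> simple M -> simple N ->
  ~ smod_iso M (Pi N) -> t =1 (fun=> 0).
Proof.
move=> h sM sN hiso m; apply: contrapT => hm; apply: hiso.
apply: (schur_iso (ext_class_hom h) sM (simple_Pi sN)).
by exists (sgf m); rewrite sgf_sgf.
Qed.

Lemma ses_qses (E : ses M N) (il : linear (inc E)) (pl : linear (prj E)) :
  qses (qof M) (qof N) (qof (mid E)) (mklin il) (mklin pl).
Proof.
have hi := inc_hom E; have hp := prj_hom E.
have [_ _ ia] := hi; have [_ _ pa] := hp.
split=> /=; try by move=> *; rewrite ?ia ?pa ?(hom_sgf _ hi) ?(hom_sgf _ hp).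
- exact: Defs.inc_inj.
- exact: prj_surj.
- exact: ses_exact.
Qed.

(** In the coordinates [r] and [prj] the middle term is $N\oplus M$ with the action corrected by
    [otr x] times the class, the shape of [glued] below. *)
Theorem ext_retraction (E : ext M N) : in_BInt M -> in_BInt N ->
  simple M -> simple N -> exists (r : mid E -> N) (t : M -> N),
  [/\ linear r, forall n, r (inc E n) = n,
      forall x v, r (act (mid E) x v) = act N x (r v) + otr x *: t (prj E v),
      forall v, r (sgf v) = sgf (r v) & ext_class E t].
Proof.
move=> hM hN sM sN; have [il _ _] := inc_hom E; have [pl _ _] := prj_hom E.
have [dM pM] := simple_polyrep hM sM; have [dN pN] := simple_polyrep hN sN.
have [_ _ /bounded_wt [k hk]] := hM.
have [r [t [h1 h2 [h3 h4 h5] h6]]] := ext_datum_exists (ses_qses il pl)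
  (weight_wsum (ext_weight E)) pM pN (simple_qsimple sM) (simple_qsimple sN) hk.
exists r, t; split=> // x v.
elim/qinf_ind: x => [|c x y hx hy|i j|i j].
- by rewrite !act0l (lin0 h1) /otr /lext msupp0 big_seq_fset0 scale0r addr0.
- rewrite (act_linearl v) h1 hx hy (act_linearl (r v)) otr_linear.
  by rewrite scalerDr scalerDl addrACA scalerA.
- by rewrite otr_e scale0r addr0; apply: h3.
- by rewrite otr_o scaler_nat; apply: h4.
Qed.

(** A vector is determined by its image in [M] and its value under the retraction. If the classes
    agree, the map matching these coordinates is a morphism. *)
Lemma class_equiv (E E' : ext M N) t t' : in_BInt M -> in_BInt N ->
  simple M -> simple N -> ext_class E t -> ext_class E' t' ->
  t =1 t' <-> ses_equiv E E'.
Proof.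
move=> hM hN sM sN ht ht'; split=> [e|[f [[fl fp fa] fi fj]]]; last first.
  move=> m; have [v <-] := prj_surj E m.
  have [n1 h1] := ht v; have [n2 h2] := ht' (f v); apply: (incI (E := E')).
  rewrite -fi -(h1 _ (leq_maxl n1 n2)) fa (h2 _ (leq_maxr n1 n2)).
  by rewrite fj.
have [r [s [rl rid ra rs hs]]] := ext_retraction E hM hN sM sN.
have [r' [s' [rl' rid' ra' rs' hs']]] := ext_retraction E' hM hN sM sN.
have es : s =1 s'.
  by move=> m; rewrite (ext_class_uniq hs ht) e (ext_class_uniq ht' hs').
have hp := prj_hom E; have hp' := prj_hom E'.
have [pl _ pa] := hp; have [pl' _ pa'] := hp'.
have [il' _ ia'] := inc_hom E'.
have uniq' (u v : mid E') : prj E' u = prj E' v -> r' u = r' v -> u = v.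
  move=> h1 h2; have /ses_exact [n en] : prj E' (u - v) = 0.
    by rewrite (linB pl') h1 subrr.
  have : r' (u - v) = 0 by rewrite (linB rl') h2 subrr.
  rewrite en rid' => n0; rewrite n0 (lin0 il') in en.
  by apply/eqP; rewrite -subr_eq0 en.
have /choice [f hf] : forall v : mid E, exists u : mid E',
    prj E' u = prj E v /\ r' u = r v.
  move=> v; have [u hu] := prj_surj E' (prj E v).
  exists (u + inc E' (r v - r' u)); split.
    by rewrite (linD pl') prj_inc0 addr0.
  by rewrite (linD rl') rid' addrC subrK.
have hf1 v : prj E' (f v) = prj E v by case: (hf v).
have hf2 v : r' (f v) = r v by case: (hf v).
exists f; split=> //.
- apply: is_hom_sgf.
  + by move=> c u v; apply: uniq'; rewrite ?pl' ?rl' ?hf1 ?hf2 ?pl ?rl.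
  + move=> x v; apply: uniq'; first by rewrite pa' !hf1 pa.
    by rewrite ra' !hf2 hf1 ra es.
  + move=> v; apply: uniq'.
      by rewrite (hom_sgf _ hp') !hf1 (hom_sgf _ hp).
    by rewrite rs' !hf2 rs.
- move=> n; apply: uniq'; first by rewrite hf1 !prj_inc0.
  by rewrite hf2 rid rid'.
Qed.

Lemma class_scale (E E' : ext M N) t t' (c : K) : ext_class E t ->
  ext_class E' t' -> ses_scale c E E' -> forall m, t' m = c *: t m.
Proof.
move=> ht ht' [f [[fl fp fa] fi fj]] m; have [v <-] := prj_surj E m.
have [n1 h1] := ht v; have [n2 h2] := ht' (f v); apply: (incI (E := E')).
by rewrite -fi -(h1 _ (leq_maxl n1 n2)) fa (h2 _ (leq_maxr n1 n2)) fj.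
Qed.

(** The pullback [F] embeds into the sum of [E1] and [E2], so there $H_a$ acts by the pair of
    classes for large [a]; the pushout map adds the components. *)
Lemma class_baer (E1 E2 E : ext M N) t1 t2 t : ext_class E1 t1 ->
  ext_class E2 t2 -> ext_class E t -> baer_sum E1 E2 E ->
  forall m, t m = t1 m + t2 m.
Proof.
move=> c1 c2 c [F [[f [[fl _ fa] fi fj]] [g [[gl _ ga] gi gj]]]] m.
have [v ev] := prj_surj F m.
have [pF _ _] := prj_hom F.
have [i1 _ _] := inc_hom E1; have [i2 _ _] := inc_hom E2.
(* A vector killed by [f] has image 0 in [M], so it comes from the sum of two copies of [N], on
   which [f] is the inclusion. *)
have finj u w : f u = f w -> u = w.
  move=> e; have : f (u - w) = 0 by rewrite (linB fl) e subrr.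
  move=> e0; have := fj (u - w); rewrite e0 => -[/esym p0 _].
  have p1 : prj F (u - w) = 0.
    by rewrite p0; case: (prj_hom E1) => pl1 _ _; exact: (lin0 pl1).
  have [[a b] eab] := (ses_exact (s := F) (u - w)).1 p1.
  have := fi (a, b); rewrite -eab e0 => -[/esym ea /esym eb].
  have a0 : a = 0 by apply: (incI (E := E1)); rewrite (lin0 i1).
  have b0 : b = 0 by apply: (incI (E := E2)); rewrite (lin0 i2).
  have [iF _ _] := inc_hom F.
  apply/eqP; rewrite -subr_eq0 eab a0 b0.
  by have := lin0 iF => /= ->.
case efv : (f v) => [v1 v2].
have [p1 p2] : prj E1 v1 = m /\ prj E2 v2 = m.
  by have := fj v; rewrite efv ev => -[].
have [n1 h1] := c1 v1; have [n2 h2] := c2 v2; have [n3 h3] := c (g v).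
pose a := maxn n1 (maxn n2 n3).
have ea : act (mid F) (oE K a a) v = inc F (t1 m, t2 m).
  apply: finj; rewrite fa fi efv /=; congr pair.
    by rewrite h1 ?p1 // /a leq_maxl.
  by rewrite h2 ?p2 // /a !leq_max leqnn orbT.
apply: (incI (E := E)); rewrite -[t1 m + t2 m]/((t1 m, t2 m).1 + (t1 m, t2 m).2).
by rewrite -gi -ea ga h3 ?gj ?ev // /a !leq_max leqnn !orbT.
Qed.

End Classes.

(** * The odd trace and the extension with a given class *)

Section OddTrace.
Variable K : fieldType.

Lemma lext_fmulmxC (A B : glinf K) :
  lext (fun k => (k.1 == k.2)%:R) (fmulmx A B) =
  lext (fun k => (k.1 == k.2)%:R) (fmulmx B A).
Proof.
have tr (C D : glinf K) : lext (fun k => (k.1 == k.2)%:R) (fmulmx C D) =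
    \sum_(u <- msupp C) \sum_(v <- msupp D)
      (C@_u * D@_v) *+ ((u.2 == v.1) && (v.2 == u.1)).
  pose L := lextL (fun k : nat * nat => (k.1 == k.2)%:R : K).
  rewrite -[LHS]/(L _) linear_sum; apply: eq_bigr => u _.
  rewrite linear_sum big_mkcond; apply: eq_bigr => v _ /=.
  rewrite lextU /= (eq_sym v.2); case: (u.2 == v.1) => //=.
  by rewrite mulr_natr.
rewrite !tr exchange_big; apply: eq_bigr => u _; apply: eq_bigr => v _.
by rewrite mulrC andbC.
Qed.

Lemma lext0 (T : choiceType) (a : T -> K) : lext a 0 = 0.
Proof. by rewrite /lext msupp0 big_seq_fset0. Qed.

(** A bracket of elements of equal parity is even, where [otr] is 0; for an even and an odd element
    [otr] is the trace of a commutator. *)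
Lemma otr_br a b (x y : qinf K) : qpar a x -> qpar b y -> otr (qbr a b x y) = 0.
Proof.
have oB u c v : otr (u - c *: v) = otr u - c * otr v.
  by rewrite addrC -scaleNr otr_linear mulNr addrC.
rewrite /qbr oB; case: x => [A B]; case: y => [C D].
case: a; case: b => /= -> ->; rewrite /otr /qmul /= ?fmulmx0l ?fmulmx0r.
- by rewrite addr0 lext0 mulr0 subr0.
- by rewrite ?addr0 ?add0r mul1r lext_fmulmxC subrr.
- by rewrite ?addr0 ?add0r mul1r lext_fmulmxC subrr.
- by rewrite addr0 lext0 mulr0 subr0.
Qed.
End OddTrace.

Section Construction.
Variables (K : numClosedFieldType) (M N : smod K) (t : M -> N).
Hypothesis t_lin : linear t.
Hypothesis t_par : forall b m, par M b m -> par N (~~ b) (t m).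
Hypothesis t_act : forall a x m, qpar a x ->
  t (act M x m) = (-1) ^+ a *: act N x (t m).

Let car : lmodType K := (N * M)%type.
Let xpar b (v : car) := par N b v.1 /\ par M b v.2.
Let xact x (v : car) : car := (act N x v.1 + otr x *: t v.2, act M x v.2).

Let xpar_linear b (c : K) v w : xpar b v -> xpar b w -> xpar b (c *: v + w).
Proof. by move=> [? ?] [? ?]; split; apply: par_linear. Qed.

Let xpar_zero b : xpar b 0.
Proof. by split; apply: par_zero. Qed.

Let xpar_span v : exists v0 v1, [/\ xpar false v0, xpar true v1 & v = v0 + v1].
Proof.
case: v => n m; have [n0 [n1 [? ? ->]]] := par_span n.
have [m0 [m1 [? ? ->]]] := par_span m.
by exists (n0, m0), (n1, m1).
Qed.

Let xpar_direct v : xpar false v -> xpar true v -> v = 0.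
Proof.
case: v => n m [/= n0 m0] [/= n1 m1].
by rewrite (par_direct n0 n1) (par_direct m0 m1).
Qed.

Let xact_linear x : linear (xact x).
Proof.
move=> c u v; rewrite /xact /= !act_linear t_lin; congr pair => /=.
by rewrite !scalerDr !scalerA addrACA mulrC.
Qed.

Let xact_linearl v : linear (xact^~ v).
Proof.
move=> c x y; rewrite /xact (act_linearl v.1) (act_linearl v.2) otr_linear.
by congr pair; rewrite /= scalerDl scalerDr !scalerA addrACA.
Qed.

Let xact_par a b x v : qpar a x -> xpar b v -> xpar (a (+) b) (xact x v).
Proof.
move=> hx [h1 h2]; split; last exact: act_par.
rewrite /=; apply: parD; first exact: act_par.
case: a hx => hx; last by rewrite otr_even // scale0r; apply: par_zero.
by rewrite -[_ *: _]addr0; apply: par_linear; [apply: t_par|apply: par_zero].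
Qed.

Let xact_br a b x y v : qpar a x -> qpar b y ->
  xact (qbr a b x y) v
    = xact x (xact y v) - (-1) ^+ (a && b) *: xact y (xact x v).
Proof.
move=> hx hy; rewrite /xact (otr_br hx hy) scale0r addr0 /= !(act_br _ hx hy).
congr pair; rewrite /= (t_act _ hx) (t_act _ hy) !actD.
rewrite !(linZ (act_linear (s := N) _)) scalerDr scalerDr.
set s := (-1) ^+ (a && b); set p := act N x (act N y _); set p' := act N y (act N x _).
set u := act N x (t _); set w := act N y (t _).
(* [otr y] vanishes unless [y] is odd; then [s] is $(-1)^a$ and cancels the sign with which [t]
   passes [x]. The terms with [otr x] are symmetric. *)
have e1 : otr y *: u - s *: (otr y *: ((-1) ^+ a *: u)) = 0.
  case: b hy @s => hy s; last by rewrite (otr_even hy) !scale0r scaler0 subr0.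
  by rewrite !scalerA /s andbT mulrAC -expr2 sqrr_sign mul1r subrr.
have e2 : otr x *: ((-1) ^+ b *: w) - s *: (otr x *: w) = 0.
  case: a hx @s e1 => hx s _; last by rewrite (otr_even hx) !scale0r scaler0 subr0.
  by rewrite !scalerA /s andTb mulrC subrr.
rewrite (subr0_eq e1) (subr0_eq e2).
set D := s *: (otr y *: _); set C := s *: (otr x *: w).
by rewrite -(addrA p) -(addrA _ C) (addrC C D) opprD addrACA subrr addr0.
Qed.

Definition glued : smod K :=
  @SMod K car xpar xact xpar_linear xpar_zero xpar_span xpar_direct
    xact_linear xact_linearl xact_par xact_br.

Let ginc (n : N) : glued := (n, 0).
Let gprj (v : glued) : M := v.2.

Let ginc_hom : is_hom ginc.
Proof.
split=> [c u v|b v hv|x v].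
- by congr pair; rewrite /= scaler0 addr0.
- by split=> //; apply: par_zero.
- by congr pair; rewrite /= ?(lin0 t_lin) ?scaler0 ?addr0 // (lin0 (act_linear (s := M) x)).
Qed.

Let gprj_hom : is_hom gprj.
Proof. by split=> // b v []. Qed.

Let ginc_inj : injective ginc.
Proof. by move=> u v []. Qed.

Let gprj_surj m : exists v, gprj v = m.
Proof. by exists (0, m). Qed.

Let g_exact v : gprj v = 0 <-> exists n, v = ginc n.
Proof.
by case: v => n m; split=> [/= ->|[n' [_ ->]]//]; exists n.
Qed.

Definition glued_ses : ses M N := Ses ginc_hom gprj_hom ginc_inj gprj_surj g_exact.

Lemma glued_weight_space lam (v : glued) : weight_space lam v <->
  weight_space lam v.1 /\ weight_space lam v.2.
Proof.
have hE (h : cartan K) : act glued (cdiag h) v = (act N (cdiag h) v.1, act M (cdiag h) v.2).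
  by congr pair; rewrite /= otr_even // scale0r addr0.
split=> [h|[h1 h2] c]; last by rewrite hE h1 h2.
by split=> c; have := h c; rewrite hE => -[].
Qed.

Lemma glued_weight : weight_module M -> weight_module N -> weight_module glued.
Proof.
move=> [M1 M2] [N1 N2]; split.
  move=> [n m]; have [k1 [l1 [w1 [h1 ->]]]] := N1 n.
  have [k2 [l2 [w2 [h2 ->]]]] := M1 m.
  exists (k1 + k2)%N, (fun i => match split i with inl j => l1 j | inr j => l2 j end).
  exists (fun i => match split i with inl j => (w1 j, 0) | inr j => (0, w2 j) end).
  split=> [i|].
    have a0 (P : smod K) h : act P h 0 = 0 by exact: (lin0 (act_linear (s := P) h)).
    case: split => j; apply/glued_weight_space; split=> //= h; by rewrite a0 scaler0.
  have spl (j : 'I_k1) : split (lshift k2 j) = inl j by exact: unsplitK (inl j).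
  have spr (j : 'I_k2) : split (rshift k1 j) = inr j by exact: unsplitK (inr j).
  have s1 k (f : 'I_k -> N) : \sum_(i < k) ((f i, 0) : car) = (\sum_(i < k) f i, 0).
    elim: k f => [|k ih] f; first by rewrite !big_ord0.
    by rewrite !big_ord_recl ih; congr pair; rewrite /= addr0.
  have s2 k (f : 'I_k -> M) : \sum_(i < k) ((0, f i) : car) = (0, \sum_(i < k) f i).
    elim: k f => [|k ih] f; first by rewrite !big_ord0.
    by rewrite !big_ord_recl ih; congr pair; rewrite /= addr0.
  transitivity (\sum_(j < k1) ((w1 j, 0) : car) + \sum_(j < k2) ((0, w2 j) : car)).
    by rewrite s1 s2; congr pair; rewrite /= ?addr0 ?add0r.
  rewrite big_split_ord; congr (_ + _); apply: eq_bigr => j _; last by rewrite spr.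
  by rewrite spl.
move=> k lam w hlam hw hs i.
have e1 : \sum_(j < k) (w j).1 = 0 by rewrite -[RHS]/((0 : car).1) -hs raddf_sum.
have e2 : \sum_(j < k) (w j).2 = 0 by rewrite -[RHS]/((0 : car).2) -hs raddf_sum.
have hw1 j : weight_space (lam j) (w j).1 by case/glued_weight_space: (hw j).
have hw2 j : weight_space (lam j) (w j).2 by case/glued_weight_space: (hw j).
have := N2 _ _ _ hlam hw1 e1 i; have := M2 _ _ _ hlam hw2 e2 i.
by case: (w i) => x y /= -> ->.
Qed.

Definition glued_ext (hM : weight_module M) (hN : weight_module N) : ext M N :=
  @Ext K M N glued_ses (glued_weight hM hN).

Lemma glued_class (hM : weight_module M) (hN : weight_module N) :
  (forall m, exists n0, forall a, (n0 <= a)%N -> act M (oE K a a) m = 0) ->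
  (forall n, exists n0, forall a, (n0 <= a)%N -> act N (oE K a a) n = 0) ->
  ext_class (glued_ext hM hN) t.
Proof.
move=> oM oN v; have [n1 h1] := oM v.2; have [n2 h2] := oN v.1.
exists (maxn n1 n2) => a; rewrite geq_max => /andP [/h1 e1 /h2 e2].
by congr pair; rewrite /= ?e1 // e2 otr_o eqxx scale1r add0r.
Qed.

End Construction.

(** * Computation of the extension groups *)

Section Ext1.
Variable K : numClosedFieldType.

Lemma BInt_odd_vanish (M : smod K) : in_BInt M -> simple M ->
  forall m : M, exists n0, forall a, (n0 <= a)%N -> act M (oE K a a) m = 0.
Proof.
move=> hM sM m; have [d hd] := simple_polyrep hM sM.
exact: (simple_o_vanish m hd (simple_qsimple sM)).
Qed.

Lemma exists_class (M N : smod K) (E : ext M N) : in_BInt M -> in_BInt N ->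
  simple M -> simple N -> exists t, ext_class E t.
Proof.
by move=> hM hN sM sN; have [r [t [_ _ _ _ h]]] := ext_retraction E hM hN sM sN; exists t.
Qed.

Lemma Ext1_zero (M N : smod K) : in_BInt M -> in_BInt N -> simple M ->
  simple N -> ~ smod_iso M (Pi N) -> Ext1_isomorphic M N 'rV[K]_0.
Proof.
move=> hM hN sM sN hiso; exists (fun=> 0); split.
- move=> E E'; split=> // _.
  have [t ht] := exists_class E hM hN sM sN.
  have [t' ht'] := exists_class E' hM hN sM sN.
  apply/(class_equiv hM hN sM sN ht ht') => m.
  by rewrite (class_trivial ht sM sN hiso) (class_trivial ht' sM sN hiso).
- move=> w; have [wM _ _] := hM; have [wN _ _] := hN.
  (* The zero map as class gives the split extension, a witness that extensions exist at all. *)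
  have z_lin : linear (fun _ : M => 0 : N) by move=> c u v; rewrite scaler0 addr0.
  have z_par b m : par M b m -> par N (~~ b) 0 by move=> _; apply: par_zero.
  have z_act a (x : qinf K) (m : M) : qpar a x -> 0 = (-1) ^+ a *: act N x 0.
    by move=> _; rewrite (lin0 (act_linear (s := N) x)) scaler0.
  exists (glued_ext z_lin z_par z_act wM wN).
  by rewrite [w]thinmx0.
- by move=> *; rewrite addr0.
- by move=> *; rewrite scaler0.
Qed.

(** All classes are multiples of one odd map: composing the even map attached to a class with the
    isomorphism back from [Pi M] gives an endomorphism, a scalar by Schur's lemma. *)
Lemma Ext1_line (M : smod K) : in_BInt M -> simple M -> smod_iso M (Pi M) ->
  Ext1_isomorphic M M K^o.
Proof.
move=> hM sM [f [g [hf hg fK gK]]]; have [wM _ bM] := hM.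
have [fl fp fa] := hf; have sl := @sgf_linear K M.
(* [f] commutes with odd elements without a sign; precomposing the parity operator makes it
   anticommute with them, as a class does. *)
pose T c (m : M) : M := c *: (f (sgf m) : M).
have [[v nv] _] := sM.
have T_inj c c' : T c =1 T c' -> c = c'.
  move=> /(_ (sgf v)); rewrite /T sgf_sgf; apply: scaler_injr.
  by apply/eqP => e; apply: nv; rewrite -[v]fK e; apply: hom0 hg.
have hT E t : ext_class (E : ext M M) t -> exists c, t =1 T c.
  move=> ht; have [hl hp ha] := ext_class_hom ht.
  have [gl gp ga] := hg.
  have hgt : is_hom (fun m => g (t (sgf m))).
    split=> [c u w|b w hw|x w].
    - by rewrite hl gl.
    - by apply: gp; apply: hp.
    - by rewrite ha ga.
  have [c hc] := schur_scalar wM bM sM hgt.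
  exists c => m; have := hc (sgf m); rewrite sgf_sgf => e.
  by have := gK (t m); rewrite e (linZ fl) => <-.
have /choice [cl hcl] : forall E : ext M M, exists c, ext_class E (T c).
  move=> E; have [t ht] := exists_class E hM hM sM sM.
  have [c hc] := hT E t ht; exists c => w; have [n0 h0] := ht w.
  by exists n0 => a /h0 ->; rewrite hc.
exists cl; split.
- move=> E E'; split=> [e|].
    by apply/(class_equiv hM hM sM sM (hcl E) (hcl E')); rewrite e.
  by move/(class_equiv hM hM sM sM (hcl E) (hcl E'))/T_inj.
- move=> c; have T_lin : linear (T c).
    by move=> x u w; rewrite /T sl fl scalerDr !scalerA mulrC.
  have T_par b m : par M b m -> par M (~~ b) (T c m).
    move=> /par_sgf e; rewrite /T e (linZ fl) scalerA.
    have : par (Pi M) b (f m) by apply: fp; apply/par_sgf.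
    move=> h; rewrite -[_ *: _]addr0; apply: par_linear; last exact: par_zero.
    exact: h.
  have T_act a x m : qpar a x -> T c (act M x m) = (-1) ^+ a *: act M x (T c m).
    move=> hx; rewrite /T (sgf_act _ hx) (linZ fl) fa (linZ (act_linear (s := M) x)).
    by rewrite !scalerA mulrC.
  exists (glued_ext T_lin T_par T_act wM wM); apply: T_inj.
  apply: ext_class_uniq (hcl _) _.
  by apply: glued_class; apply: BInt_odd_vanish.
- move=> E1 E2 E hE; apply: T_inj => m.
  rewrite (class_baer (hcl E1) (hcl E2) (hcl E) hE) /T.
  by rewrite scalerDl.
- move=> c E E' hE; apply: T_inj => m.
  by rewrite (class_scale (hcl E) (hcl E') hE) /T scalerA.
Qed.

End Ext1.

Theorem theorem6p2 (R : realType) (M N : smod R[i])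
    (hM : in_BInt M) (hN : in_BInt N) (sM : simple M) (sN : simple N)
    (hMN : ~ iso_up_to_parity M N) :
  Ext1_isomorphic M N 'rV[R[i]]_0 /\
  (~ smod_iso M (Pi M) -> Ext1_isomorphic M M 'rV[R[i]]_0) /\
  (smod_iso M (Pi M) -> Ext1_isomorphic M M R[i]^o).
Proof.
split; first by apply: Ext1_zero => // h; apply: hMN; right.
by split=> h; [apply: Ext1_zero|apply: Ext1_line].
Qed.
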